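(* Let $X$ be a normed linear space and $Y$ a Banach space such that the pair $(X,Y)$ has property (LA$_1$) with $C_{\mathrm A}\ge1$ and $X$ has property (LA$_1$) with $C_{\mathrm M}\ge1$. Assume further that $k\in\mathbb N\cup\{\infty\}$ and the pair $(X,Y)$ has property (LA$_k$). Let $\Omega\subset X$ be an open set and let $A\subset\Omega$ be relatively closed (in $\Omega$) such that each component of $\Omega$ has a non-empty intersection with $A$. Suppose that (a) there is $C_{\mathrm E}\ge1$ such that every $Q$-Lipschitz mapping from $A$ to $Y$ can be extended to a $C_{\mathrm E}Q$-Lipschitz mapping on $\Omega$, and (b) the pair $(A,Y)$ has property (LLE). Let $L,M\ge0$ and let $f\colon A\to Y$ be an $L$-Lipschitz mapping that satisfies condition (W) with $G\colon A\to\mathcal L(X;Y)$ such that $\sup_{x\in A}\|G(x)\|\le M$. Let $\eta>1$. Then $f$ can be extended to a $\bigl(\max\{C_{\mathrm A}C_{\mathrm E}L,M\}+\eta C_{\mathrm M}(C_{\mathrm E}L+M)\bigr)$-Lipschitz mapping $g\in C^1(\Omega;Y)$ such that $Dg=G$ on $A$ and $g$ is $C^k$-smooth on $\Omega\setminus A$.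
   Context: All normed linear spaces are real. $U(x,r)$ is the open ball with centre $x$ and radius $r$, $U_X$ is the open unit ball of $X$. An $L$-Lipschitz mapping is a mapping with a (not necessarily minimal) Lipschitz constant $L$. $\mathcal L(X;Y)$ is the normed space of continuous linear operators from $X$ to $Y$. $Dg$ is the Fréchet derivative. For open $\Omega\subset X$, $C^k(\Omega;Y)$ is the space of $C^k$-smooth (in the Fréchet sense) mappings from $\Omega$ to $Y$. Condition (W): a mapping $f\colon A\to Y$, $A\subset X$, satisfies condition (W) with $G$ if $G\colon A\to\mathcal L(X;Y)$ is continuous and for each $x\in A$ the operator $G(x)$ is a strict derivative of $f$ at $x$ with respect to $A$, i.e. for each $\varepsilon>0$ there is $\delta>0$ such that $\|f(z)-f(y)-G(x)[z-y]\|\le\varepsilon\|z-y\|$ whenever $y,z\in U(x,\delta)\cap A$. Property (LLE): for normed linear spaces $X,Y$ and $A\subset X$, the pair $(A,Y)$ has property (LLE) if for every $x\in A$ there is $K\ge1$ such that for each $\delta>0$ there is an open neighbourhood $U$ of $x$ (in $X$) such that $U\subset U(x,\delta)$ and each $Q$-Lipschitz mapping from $U\cap A$ to $Y$ can be extended to a $KQ$-Lipschitz mapping on $U$. Property (LA$_k$), $k\in\mathbb N\cup\{\infty\}$: the pair $(X,Y)$ of normed linear spaces has property (LA$_k$) with $C\ge0$ if for any $L$-Lipschitz mapping $f\colon U_X\to Y$ and any $\varepsilon>0$ there is a $CL$-Lipschitz mapping $g\in C^k(U_X;Y)$ such that $\sup_{U_X}\|f-g\|\le\varepsilon$. It has property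 (LA$_k$) if it has it with some $C\ge0$. The space $X$ has property (LA$_k$) (with $C$) if the pair $(X,\mathbb R)$ does. *)

(* Defs.v *)
From HB Require Import structures.
From mathcomp Require Export all_boot all_order all_algebra.
From mathcomp Require Export all_classical all_reals all_analysis.
Export Order.TTheory GRing.Theory Num.Theory.
Export numFieldNormedType.Exports.
Set Implicit Arguments.
Unset Strict Implicit.
Unset Printing Implicit Defensive.
#[export] Set Implicit Arguments.
#[export] Unset Strict Implicit.
#[export] Unset Printing Implicit Defensive.
Global Open Scope classical_set_scope.
Global Open Scope ring_scope.

(* Mappings defined on a subset A of X are represented by total functions
   X -> Y of which only the values on A are ever constrained. *)

Section ContinuousLinearOperators.
Context (R : realType) (X Y : normedModType R).

Definition clin_pred : {pred X -> Y} :=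
  [pred f : X -> Y | `[< linear f /\ continuous f >]].

Record clin := Clin { clin_fun :> X -> Y ; clin_predP : clin_fun \in clin_pred }.

HB.instance Definition _ := [isSub for clin_fun].
HB.instance Definition _ := [Choice of clin by <:].

Lemma clin_linear (T : clin) : linear T.
Proof. by case: T => f /= /asboolP[]. Qed.

Lemma clin_continuous (T : clin) : continuous T.
Proof. by case: T => f /= /asboolP[]. Qed.

HB.instance Definition _ (T : clin) :=
  GRing.isLinear.Build R X Y *:%R (clin_fun T) (@clin_linear T).

Lemma clin_submod_closed : submod_closed clin_pred.
Proof.
split.
  apply/asboolP; split; last exact: cst_continuous.
  by move=> a u v; rewrite scaler0 addr0.
move=> a f g /asboolP[fl fc] /asboolP[gl gc]; apply/asboolP; split.
  move=> b u v; rewrite !fctE fl gl !scalerDr !scalerA.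
  by rewrite [a * b]mulrC -!addrA; congr (_ + _); rewrite addrCA.
move=> x; apply: cvgD; last exact: gc.
by apply: cvgZl_tmp; exact: fc.
Qed.

HB.instance Definition _ := GRing.isSubmodClosed.Build _ _ clin_pred
  clin_submod_closed.
HB.instance Definition _ := [SubChoice_isSubLmodule of clin by <:].

Definition clin_norm (T : clin) : R := sup [set `|T x| | x in [set x | `|x| <= 1]].

Lemma clin_norm_has_sup (T : clin) :
  has_sup [set `|T x| | x in [set x | `|x| <= 1]].
Proof.
split; first by exists `|T 0|; exists 0 => //=; rewrite normr0.
have /linear_bounded_continuous/linear_boundedP : continuous T.
  exact: clin_continuous.
move=> /pinfty_ex_gt0[M M0 HM]; exists M => _ [x /= x1 <-].
by apply: le_trans (HM x) _; rewrite ler_piMr// ltW.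
Qed.

Lemma clin_norm_ge0 (T : clin) : 0 <= clin_norm T.
Proof.
apply: le_trans (ub_le_sup (clin_norm_has_sup T).2 _); last first.
  by exists 0 => //=; rewrite normr0.
exact: normr_ge0.
Qed.

Lemma clin_norm_le (T : clin) (x : X) : `|T x| <= clin_norm T * `|x|.
Proof.
have [->|x0] := eqVneq x 0; first by rewrite linear0 !normr0 mulr0.
have nx0 : 0 < `|x| by rewrite normr_gt0.
rewrite -ler_pdivrMr//; apply: (ub_le_sup (clin_norm_has_sup T).2).
exists (`|x|^-1 *: x) => /=.
  by rewrite normrZ normfV normr_id mulVf// gt_eqF.
by rewrite linearZ/= normrZ normfV normr_id mulrC.
Qed.

Lemma clin_norm_le_bound (T : clin) (M : R) :
  (forall x, `|x| <= 1 -> `|T x| <= M) -> clin_norm T <= M.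
Proof.
move=> H; apply: ge_sup; first exact: (clin_norm_has_sup T).1.
by move=> _ [x x1 <-]; exact: H.
Qed.

Lemma clin_normD (S T : clin) : clin_norm (S + T) <= clin_norm S + clin_norm T.
Proof.
apply: clin_norm_le_bound => x x1; apply: le_trans (ler_normD _ _) _.
by apply: lerD; apply: le_trans (clin_norm_le _ _) _;
  rewrite ler_piMr// clin_norm_ge0.
Qed.

Lemma clin_normZ (l : R) (T : clin) : clin_norm (l *: T) = `|l| * clin_norm T.
Proof.
have le k S : clin_norm (k *: S) <= `|k| * clin_norm S.
  apply: clin_norm_le_bound => x x1; rewrite [_ x]/(k *: S x) normrZ.
  rewrite ler_wpM2l//; apply: le_trans (clin_norm_le _ _) _.
  by rewrite ler_piMr// clin_norm_ge0.
apply/eqP; rewrite eq_le le/=.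
have [->|l0] := eqVneq l 0; first by rewrite normr0 mul0r clin_norm_ge0.
rewrite -ler_pdivlMl ?normr_gt0// -normfV.
by apply: le_trans (le _ _); rewrite scalerA mulVf// scale1r.
Qed.

Lemma clin_norm0_eq0 (T : clin) : clin_norm T = 0 -> T = 0.
Proof.
move=> T0; apply/val_inj/funext => x; apply/normr0_eq0/le_anti.
by rewrite normr_ge0 andbT (le_trans (clin_norm_le _ _))// T0 mul0r.
Qed.

HB.instance Definition _ :=
  Lmodule_isNormed.Build R clin clin_normD clin_normZ clin_norm0_eq0.

Lemma clin_normE (T : clin) :
  `|T| = sup [set `|T x| | x in [set x | `|x| <= 1]].
Proof. by []. Qed.

End ContinuousLinearOperators.

Notation "''L' ( X , Y )" := (clin X Y)
  (at level 8, format "''L' ( X ,  Y )") : type_scope.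

Section Smoothness.
Context (R : realType) (X : normedModType R).

(* Total; meaningful only where f is differentiable (see fderivE). *)
Definition fderiv (Y : normedModType R) (f : X -> Y) (x : X) : 'L(X, Y) :=
  insubd (0 : 'L(X, Y)) ('d f x : X -> Y).

Lemma fderivE (Y : normedModType R) (f : X -> Y) (x : X) :
  differentiable f x -> fderiv f x = 'd f x :> (X -> Y).
Proof.
move=> fx; apply: (@insubdK _ _ 'L(X, Y)); apply/asboolP; split.
  by move=> a u v; rewrite linearP.
exact: diff_continuous.
Qed.

(* C^n-smoothness on an open set Omega; the values of f and of its derivatives
   outside Omega are irrelevant. *)
Fixpoint Cn (n : nat) (Omega : set X) :
    forall Y : normedModType R, (X -> Y) -> Prop :=
  match n with
  | 0 => fun Y f => {within Omega, continuous f}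
  | m.+1 => fun Y f =>
      (forall x, Omega x -> differentiable f x) /\
      @Cn m Omega 'L(X, Y) (fderiv f)
  end.

End Smoothness.

Inductive smoothness := Cfinite of nat | Cinfinite.

Definition Ck (R : realType) (X Y : normedModType R) (k : smoothness)
    (Omega : set X) (f : X -> Y) : Prop :=
  match k with
  | Cfinite n => Cn n Omega f
  | Cinfinite => forall n, Cn n Omega f
  end.

Section Properties.
Context (R : realType) (X Y : normedModType R).

Definition strict_derivative (A : set X) (f : X -> Y) (x : X) (T : 'L(X, Y)) :=
  forall eps : R, 0 < eps -> exists2 delta : R, 0 < delta &
    forall y z, (ball x delta `&` A) y -> (ball x delta `&` A) z ->
      `|f z - f y - T (z - y)| <= eps * `|z - y|.

Definition condition_W (A : set X) (f : X -> Y) (G : X -> 'L(X, Y)) :=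
  {within A, continuous G} /\
  forall x, A x -> strict_derivative A f x (G x).

(* Every Q-Lipschitz mapping A -> Y extends to a (K Q)-Lipschitz mapping on B.
   0 <= Q is needed: on a set with at most one point every mapping satisfies
   the Lipschitz inequality for negative constants as well. *)
Definition lipschitz_extension (K : R) (A B : set X) :=
  forall (Q : R) (f : X -> Y), 0 <= Q -> Q.-lipschitz_A f ->
    exists2 g : X -> Y, (K * Q).-lipschitz_B g & forall x, A x -> g x = f x.

Definition property_LLE (A : set X) :=
  forall x, A x -> exists2 K : R, 1 <= K &
    forall delta : R, 0 < delta -> exists U : set X,
      [/\ open U, U x, U `<=` ball x delta & lipschitz_extension K (U `&` A) U].

Definition property_LA_with (k : smoothness) (C : R) :=
  0 <= C /\
  forall (L : R) (f : X -> Y), 0 <= L -> L.-lipschitz_(ball 0 1) f ->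
  forall eps : R, 0 < eps -> exists g : X -> Y,
    [/\ (C * L).-lipschitz_(ball 0 1) g, Ck k (ball 0 1) g &
        forall x, ball 0 1 x -> `|f x - g x| <= eps].

Definition property_LA (k : smoothness) := exists C : R, property_LA_with k C.

End Properties.

(* Main.v *)
(** The extension f_E given by (a) is improved near A in layers. By (LLE), near
    a in A the map f - G(a), which is almost constant there in the Lipschitz
    sense, extends with a small Lipschitz constant; a partition of unity near A
    glues these extensions, and since any two of them agree on A the derivatives
    of the partition cost nothing in the limit. This gives, for each eps, an
    extension of f near A whose difference from G(a) is eps-Lipschitz near every
    a in A. Extensions for eps = 2^-n are interpolated by cutoffs of the form
    min(1, c ln(r / d)), with d the distance to A: two extensions of f differ by
    O(d) and the cutoff is (2c/d)-Lipschitz, so each interpolation costs only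
    O(c). The result is an extension with strict derivative G(a) with respect to
    Omega at every a in A.

    On Omega \ A it is then approximated, with errors O(dist^2) to the
    complement, by a C^1 map (locally by T + the (LA_1)-approximation of F - T,
    T being an approximate derivative), and this in turn by a C^k map. Only the
    closeness to F, not the size of the partition functions, enters the gluing
    estimates. The logarithmic cutoffs make the local Lipschitz constants exceed
    max(C_A C_E L, M) by an arbitrarily small amount only; the global constant
    follows from the mean value inequality for segments inside Omega and from
    closeness to f_E for the others. *)

(* Smoothing takes two steps because only the constant C_A of (LA_1) may enter the bound, whereas
   that of (LA_k) is arbitrary. Once the approximant is C^1, subtracting its derivative at a point
   leaves a map with arbitrarily small local Lipschitz constant, and any factor becomes harmless.
   The quantity controlled is |T| + C_A rho, where F - T is rho-Lipschitz near a point: up to small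
   errors it bounds the derivative of the smoothed map, and interpolation averages it. The extension
   f_E contributes T = 0 and rho = C_E L, the layers near A contribute T = G(b) with small rho;
   hence the maximum of C_A C_E L and M. No bound is available for the Lipschitz constants c_n of
   the partition functions. Since locally each n carries a single index of the cover, the n-th local
   approximant may be chosen after c_n, with an error of order 2^-n / (1 + c_n), and the errors stay
   summable after multiplication by c_n. An extension from A cannot be adapted in this way; there
   the pieces agree on A, and closeness to A replaces closeness to F. *)
From HB Require Import structures.
From mathcomp Require Import ring lra.
From mathcomp Require wochoice.
Require Import Defs.

(** * Linear combinations in a module *)

Section ModuleExpressions.
Context (R : comNzRingType) (V : lmodType R).

Inductive lexp :=
  LVar of nat | LAdd of lexp & lexp | LOpp of lexp | LZero | LScale of R & lexp.

Fixpoint leval (env : seq V) (e : lexp) : V :=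
  match e with
  | LVar i => nth 0 env i
  | LAdd a b => leval env a + leval env b
  | LOpp a => - leval env a
  | LZero => 0
  | LScale c a => c *: leval env a
  end.

(** [Nat.eqb] is used so that [cbn] computes the coefficients of a reified term and leaves one
    equation in R per atom for [ring]. *)
Fixpoint lcoef (e : lexp) (i : nat) : R :=
  match e with
  | LVar j => if Nat.eqb j i then 1 else 0
  | LAdd a b => lcoef a i + lcoef b i
  | LOpp a => - lcoef a i
  | LZero => 0
  | LScale c a => c * lcoef a i
  end.

Fixpoint same_coef (e1 e2 : lexp) (n : nat) : Prop :=
  match n with
  | 0 => True
  | m.+1 => same_coef e1 e2 m /\ lcoef e1 m = lcoef e2 m
  end.

Lemma leval_coef (env : seq V) (e : lexp) :
  leval env e = \sum_(i < size env) lcoef e i *: env`_i.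
Proof.
elim: e => [j|a IHa b IHb|a IHa||c a IHa] /=; rewrite ?IHa ?IHb.
- have eqbE (i k : nat) : Nat.eqb i k = (i == k).
    by elim: i k => [|i IH] [|k] //=; rewrite IH.
  have [js|js] := ltnP j (size env).
    rewrite (bigD1 (Ordinal js))//= eqbE eqxx scale1r big1 ?addr0// => i ij.
    by rewrite eqbE ifN ?scale0r// eq_sym.
  rewrite nth_default// big1// => i _; rewrite eqbE ifN ?scale0r//.
  by rewrite gtn_eqF// (leq_trans _ js).
- by rewrite -big_split/=; apply: eq_bigr => i _; rewrite scalerDl.
- by rewrite -sumrN; apply: eq_bigr => i _; rewrite scaleNr.
- by rewrite big1// => i _; rewrite scale0r.
- by rewrite scaler_sumr; apply: eq_bigr => i _; rewrite scalerA.
Qed.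

Lemma leval_eq (env : seq V) (e1 e2 : lexp) :
  same_coef e1 e2 (size env) -> leval env e1 = leval env e2.
Proof.
rewrite !leval_coef; move: (size env) (nth 0 env) => n v.
elim: n => [|n IH] /=.
  by rewrite !big_ord0.
by rewrite !big_ord_recr/= => -[/IH-> ->].
Qed.

End ModuleExpressions.

Ltac atom_index x l :=
  match l with
  | cons x _ => constr:(0%N)
  | cons _ ?l' => let n := atom_index x l' in constr:(S n)
  end.

Ltac atoms t l :=
  match t with
  | (?a + ?b)%R => let l := atoms a l in atoms b l
  | (- ?a)%R => atoms a l
  | (_ *: ?a)%R => atoms a l
  | 0%R => l
  | _ => match l with
         | _ => let _ := atom_index t l in l
         | _ => constr:(cons t l)
         end
  end.

Ltac reify R t l :=
  match t with
  | (?a + ?b)%R => let x := reify R a l in let y := reify R b l in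
                   constr:(@LAdd R x y)
  | (- ?a)%R => let x := reify R a l in constr:(@LOpp R x)
  | (?c *: ?a)%R => let x := reify R a l in constr:(@LScale R c x)
  | 0%R => constr:(@LZero R)
  | _ => let n := atom_index t l in constr:(@LVar R n)
  end.

(* Decides an equality of linear combinations in a module over R by comparing
   the coefficients of the atoms. *)
Ltac lmod_over R :=
  match goal with
  | |- @eq ?T ?a ?b =>
    let l0 := constr:(@nil T) in
    let l := atoms a l0 in let l := atoms b l in
    let x := reify R a l in let y := reify R b l in
    refine (@leval_eq R _ l x y _);
    cbn [same_coef lcoef Nat.eqb size]; repeat split; ring
  end.

Ltac lmod := match goal with R : realType |- _ => lmod_over R end.

(** * Derivatives *)

Section Basics.
Context (R : realType) (X Y : normedModType R).

Lemma ballE (x : X) (r : R) : ball x r = [set y | `|x - y| < r].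
Proof. by rewrite -ball_normE. Qed.

Lemma open_ballP (O : set X) (x : X) : open O -> O x ->
  exists2 r : R, 0 < r & ball x r `<=` O.
Proof.
move=> oO Ox; have /nbhs_ballP[r /= r0 rO] : nbhs x O by exact: open_nbhs_nbhs.
by exists r.
Qed.

Lemma lipschitzP (k : R) (A : set X) (f : X -> Y) :
  k.-lipschitz_A f <-> forall x y, A x -> A y -> `|f x - f y| <= k * `|x - y|.
Proof.
split=> [H x y Ax Ay|H [x y] [/= Ax Ay]]; last exact: H.
by have /= := H (x, y); apply.
Qed.

(** Differentiability in epsilon-delta form, as a relation: no default value intervenes, unlike in
    [fderiv]. *)
Definition has_deriv (f : X -> Y) (x : X) (T : 'L(X, Y)) :=
  forall e : R, 0 < e -> exists2 d : R, 0 < d &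
    forall y, `|y - x| < d -> `|f y - f x - T (y - x)| <= e * `|y - x|.

Lemma littleo_has_deriv (f : X -> Y) (x : X) (T : 'L(X, Y)) :
  f \o shift x = cst (f x) + T +o_ 0 id <-> has_deriv f x T.
Proof.
split=> [/eqaddoP H e e0|H].
  have /nbhs_norm0P[d /= d0 Hd] := H e e0.
  exists d => // y yd; have := Hd (y - x) yd.
  have -> : (f \o shift x - (cst (f x) + T)) (y - x) =
    f (y - x + x) - (f x + T (y - x)) by [].
  by rewrite subrK opprD addrA.
apply/eqaddoP => e e0; have [d d0 Hd] := H e e0.
apply/nbhs_norm0P; exists d => //= h hd; have := Hd (h + x).
rewrite addrK => /(_ hd).
have -> : (f \o shift x - (cst (f x) + T)) h = f (h + x) - (f x + T h) by [].
by rewrite opprD addrA.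
Qed.

Lemma has_derivP (f : X -> Y) (x : X) (T : 'L(X, Y)) :
  has_deriv f x T <-> differentiable f x /\ fderiv f x = T.
Proof.
split=> [/littleo_has_deriv H|[df dT]].
  have dE : 'd f x = T :> (X -> Y) by apply: diff_unique => //; exact: clin_continuous.
  have df : differentiable f x.
    by apply/diff_locallyP; rewrite dE; split => //; exact: clin_continuous.
  by split => //; apply: val_inj; rewrite /= -dE; exact: fderivE.
apply/littleo_has_deriv; rewrite -dT (fderivE df).
by have /diff_locallyP[] := df.
Qed.

End Basics.

Section OperatorNorm.
Context (R : realType) (X Y : normedModType R).

Lemma opnorm_le (T : 'L(X, Y)) (x : X) : `|T x| <= `|T| * `|x|.
Proof. exact: clin_norm_le. Qed.

Lemma opnorm_le_bound (T : 'L(X, Y)) (M : R) : 0 <= M ->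
  (forall x, `|T x| <= M * `|x|) -> `|T| <= M.
Proof.
move=> M0 H; apply: clin_norm_le_bound => x x1.
by apply: le_trans (H x) _; rewrite ler_piMr.
Qed.

Lemma clinD (S T : 'L(X, Y)) x : (S + T) x = S x + T x. Proof. by []. Qed.
Lemma clinN (T : 'L(X, Y)) x : (- T) x = - T x. Proof. by []. Qed.
Lemma clinB (S T : 'L(X, Y)) x : (S - T) x = S x - T x. Proof. by []. Qed.
Lemma clinZ a (T : 'L(X, Y)) x : (a *: T) x = a *: T x. Proof. by []. Qed.

Lemma clin_ext (S T : 'L(X, Y)) : (forall x, S x = T x) -> S = T.
Proof. by move=> H; apply/val_inj/funext. Qed.

Definition to_clin (f : X -> Y) : 'L(X, Y) := insubd (0 : 'L(X, Y)) f.

Lemma to_clinE (f : X -> Y) (c : R) : linear f ->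
  (forall x, `|f x| <= c * `|x|) -> to_clin f = f :> (X -> Y).
Proof.
move=> fl fc; apply: (@insubdK _ _ 'L(X, Y)); apply/asboolP; split=> //.
pose lf := GRing.isLinear.Build R X Y *:%R f fl.
pose h : {linear X -> Y} := HB.pack f lf.
suff : continuous h by [].
apply/linear_bounded_continuous/linear_boundedP; near=> r => x.
apply: le_trans (fc x) _; rewrite ler_wpM2r//; near: r.
Unshelve. all: by end_near. Qed.

Lemma continuous_forP (f : X -> Y) (x : X) : {for x, continuous f} <->
  forall e : R, 0 < e -> exists2 d : R, 0 < d &
    forall y, `|y - x| < d -> `|f y - f x| <= e.
Proof.
split=> [/cvgrPdist_le H e e0|H].
  have /nbhs_normP[d /= d0 Hd] := H e e0.
  by exists d => // y yd; rewrite distrC; apply: Hd; rewrite /= distrC.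
apply/cvgrPdist_le => e e0; have [d d0 Hd] := H e e0.
by apply/nbhs_normP; exists d => //= y /= yd; rewrite distrC; apply: Hd; rewrite distrC.
Qed.

Lemma has_deriv_eq (f g : X -> Y) (O : set X) (x : X) (T : 'L(X, Y)) :
  open O -> O x -> (forall y, O y -> f y = g y) ->
  has_deriv f x T -> has_deriv g x T.
Proof.
move=> oO Ox fg H e e0; have [d d0 Hd] := H e e0.
have [r r0 rO] := open_ballP oO Ox.
exists (Num.min d r); first by rewrite lt_min d0.
move=> y; rewrite lt_min => /andP[yd yr]; rewrite -!fg//; first exact: Hd.
by apply: rO; rewrite ballE /= distrC.
Qed.

(** Both estimates hold at small multiples [t *: h], and homogeneity removes t. Derivatives of glued
    maps are estimated in this way, without a formula for the derivative of the sum. *)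
Lemma has_deriv_lip (f : X -> Y) (x : X) (T S : 'L(X, Y)) (k r : R) :
  0 <= k -> 0 < r -> has_deriv f x T ->
  (forall y, `|y - x| < r -> `|f y - f x - S (y - x)| <= k * `|y - x|) ->
  `|T - S| <= k.
Proof.
move=> k0 r0 H K; apply/ler_addgt0Pr => e e0.
have [d d0 Hd] := H e e0.
apply: opnorm_le_bound; first by rewrite addr_ge0// ltW.
move=> h; have [->|h0] := eqVneq h 0; first by rewrite linear0 !normr0 mulr0.
have nh : 0 < `|h| by rewrite normr_gt0.
pose t := Num.min d r / (2 * `|h|).
have m0 : 0 < Num.min d r by rewrite lt_min d0 r0.
have t0 : 0 < t by rewrite divr_gt0// mulr_gt0.
have tE : `|t *: h| = Num.min d r / 2.
  rewrite normrZ gtr0_norm// /t; field; lra.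
have tm : `|t *: h| < Num.min d r by rewrite tE; lra.
have := K (x + t *: h); have := Hd (x + t *: h).
rewrite addrAC subrr add0r; move: tm; rewrite lt_min => /andP[-> ->].
move=> /(_ isT) A /(_ isT) B.
rewrite -(ler_pM2l t0) mulrCA -[t in leRHS]gtr0_norm// -normrZ.
rewrite -[t in leLHS]gtr0_norm// -normrZ clinB scalerBr -!linearZ /=.
set u := f _ - f x in A B.
have -> : T (t *: h) - S (t *: h) = (u - S (t *: h)) - (u - T (t *: h)).
  by rewrite opprB [RHS]addrC addrA subrK.
by apply: le_trans (ler_normB _ _) _; rewrite mulrDl lerD.
Qed.

End OperatorNorm.

Lemma eps_small (R : realType) (K e : R) : 0 <= K -> 0 < e ->
  exists2 d : R, 0 < d <= 1 & d * K <= e.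
Proof.
move=> K0 e0; exists (Num.min 1 (e / (K + 1))).
  by rewrite ge_min lexx/= lt_min ltr01/= divr_gt0// ltr_wpDl.
have K1 : 0 < K + 1 by rewrite ltr_wpDl.
apply: le_trans (_ : e / (K + 1) * K <= _).
  by rewrite ler_wpM2r// ge_min lexx orbT.
by rewrite -mulrA ler_piMr ?(ltW e0)// mulrC ler_pdivrMr//; lra.
Qed.

(** * Smoothness classes *)

Section CnBasic.
Context (R : realType) (X : normedModType R).
Implicit Types (Y : normedModType R) (O : set X).

Lemma Cn0P Y (O : set X) (f : X -> Y) : open O ->
  Cn 0 O f <-> forall x, O x -> {for x, continuous f}.
Proof.
move=> oO; rewrite /= continuous_open_subspace//; split=> H x.
  by move=> Ox; apply: H; rewrite inE.
by rewrite inE => Ox; exact: H.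
Qed.

Lemma Cn_eq n Y (O : set X) (f g : X -> Y) : open O ->
  (forall x, O x -> f x = g x) -> Cn n O f -> Cn n O g.
Proof.
elim: n Y f g => [|n IH] Y f g oO fg.
  move=> /(Cn0P _ oO) H; apply/(Cn0P _ oO) => x Ox.
  have [r r0 rO] := open_ballP oO Ox.
  apply/continuous_forP => e e0.
  have /continuous_forP/(_ _ e0)[d d0 Hd] := H x Ox.
  exists (Num.min d r); first by rewrite lt_min d0.
  move=> y; rewrite lt_min => /andP[yd yr]; rewrite -!fg//; first exact: Hd.
  by apply: rO; rewrite ballE /= distrC.
move=> [fd Df].
have gd x : O x -> has_deriv g x (fderiv f x).
  by move=> Ox; apply: (has_deriv_eq oO Ox fg); apply/has_derivP; split => //; exact: fd.
split=> [x Ox|]; first by have /has_derivP[] := gd x Ox.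
by apply: (IH _ _ _ oO _ Df) => x Ox; have /has_derivP[_ ->] := gd x Ox.
Qed.

Lemma CnSP n Y (O : set X) (f : X -> Y) (Df : X -> 'L(X, Y)) : open O ->
  (forall x, O x -> has_deriv f x (Df x)) -> Cn n O Df -> Cn n.+1 O f.
Proof.
move=> oO H D; split=> [x Ox|]; first by have /has_derivP[] := H x Ox.
by apply: Cn_eq D => // x Ox; have /has_derivP[_ ->] := H x Ox.
Qed.

Lemma CnS_has_deriv n Y (O : set X) (f : X -> Y) x : Cn n.+1 O f -> O x ->
  has_deriv f x (fderiv f x).
Proof. by move=> [H _] Ox; apply/has_derivP; split => //; exact: H. Qed.

Lemma Cn_sub n Y (O P : set X) (f : X -> Y) : open O -> open P -> O `<=` P ->
  Cn n P f -> Cn n O f.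
Proof.
elim: n Y f => [|n IH] Y f oO oP OP.
  by move=> /(Cn0P _ oP) H; apply/(Cn0P _ oO) => x /OP; exact: H.
by move=> [H D]; split=> [x /OP/H//|]; exact: IH D.
Qed.

Lemma Cn_local n Y (O : set X) (f : X -> Y) : open O ->
  (forall x, O x -> exists2 r : R, 0 < r & Cn n (ball x r) f) -> Cn n O f.
Proof.
elim: n Y f => [|n IH] Y f oO H.
  apply/(Cn0P _ oO) => x /H[r r0 /Cn0P]; apply; first exact: ball_open.
  exact: ballxx.
split=> [x /H[r r0 [+ _]]|]; first by apply; exact: ballxx.
by apply: IH => // x /H[r r0 [_ D]]; exists r.
Qed.

Lemma CnW n Y (O : set X) (f : X -> Y) : open O -> Cn n.+1 O f -> Cn n O f.
Proof.
elim: n Y f => [|n IH] Y f oO.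
  move=> [H _]; apply/(Cn0P _ oO) => x /H; exact: differentiable_continuous.
by move=> [H D]; split => //; exact: IH.
Qed.

Lemma Cn_le m n Y (O : set X) (f : X -> Y) : open O -> (m <= n)%N ->
  Cn n O f -> Cn m O f.
Proof.
move=> oO; elim: n => [|n IH]; first by rewrite leqn0 => /eqP->.
by rewrite leq_eqVlt => /predU1P[->//|mn] /(CnW oO); exact: IH.
Qed.

Lemma has_deriv_cst Y (c : Y) (x : X) : has_deriv (fun=> c) x (0 : 'L(X, Y)).
Proof.
move=> e e0; exists 1 => // y _.
have -> : c - c - (0 : 'L(X, Y)) (y - x) = 0 by rewrite subrr sub0r; exact: oppr0.
by rewrite normr0 mulr_ge0// ltW.
Qed.

Lemma Cn_cst n Y (O : set X) (c : Y) : open O -> Cn n O (fun=> c).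
Proof.
move=> oO; elim: n Y c => [|n IH] Y c.
  by apply/(Cn0P _ oO) => x Ox; exact: cvg_cst.
by apply: (CnSP oO _ (IH _ 0)) => x _; exact: has_deriv_cst.
Qed.

Lemma has_deriv_clin Y (T : 'L(X, Y)) (x : X) : has_deriv T x T.
Proof.
move=> e e0; exists 1 => // y _.
by rewrite -linearB subrr normr0 mulr_ge0// ltW.
Qed.

Lemma Cn_clin n Y (O : set X) (T : 'L(X, Y)) : open O -> Cn n O T.
Proof.
move=> oO; case: n => [|n].
  by apply/(Cn0P _ oO) => x Ox; exact: clin_continuous.
by apply: (CnSP oO _ (Cn_cst n T oO)) => x _; exact: has_deriv_clin.
Qed.

Lemma has_derivD Y (f g : X -> Y) (x : X) (S T : 'L(X, Y)) :
  has_deriv f x S -> has_deriv g x T -> has_deriv (fun x => f x + g x) x (S + T).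
Proof.
move=> F G e e0; have e2 : 0 < e / 2 by rewrite divr_gt0.
have [d d0 Hd] := F _ e2; have [d' d0' Hd'] := G _ e2.
exists (Num.min d d'); first by rewrite lt_min d0.
move=> y; rewrite lt_min => /andP[/Hd A /Hd' B].
rewrite clinD.
have -> : f y + g y - (f x + g x) - (S (y - x) + T (y - x)) =
  (f y - f x - S (y - x)) + (g y - g x - T (y - x)) by lmod.
apply: le_trans (ler_normD _ _) _; lra.
Qed.

Lemma Cn_add n Y (O : set X) (f g : X -> Y) : open O ->
  Cn n O f -> Cn n O g -> Cn n O (fun x => f x + g x).
Proof.
move=> oO; elim: n Y f g => [|n IH] Y f g.
  move=> /(Cn0P _ oO) F /(Cn0P _ oO) G; apply/(Cn0P _ oO) => x Ox.
  by apply: cvgD; [exact: F|exact: G].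
move=> F G; apply: (CnSP oO _ (IH _ _ _ F.2 G.2)) => x Ox.
by apply: has_derivD; [exact: CnS_has_deriv F Ox|exact: CnS_has_deriv G Ox].
Qed.

Lemma Cn_sum n Y (O : set X) (F : nat -> X -> Y) (N : nat) : open O ->
  (forall i, (i < N)%N -> Cn n O (F i)) -> Cn n O (fun x => \sum_(i < N) F i x).
Proof.
move=> oO; elim: N => [_|N IH H].
  by apply: Cn_eq (Cn_cst n 0 oO) => // x _; rewrite big_ord0.
apply: Cn_eq (Cn_add oO (IH _) (H N _)) => // [x _|i iN].
  by rewrite big_ord_recr.
by apply: H; exact: ltn_trans iN _.
Qed.

End CnBasic.

(** * Bounded bilinear maps and the product rule *)

Section Bilinear.
Context (R : realType).
Implicit Types (U V Z X : normedModType R).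

Definition bbilinear U V Z (B : U -> V -> Z) :=
  [/\ forall v, linear (B^~ v), forall u, linear (B u) &
      exists2 c : R, 0 <= c & forall u v, `|B u v| <= c * `|u| * `|v|].

Section Lift.
Context (X U V Z : normedModType R) (B : U -> V -> Z).
Context (hB : bbilinear B).

(** The two terms B(Du, v) and B(u, Dv) of the product rule, as bounded bilinear maps into a space
    of operators. They are of the same kind as B, which lets [Cn_bilin] go by induction on n with
    all target spaces varying. *)
Definition bilin_liftl (S : 'L(X, U)) (v : V) : 'L(X, Z) :=
  to_clin (fun h => B (S h) v).
Definition bilin_liftr (u : U) (S : 'L(X, V)) : 'L(X, Z) :=
  to_clin (fun h => B u (S h)).

Lemma bilin_liftlE S v h : bilin_liftl S v h = B (S h) v.
Proof.
have [Bl Br [c c0 Bc]] := hB.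
rewrite (@to_clinE _ _ _ _ (c * `|S| * `|v|))// => [a x y|x].
  by rewrite linearP Bl.
apply: le_trans (Bc _ _) _.
by rewrite [leRHS]mulrAC ler_wpM2r// -[leRHS]mulrA ler_wpM2l// opnorm_le.
Qed.

Lemma bilin_liftrE u S h : bilin_liftr u S h = B u (S h).
Proof.
have [Bl Br [c c0 Bc]] := hB.
rewrite (@to_clinE _ _ _ _ (c * `|u| * `|S|))// => [a x y|x].
  by rewrite linearP Br.
apply: le_trans (Bc _ _) _.
by rewrite -[leRHS]mulrA ler_wpM2l ?mulr_ge0// opnorm_le.
Qed.

Lemma bbilinear_liftl : bbilinear bilin_liftl.
Proof.
have [Bl Br [c c0 Bc]] := hB; split.
- move=> v a S T; apply: clin_ext => h.
  transitivity (a *: bilin_liftl S v h + bilin_liftl T v h); last by [].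
  by rewrite !bilin_liftlE; exact: (Bl v a (S h) (T h)).
- move=> S a v w; apply: clin_ext => h.
  transitivity (a *: bilin_liftl S v h + bilin_liftl S w h); last by [].
  by rewrite !bilin_liftlE; exact: (Br (S h) a v w).
- exists c => // S v; apply: opnorm_le_bound; first by rewrite !mulr_ge0.
  move=> h; rewrite bilin_liftlE; apply: le_trans (Bc _ _) _.
  by rewrite [leRHS]mulrAC ler_wpM2r// -[leRHS]mulrA ler_wpM2l// opnorm_le.
Qed.

Lemma bbilinear_liftr : bbilinear bilin_liftr.
Proof.
have [Bl Br [c c0 Bc]] := hB; split.
- move=> S a u v; apply: clin_ext => h.
  transitivity (a *: bilin_liftr u S h + bilin_liftr v S h); last by [].
  by rewrite !bilin_liftrE; exact: (Bl (S h) a u v).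
- move=> u a S T; apply: clin_ext => h.
  transitivity (a *: bilin_liftr u S h + bilin_liftr u T h); last by [].
  by rewrite !bilin_liftrE; exact: (Br u a (S h) (T h)).
- exists c => // S v; apply: opnorm_le_bound; first by rewrite !mulr_ge0.
  move=> h; rewrite bilin_liftrE; apply: le_trans (Bc _ _) _.
  by rewrite -[leRHS]mulrA ler_wpM2l ?mulr_ge0// opnorm_le.
Qed.

Lemma bilinBl u u' v : B (u - u') v = B u v - B u' v.
Proof.
have [Bl _ _] := hB; rewrite addrC -scaleN1r (Bl v).
by rewrite scaleN1r addrC.
Qed.

Lemma bilinBr u v v' : B u (v - v') = B u v - B u v'.
Proof.
have [_ Br _] := hB; rewrite addrC -scaleN1r (Br u).
by rewrite scaleN1r addrC.
Qed.

Lemma has_deriv_bilin (u : X -> U) (v : X -> V) x S T :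
  has_deriv u x S -> has_deriv v x T ->
  has_deriv (fun x => B (u x) (v x)) x
    (bilin_liftl S (v x) + bilin_liftr (u x) T).
Proof.
have [Bl Br [c c0 Bc]] := hB.
move=> Hu Hv e e0.
(* One summand for each error term: the remainder of u against v(x), the remainder of v against
   u(x), and the product of the two increments, which is small because |y - x| < e1. *)
pose K := c * (`|v x| + `|u x| + (`|S| + 1) * (`|T| + 1)).
have K0 : 0 <= K by rewrite mulr_ge0// !addr_ge0// mulr_ge0// addr_ge0.
have [e1 /andP[e10 e11] e1K] := eps_small K0 e0.
have [d d0 Hd] := Hu _ e10; have [d' d0' Hd'] := Hv _ e10.
exists (Num.min (Num.min d d') e1); first by rewrite !lt_min d0 d0'.
move=> y; rewrite !lt_min => /andP[/andP[/Hd A /Hd' A'] ye].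
rewrite clinD bilin_liftlE bilin_liftrE; set h := y - x in A A' ye *.
have B1 : `|u y - u x| <= (`|S| + 1) * `|h|.
  rewrite -[u y - u x](subrK (S h)); apply: le_trans (ler_normD _ _) _.
  have := opnorm_le S h; have : e1 * `|h| <= `|h| by rewrite ler_piMl.
  lra.
have B2 : `|v y - v x| <= (`|T| + 1) * `|h|.
  rewrite -[v y - v x](subrK (T h)); apply: le_trans (ler_normD _ _) _.
  have := opnorm_le T h; have : e1 * `|h| <= `|h| by rewrite ler_piMl.
  lra.
have -> : B (u y) (v y) - B (u x) (v x) - (B (S h) (v x) + B (u x) (T h)) =
    B (u y - u x - S h) (v x) + B (u x) (v y - v x - T h) +
    B (u y - u x) (v y - v x).
  rewrite !bilinBl !bilinBr.
  set a := B (u y) (v y); set b := B (u x) (v x); set p := B (S h) _.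
  set q := B _ (T h); set r := B (u y) (v x); set s := B (u x) (v y).
  lmod.
apply: le_trans (ler_normD _ _) _.
have C1 : `|B (u y - u x - S h) (v x) + B (u x) (v y - v x - T h)| <=
    c * (e1 * `|h|) * `|v x| + c * `|u x| * (e1 * `|h|).
  apply: le_trans (ler_normD _ _) _; apply: lerD; apply: le_trans (Bc _ _) _.
    by rewrite ler_wpM2r// ler_wpM2l.
  by rewrite ler_wpM2l// mulr_ge0.
have C2 : `|B (u y - u x) (v y - v x)| <=
    c * ((`|S| + 1) * `|h|) * ((`|T| + 1) * e1).
  apply: le_trans (Bc _ _) _; apply: ler_pM => //; first by rewrite mulr_ge0.
    by rewrite ler_wpM2l.
  by apply: le_trans B2 _; rewrite ler_wpM2l ?addr_ge0// ltW.
apply: le_trans (lerD C1 C2) _.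
apply: le_trans (_ : e1 * K * `|h| <= _); last by rewrite ler_wpM2r.
rewrite /K le_eqVlt; apply/orP; left; apply/eqP; ring.
Qed.

Lemma continuous_bilin (u : X -> U) (v : X -> V) x :
  {for x, continuous u} -> {for x, continuous v} ->
  {for x, continuous (fun x => B (u x) (v x))}.
Proof.
have [Bl Br [c c0 Bc]] := hB.
move=> /continuous_forP Hu /continuous_forP Hv; apply/continuous_forP => e e0.
pose K := c * (`|v x| + `|u x| + 1).
have K0 : 0 <= K by rewrite mulr_ge0// !addr_ge0.
have [e1 /andP[e10 e11] e1K] := eps_small K0 e0.
have [d d0 Hd] := Hu _ e10; have [d' d0' Hd'] := Hv _ e10.
exists (Num.min d d'); first by rewrite !lt_min d0 d0'.
move=> y; rewrite lt_min => /andP[/Hd A /Hd' A'].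
have -> : B (u y) (v y) - B (u x) (v x) =
   B (u y - u x) (v x) + B (u x) (v y - v x) + B (u y - u x) (v y - v x).
  rewrite !bilinBl !bilinBr.
  set a := B (u y) (v y); set b := B (u x) (v x).
  set r := B (u y) (v x); set s := B (u x) (v y).
  lmod.
apply: le_trans (ler_normD _ _) _.
have C1 : `|B (u y - u x) (v x) + B (u x) (v y - v x)| <=
    c * e1 * `|v x| + c * `|u x| * e1.
  apply: le_trans (ler_normD _ _) _; apply: lerD; apply: le_trans (Bc _ _) _.
    by rewrite ler_wpM2r// ler_wpM2l.
  by rewrite ler_wpM2l// mulr_ge0.
have C2 : `|B (u y - u x) (v y - v x)| <= c * e1 * 1.
  apply: le_trans (Bc _ _) _; apply: ler_pM => //; first by rewrite mulr_ge0.
    by rewrite ler_wpM2l.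
  exact: le_trans A' _.
apply: le_trans (lerD C1 C2) _; apply: le_trans e1K.
rewrite /K le_eqVlt; apply/orP; left; apply/eqP; ring.
Qed.

End Lift.

Lemma Cn_bilin n X U V Z (B : U -> V -> Z) (O : set X)
    (u : X -> U) (v : X -> V) : bbilinear B -> open O ->
  Cn n O u -> Cn n O v -> Cn n O (fun x => B (u x) (v x)).
Proof.
elim: n U V Z B u v => [|n IH] U V Z B u v hB oO.
  move=> /(Cn0P _ oO) F /(Cn0P _ oO) G; apply/(Cn0P _ oO) => x Ox.
  by apply: continuous_bilin; [exact: hB|exact: F|exact: G].
move=> F G.
have F' := CnW oO F; have G' := CnW oO G.
apply: (@CnSP _ _ _ _ _ _ (fun x => bilin_liftl B (fderiv u x) (v x) +
                          bilin_liftr B (u x) (fderiv v x))) => //.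
  by move=> x Ox; apply: has_deriv_bilin => //; [exact: CnS_has_deriv F Ox|exact: CnS_has_deriv G Ox].
apply: Cn_add => //; apply: IH => //.
- exact: bbilinear_liftl.
- exact: F.2.
- exact: bbilinear_liftr.
- exact: G.2.
Qed.

End Bilinear.

(** * The mean value inequality for vector-valued maps *)

Section MeanValue.
Context (R : realType).

(** Continuous induction: the set S of times up to which phi grows at rate at most K + e contains
    its supremum, and the local estimate at the supremum carries the bound further unless the
    supremum is 1. *)
Lemma growth_bound (Y : normedModType R) (phi : R -> Y) (K : R) : 0 <= K ->
  (forall t, 0 <= t <= 1 -> forall e : R, 0 < e -> exists2 d : R, 0 < d &
    forall s, 0 <= s <= 1 -> `|s - t| < d ->
      `|phi s - phi t| <= (K + e) * `|s - t|) ->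
  `|phi 1 - phi 0| <= K.
Proof.
move=> K0 H; apply/ler_addgt0Pr => e e0.
pose S := [set t : R | 0 <= t <= 1 /\
  forall s, 0 <= s <= t -> `|phi s - phi 0| <= (K + e) * s].
have S0 : S 0.
  split; first by rewrite lexx ler01.
  move=> s s0; have -> : s = 0 by lra.
  by rewrite subrr normr0 mulr0.
have hS : has_sup S by split; [exists 0|exists 1 => t [/andP[]]].
pose c := sup S.
have c0 : 0 <= c by exact: ub_le_sup hS.2 _ S0.
have c1 : c <= 1 by apply: ge_sup; [exists 0|move=> t [/andP[]]].
have [|d d0 Hd] := H c _ _ e0; first by rewrite c0.
have step t s : 0 <= t -> t <= s -> s <= 1 ->
    `|phi t - phi 0| <= (K + e) * t -> `|phi s - phi t| <= (K + e) * (s - t) ->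
    `|phi s - phi 0| <= (K + e) * s.
  move=> t0 ts s1 A B; rewrite -(subrKA (phi t)).
  by apply: le_trans (ler_normD _ _) _; lra.
have Sc : S c.
  split; first by rewrite c0.
  (* The bound reaches c from a point t of S within d of c, through the local estimate at c. *)
  have [t St ct] := sup_adherent d0 hS.
  have tc : t <= c by exact: ub_le_sup hS.2 _ St.
  have cc : `|phi c - phi 0| <= (K + e) * c.
    apply: (step t) => //.
    - by case: St => /andP[].
    - apply: St.2; case: St => /andP[t0 _] _; lra.
    - have := Hd t; rewrite distrC [`|phi t - _|]distrC ger0_norm ?subr_ge0//.
      apply; first by case: St.
      rewrite -/c in ct; lra.
  move=> s /andP[s0]; rewrite le_eqVlt => /predU1P[->//|sc].
  have [u Su su] : exists2 u, S u & s < u.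
    have := @sup_adherent _ S (c - s); rewrite subr_gt0 => /(_ sc hS)[u Su].
    rewrite -/c => cu; exists u => //; lra.
  by apply: Su.2; rewrite s0 ltW.
have [c1'|c1'] := ltP c 1; last first.
  have c1E : c = 1 by lra.
  by have := Sc.2 1; rewrite c1E ler01 lexx mulr1; apply.
pose c' := Num.min 1 (c + d / 2).
have cc' : c < c' by rewrite lt_min c1'/=; lra.
suff : S c' by move=> /(ub_le_sup hS.2); rewrite -/c; lra.
have c'1 : c' <= 1 by rewrite ge_min lexx.
have c'd : c' <= c + d / 2 by rewrite ge_min lexx orbT.
split; first by apply/andP; split => //; lra.
move=> s /andP[s0 sc'].
have [sc|sc] := leP s c; first by apply: Sc.2; rewrite s0.
apply: (step c) => //; [exact: ltW|lra| |].
  by apply: Sc.2; rewrite c0/=.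
have := Hd s; rewrite ger0_norm; last by lra.
apply; [apply/andP; split|]; lra.
Qed.

(** With S = 0 this is the usual inequality; with S the derivative at a nearby point it gives strict
    differentiability of C^1 maps. *)
Lemma mean_value (X Y : normedModType R) (f : X -> Y) (T : X -> 'L(X, Y))
    (S : 'L(X, Y)) (x y : X) (K : R) : 0 <= K ->
  (forall t : R, 0 <= t <= 1 -> let z := x + t *: (y - x) in
     has_deriv f z (T z) /\ `|T z - S| <= K) ->
  `|f y - f x - S (y - x)| <= K * `|y - x|.
Proof.
move=> K0 H.
pose phi (t : R) := f (x + t *: (y - x)) - S (x + t *: (y - x)).
have -> : f y - f x - S (y - x) = phi 1 - phi 0.
  rewrite /phi scale1r scale0r addr0 [x + (y - x)]addrC subrK linearB/=; lmod.
apply: growth_bound; first by rewrite mulr_ge0.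
move=> t t01 e e0; set h := y - x; have [/= D B] := H t t01.
pose e1 := e / (`|h| + 1).
have h1 : 0 < `|h| + 1 by rewrite ltr_wpDl.
have e10 : 0 < e1 by rewrite divr_gt0.
have [d d0 Hd] := D _ e10.
exists (d / (`|h| + 1)); first by rewrite divr_gt0.
move=> s s01 std; rewrite /phi -/h.
set z := x + t *: h in D B Hd *; set w := x + s *: h.
have wz : w - z = (s - t) *: h by rewrite /w /z; lmod.
have nwz : `|w - z| = `|s - t| * `|h| by rewrite wz normrZ.
have wzd : `|w - z| < d.
  rewrite nwz; move: std; rewrite ltr_pdivlMr//; apply: le_lt_trans.
  by rewrite ler_wpM2l// lerDl.
have -> : f w - S w - (f z - S z) = (f w - f z - T z (w - z)) + (T z - S) (w - z).
  rewrite clinB [S (w - z)]linearB/=; lmod.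
apply: le_trans (ler_normD _ _) _.
have A1 := Hd w wzd; have A2 := opnorm_le (T z - S) (w - z).
have A3 : `|T z - S| * `|w - z| <= K * `|w - z| by rewrite ler_wpM2r.
apply: le_trans (_ : (K + e1) * `|w - z| <= _); first lra.
rewrite nwz [`|s - t| * _]mulrC mulrA ler_wpM2r// mulrDl lerD2l.
by rewrite /e1 mulrAC ler_pdivrMr// ler_wpM2l ?(ltW e0)// lerDl.
Qed.

End MeanValue.

(** * Products, compositions and affine substitutions of C^n maps *)

Section CnOperations.
Context (R : realType) (X : normedModType R).
Implicit Types (Y : normedModType R).

Lemma bbilinear_scale Y : bbilinear (fun (a : R^o) (y : Y) => a *: y).
Proof.
split.
- by move=> y a b c; rewrite scalerDl scalerA.
- by move=> a b u v; rewrite scalerDr !scalerA mulrC.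
- by exists 1 => // a y; rewrite mul1r normrZ.
Qed.

Lemma Cn_scale n Y (O : set X) (a : X -> R^o) (f : X -> Y) : open O ->
  Cn n O a -> Cn n O f -> Cn n O (fun x => a x *: f x).
Proof. by move=> oO; apply: Cn_bilin => //; exact: bbilinear_scale. Qed.

Lemma bbilinear_eval (Y Z : normedModType R) :
  bbilinear (fun (T : 'L(Y, Z)) (y : Y) => T y).
Proof.
split.
- by move=> y a S T.
- by move=> T a u v; rewrite linearP.
- by exists 1 => // a y; rewrite mul1r opnorm_le.
Qed.

Lemma Cn_clin_comp n (Y Z : normedModType R) (O : set X) (T : 'L(Y, Z)) (f : X -> Y) :
  open O -> Cn n O f -> Cn n O (fun x => T (f x)).
Proof.
move=> oO; apply: (Cn_bilin (@bbilinear_eval Y Z) oO).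
exact: Cn_cst.
Qed.

Lemma has_deriv_affine Y (f : X -> Y) (a : R) (v x : X) (T : 'L(X, Y)) :
  has_deriv f (a *: x + v) T -> has_deriv (fun x => f (a *: x + v)) x (a *: T).
Proof.
move=> H e e0; have e10 : 0 < e / (`|a| + 1) by rewrite divr_gt0// ltr_wpDl.
have a1 : 0 < `|a| + 1 by rewrite ltr_wpDl.
have [d d0 Hd] := H _ e10.
exists (d / (`|a| + 1)); first by rewrite divr_gt0.
move=> y yd; have uE : a *: y + v - (a *: x + v) = a *: (y - x) by lmod.
have nu : `|a *: (y - x)| <= (`|a| + 1) * `|y - x|.
  by rewrite normrZ ler_wpM2r// lerDl.
have := Hd (a *: y + v); rewrite uE clinZ linearZ /=.
move: yd; rewrite ltr_pdivlMr// mulrC => /(le_lt_trans nu) ud /(_ ud).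
move=> /le_trans; apply; apply: le_trans (ler_wpM2l (ltW e10) nu) _.
by rewrite mulrA divfK// gt_eqF.
Qed.

Lemma Cn_affine n Y (O P : set X) (f : X -> Y) (a : R) (v : X) :
  open O -> open P -> (forall x, P x -> O (a *: x + v)) ->
  Cn n O f -> Cn n P (fun x => f (a *: x + v)).
Proof.
move=> oO oP PO; elim: n Y f => [|n IH] Y f.
  move=> /(Cn0P _ oO) H; apply/(Cn0P _ oP) => x Px.
  apply: (@continuous_comp _ _ _ (fun x => a *: x + v) f x _ (H _ (PO _ Px))).
  apply: cvgD; last exact: cvg_cst.
  apply: cvgZl_tmp; exact: cvg_id.
move=> F; apply: (@CnSP _ _ _ _ _ _ (fun x => a *: fderiv f (a *: x + v))) => //.
  by move=> x Px; apply: has_deriv_affine; apply: CnS_has_deriv F _; exact: PO.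
by apply: Cn_scale => //; [exact: Cn_cst|apply: IH F.2].
Qed.

Lemma Cn_mul n (O : set X) (a b : X -> R^o) : open O ->
  Cn n O a -> Cn n O b -> Cn n O (fun x => a x * b x : R^o).
Proof. exact: Cn_scale. Qed.

Lemma Cn_opp n Y (O : set X) (f : X -> Y) : open O ->
  Cn n O f -> Cn n O (fun x => - f x).
Proof.
move=> oO F; apply: (@Cn_eq _ _ _ _ _ (fun x => (-1 : R^o) *: f x)) => //.
  by move=> x _; rewrite scaleN1r.
by apply: Cn_scale => //; exact: Cn_cst.
Qed.

Definition deriv_at (t : R -> R) (x l : R) := forall e : R, 0 < e ->
  exists2 d : R, 0 < d & forall y, `|y - x| < d ->
    `|t y - t x - l * (y - x)| <= e * `|y - x|.

Lemma has_deriv_comp (t : R -> R) (l : R) (h : X -> R^o) (x : X) (T : 'L(X, R^o)) :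
  deriv_at t (h x) l -> has_deriv h x T ->
  has_deriv (fun x => t (h x) : R^o) x ((l : R^o) *: T).
Proof.
move=> Ht Hh e e0.
pose K := `|T| + 1 + `|l|.
have K0 : 0 <= K by rewrite !addr_ge0.
have [e1 /andP[e10 e11] e1K] := eps_small K0 e0.
have [d d0 Hd] := Ht _ e10; have [d' d'0 Hd'] := Hh _ e10.
have T1 : 0 < `|T| + 1 by rewrite ltr_wpDl.
exists (Num.min d' (d / (`|T| + 1))); first by rewrite lt_min d'0 divr_gt0.
move=> y; rewrite lt_min => /andP[yd' yd].
have A := Hd' y yd'.
have B : `|h y - h x| <= (`|T| + 1) * `|y - x|.
  rewrite -[h y - h x](subrK (T (y - x))); apply: le_trans (ler_normD _ _) _.
  have := opnorm_le T (y - x); have : e1 * `|y - x| <= `|y - x| by rewrite ler_piMl.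
  lra.
have hd : `|h y - h x| < d.
  by move: yd; rewrite ltr_pdivlMr// mulrC; exact: le_lt_trans.
have C := Hd _ hd; rewrite clinZ.
have -> : t (h y) - t (h x) - (l : R^o) *: T (y - x) =
  (t (h y) - t (h x) - l * (h y - h x)) + l * (h y - h x - T (y - x)).
  rewrite /GRing.scale/=; ring.
apply: le_trans (ler_normD _ _) _; rewrite normrM.
apply: le_trans (_ : e1 * ((`|T| + 1) * `|y - x|) + `|l| * (e1 * `|y - x|) <= _).
  apply: lerD; last by rewrite ler_wpM2l.
  by apply: le_trans C _; rewrite ler_wpM2l// ltW.
apply: le_trans (_ : e1 * K * `|y - x| <= _); last by rewrite ler_wpM2r.
rewrite /K le_eqVlt; apply/orP; left; apply/eqP; ring.
Qed.

End CnOperations.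

(** * A smooth step function *)

Section SmoothStep.
Context (R : realType).

(** The function t^-j exp(-1/t), extended by 0. The family is closed under differentiation up to
    linear combinations: the derivative of [flat j] is [flat j.+2 t - j%:R * flat j.+1 t], so
    smoothness follows by induction with j varying. *)
Definition flat (j : nat) (t : R) : R :=
  if 0 < t then t^-1 ^+ j * expR (- t^-1) else 0.

Lemma flat_ge0 j t : 0 <= flat j t.
Proof.
rewrite /flat; case: ifPn => // t0.
by rewrite mulr_ge0 ?expR_ge0// exprn_ge0// invr_ge0 ltW.
Qed.

Lemma pow_le_expR (j : nat) (u : R) : 0 <= u -> u ^+ j <= j`!%:R * expR u.
Proof.
move=> u0; case: j => [|j].
  by rewrite expr0 fact0 mul1r -expR0 ler_expR.
have := expR_ge1Dxn j u0; have f0 : 0 < j.+1`!%:R :> R by rewrite ltr0n fact_gt0.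
move=> H; rewrite mulrC -ler_pdivrMr//; lra.
Qed.

Lemma flat_le j t : flat j t <= j`!%:R.
Proof.
rewrite /flat; case: ifPn => // t0; rewrite expRN ler_pdivrMr ?expR_gt0//.
by rewrite pow_le_expR// invr_ge0 ltW.
Qed.

(** For t > 0 it is t^2 times the bounded [flat j.+2 t]. Vanishing to second order yields the
    derivative 0 at the origin. *)
Lemma flat_le_sqr j t : flat j t <= (j.+2)`!%:R * t ^+ 2.
Proof.
have := flat_le j.+2 t; rewrite /flat; case: ifPn => [t0|_ _]; last first.
  by rewrite mulr_ge0// sqr_ge0.
move=> H; have t2 : 0 < t ^+ 2 by rewrite exprn_gt0.
rewrite -ler_pdivrMr//; apply: le_trans H.
rewrite le_eqVlt; apply/orP; left; apply/eqP.
by rewrite -[in RHS]addn2 exprD !exprVn mulrAC.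
Qed.

Lemma flat_deriv j t : deriv_at (flat j) t (flat j.+2 t - j%:R * flat j.+1 t).
Proof.
have [t0|t0|->] := ltgtP t 0.
- move=> e e0; exists (- t); first by rewrite oppr_gt0.
  move=> y yt; have y0 : y < 0 by have := ler_norm (y - t); lra.
  have z k s : s < 0 -> flat k s = 0 by move=> s0; rewrite /flat lt_gtF.
  by rewrite !z// mulr0 !subr0 mul0r subr0 normr0 mulr_ge0// ltW.
- have tn0 : t != 0 by rewrite gt_eqF.
  pose g (s : R) := s^-1 ^+ j * expR (- s^-1).
  have dg : is_derive t (1 : R) g (flat j.+2 t - j%:R * flat j.+1 t).
    have dV : is_derive t (1 : R) (fun s : R => s^-1) (- t ^- 2).
      apply: is_derive_eq; first exact: is_deriveV.
      by rewrite scaler1.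
    have dX : is_derive t (1 : R) (fun s : R => s^-1 ^+ j)
      ((j%:R * t^-1 ^+ j.-1) * (- t ^- 2)).
      have := @is_deriveX _ _ (fun s : R => s^-1) j t 1 _ dV.
      by rewrite exprfctE.
    have dE : is_derive t (1 : R) (fun s : R => expR (- s^-1))
        (t ^- 2 * expR (- t^-1)).
      have dN := @is_deriveN _ _ _ (fun s : R => s^-1) t 1 _ dV.
      have := @is_derive1_comp _ expR (fun s : R => - s^-1) t _ _ (is_derive_expR _) dN.
      by rewrite opprK mulrC.
    have dG := is_deriveM dX dE.
    have {}dG : is_derive t (1 : R) g _ := dG.
    apply: is_derive_eq dG _.
    rewrite /flat t0 /GRing.scale/=; case: (j) => [|i] /=.
      by rewrite !mul0r subr0 mulr0 addr0 expr0 mul1r exprVn.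
    by rewrite !exprS; field.
  have [D Dv] := dg.
  have /cvgrPdist_le cv : (fun h => h^-1 *: ((g \o shift t) (h *: 1) - g t)) @ 0^'
      --> (flat j.+2 t - j%:R * flat j.+1 t).
    by move: D; rewrite -Dv => /cvg_ex[l Dl]; rewrite /derive (cvg_lim _ Dl).
  move=> e e0; have := cv e e0.
  rewrite near_withinE => /nbhs_norm0P[d /= d0 Hd].
  exists (Num.min d t); first by rewrite lt_min d0.
  move=> y; rewrite lt_min => /andP[yd yt].
  have y0 : 0 < y by have := ler_norm (t - y); rewrite distrC; lra.
  have [->|ynt] := eqVneq y t; first by rewrite !subrr mulr0 subr0 normr0 mulr0.
  have yt0 : y - t != 0 by rewrite subr_eq0.
  have := Hd (y - t) yd yt0; rewrite /= [(y - t) *: _]mulr1 subrK.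
  have -> : flat j y = g y by rewrite /flat y0.
  have -> : flat j t = g t by rewrite /flat t0.
  set l := flat j.+2 t - _; rewrite distrC => H.
  have -> : g y - g t - l * (y - t) =
      ((y - t)^-1 *: (g y - g t) - l) * (y - t).
    rewrite [in RHS]mulrBl; congr (_ - _); rewrite /GRing.scale/=; by field.
  by rewrite normrM ler_wpM2r.
- move=> e e0; have f0 : 0 < (j.+2)`!%:R :> R by rewrite ltr0n fact_gt0.
  exists (e / (j.+2)`!%:R); first by rewrite divr_gt0.
  move=> y; rewrite subr0 ltr_pdivlMr// => yd.
  have z k : flat k 0 = 0 by rewrite /flat ltxx.
  rewrite !z mulr0 !subr0 mul0r subr0 ger0_norm ?flat_ge0//.
  apply: le_trans (flat_le_sqr _ _) _.
  by rewrite -real_normK ?num_real// expr2 mulrA ler_wpM2r// mulrC ltW.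
Qed.

Lemma Cn_flat (X : normedModType R) n j (O : set X) (h : X -> R^o) : open O ->
  Cn n O h -> Cn n O (fun x => flat j (h x) : R^o).
Proof.
move=> oO; elim: n j => [|n IH] j H.
  apply/(Cn0P _ oO) => x Ox.
  have hx := (Cn0P _ oO).1 H x Ox.
  apply: (@continuous_comp _ _ _ h (flat j : R^o -> R^o) x hx).
  apply/continuous_forP => e e0.
  have [d d0 Hd] := flat_deriv j (h x) ltr01.
  pose l := flat j.+2 (h x) - j%:R * flat j.+1 (h x).
  have K0 : 0 <= 1 + `|l| by rewrite addr_ge0.
  have [e1 /andP[e10 e11] e1K] := eps_small K0 e0.
  exists (Num.min d e1); first by rewrite lt_min d0.
  move=> y; rewrite lt_min => /andP[/Hd A B].
  rewrite -[flat j y - _](subrK (l * (y - h x))).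
  apply: le_trans (ler_normD _ _) _; rewrite normrM.
  apply: le_trans (_ : (1 + `|l|) * `|y - h x| <= _); first (rewrite -/l in A; lra).
  by apply: le_trans e1K; rewrite mulrC ler_wpM2r// ltW.
have H' := CnW oO H.
apply: (@CnSP _ _ _ _ _ _ (fun x =>
   (flat j.+2 (h x) - j%:R * flat j.+1 (h x) : R^o) *: fderiv h x)) => //.
  move=> x Ox; apply: has_deriv_comp; first exact: flat_deriv.
  exact: CnS_has_deriv H Ox.
apply: Cn_scale => //; last exact: H.2.
apply: Cn_add => //; first exact: IH.
by apply: Cn_opp => //; apply: Cn_mul => //; [exact: Cn_cst|exact: IH].
Qed.

(** The derivative of [flat 0] is [flat 2], which lies between 0 and 2! = 2. *)
Lemma flat0_lip s t : `|flat 0 s - flat 0 t| <= 2 * `|s - t|.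
Proof.
pose phi (u : R) : R^o := flat 0 (t + u * (s - t)).
have -> : flat 0 s - flat 0 t = phi 1 - phi 0.
  have E : t + (s - t) = s by ring.
  by rewrite /phi mul1r mul0r addr0 E.
apply: growth_bound; first by rewrite mulr_ge0.
move=> u u01 e e0; have e1 : 0 < e / (`|s - t| + 1).
  by rewrite divr_gt0// ltr_wpDl.
have st1 : 0 < `|s - t| + 1 by rewrite ltr_wpDl.
have [d d0 Hd] := flat_deriv 0 (t + u * (s - t)) e1.
exists (d / (`|s - t| + 1)); first by rewrite divr_gt0.
move=> v v01; rewrite ltr_pdivlMr// => vu.
have E : t + v * (s - t) - (t + u * (s - t)) = (v - u) * (s - t) by ring.
have nE : `|(v - u) * (s - t)| <= `|v - u| * (`|s - t| + 1).
  by rewrite normrM ler_wpM2l// lerDl.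
have := Hd (t + v * (s - t)); rewrite E => /(_ (le_lt_trans nE vu)).
rewrite mul0r subr0 => H; rewrite /phi.
have fl2 := flat_le 2 (t + u * (s - t)); have fg2 := flat_ge0 2 (t + u * (s - t)).
set l := flat 2 _ in H fl2 fg2.
set p := flat 0 (t + v * _) in H *; set q := flat 0 (t + u * _) in H *.
set w := l * ((v - u) * (s - t)) in H *.
have -> : (p : R^o) - q = (p - q - w) + w by rewrite subrK.
have B1 : `|w| <= 2 * `|s - t| * `|v - u|.
  rewrite /w !normrM (ger0_norm fg2) [`|v - u| * _]mulrC mulrA ler_wpM2r//.
  by rewrite ler_wpM2r// (le_trans fl2)// !factS fact0.
have B2 : `|p - q - w| <= e * `|v - u|.
  apply: le_trans H _; apply: le_trans (ler_wpM2l (ltW e1) nE) _.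
  by rewrite mulrCA [leRHS]mulrC ler_wpM2l// divfK// gt_eqF.
apply: le_trans (ler_normD _ _) _; lra.
Qed.

Lemma flat0_le s t : s <= t -> flat 0 s <= flat 0 t.
Proof.
move=> st; rewrite /flat; case: ifPn => [s0|_]; last exact: flat_ge0.
rewrite (lt_le_trans s0 st) !expr0 !mul1r ler_expR lerN2 lef_pV2 ?posrE//.
exact: lt_le_trans st.
Qed.

Lemma flat_gt0 j t : 0 < t -> 0 < flat j t.
Proof.
by move=> t0; rewrite /flat t0 mulr_gt0 ?expR_gt0// exprn_gt0// invr_gt0.
Qed.

(* Equal to 1 on ]-oo, 0] and to 0 on [1, +oo[; composing the flat function
   with itself avoids the usual quotient. *)
Definition smooth_step (t : R) : R :=
  (flat 0 (flat 0 1))^-1 * flat 0 (flat 0 1 - flat 0 t).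

Let c0 : 0 < flat 0 1. Proof. exact: flat_gt0. Qed.
Let cc0 : 0 < flat 0 (flat 0 1). Proof. exact: flat_gt0. Qed.

Lemma smooth_step1 t : t <= 0 -> smooth_step t = 1.
Proof.
move=> t0; rewrite /smooth_step.
have -> : flat 0 t = 0 by rewrite /flat ltNge t0.
by rewrite subr0 mulVf// gt_eqF.
Qed.

Lemma smooth_step0 t : 1 <= t -> smooth_step t = 0.
Proof.
move=> t1; rewrite /smooth_step; have := flat0_le t1 => H.
have -> : flat 0 (flat 0 1 - flat 0 t) = 0; last by rewrite mulr0.
by rewrite [LHS]/flat ltNge subr_le0 H.
Qed.

Lemma smooth_step_ge0 t : 0 <= smooth_step t.
Proof. by rewrite mulr_ge0 ?flat_ge0// invr_ge0 ltW. Qed.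

Lemma smooth_step_le1 t : smooth_step t <= 1.
Proof.
rewrite /smooth_step mulrC ler_pdivrMr// mul1r flat0_le//.
by rewrite gerBl flat_ge0.
Qed.

Lemma smooth_step_lip : exists2 K : R, 0 <= K & forall s t,
  `|smooth_step s - smooth_step t| <= K * `|s - t|.
Proof.
exists ((flat 0 (flat 0 1))^-1 * 4); first by rewrite mulr_ge0// invr_ge0 ltW.
move=> s t; rewrite /smooth_step -mulrBr normrM ger0_norm ?invr_ge0 ?(ltW cc0)//.
rewrite -mulrA ler_wpM2l ?invr_ge0 ?(ltW cc0)//.
apply: le_trans (flat0_lip _ _) _.
have := flat0_lip t s; have -> : flat 0 1 - flat 0 s - (flat 0 1 - flat 0 t) =
  flat 0 t - flat 0 s by ring.
rewrite [`|t - s|]distrC; lra.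
Qed.

Lemma Cn_smooth_step (X : normedModType R) n (O : set X) (h : X -> R^o) : open O ->
  Cn n O h -> Cn n O (fun x => smooth_step (h x) : R^o).
Proof.
move=> oO H; apply: Cn_mul => //; first exact: Cn_cst.
apply: Cn_flat => //; apply: Cn_add => //; first exact: Cn_cst.
by apply: Cn_opp => //; exact: Cn_flat.
Qed.

End SmoothStep.

(** * Capped distance to a set *)

Section CappedDistance.
Context (R : realType) (X : normedModType R).
Implicit Types (Z : set X) (x y z : X).

(** The cap makes the infimum meaningful for empty [Z], as for the complement of the whole space,
    and makes the square of the distance at most the distance. *)
Definition capdist Z x : R := inf ([set 1] `|` [set `|x - z| | z in Z]).

Let lb Z x : lbound ([set 1] `|` [set `|x - z| | z in Z]) 0.
Proof. by move=> _ [->|[z _ <-]]. Qed.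

Let has_infD Z x : has_inf ([set 1] `|` [set `|x - z| | z in Z]).
Proof. by split; [exists 1; left|exists 0; exact: lb]. Qed.

Lemma capdist_ge0 Z x : 0 <= capdist Z x.
Proof. by apply: lb_le_inf; [exists 1; left|exact: lb]. Qed.

Lemma capdist_le1 Z x : capdist Z x <= 1.
Proof. by apply: ge_inf; [exact: (has_infD _ _).2|left]. Qed.

Lemma capdist_le Z x z : Z z -> capdist Z x <= `|x - z|.
Proof. by move=> Zz; apply: ge_inf; [exact: (has_infD _ _).2|right; exists z]. Qed.

Lemma capdist_lt Z x t : capdist Z x < t -> t <= 1 -> exists2 z, Z z & `|x - z| < t.
Proof.
move=> dt t1.
have e0 : 0 < t - capdist Z x by rewrite subr_gt0.
have [_ [->|[z Zz <-]]] := inf_adherent e0 (has_infD Z x).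
- by rewrite -[inf _]/(capdist Z x); lra.
- by rewrite -[inf _]/(capdist Z x) => H; exists z => //; lra.
Qed.

Lemma le_capdist Z x t : t <= 1 -> (forall z, Z z -> t <= `|x - z|) -> t <= capdist Z x.
Proof.
move=> t1 H; apply: lb_le_inf; first by exists 1; left.
by move=> _ [->|[z Zz <-]] //; exact: H.
Qed.

Lemma capdist_lip Z x y : `|capdist Z x - capdist Z y| <= `|x - y|.
Proof.
suff H a b : capdist Z a <= capdist Z b + `|a - b|.
  have := H x y; have := H y x; rewrite distrC ler_norml => A B.
  by apply/andP; split; lra.
rewrite -lerBlDr; apply: le_capdist => [|z Zz].
  by have := capdist_le1 Z a; have := normr_ge0 (a - b); lra.
have := capdist_le a Zz; have := ler_distD b a z; lra.
Qed.

Lemma capdistC_gt0 (O : set X) x : open O -> O x -> 0 < capdist (~` O) x.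
Proof.
move=> oO Ox; have [r r0 rO] := open_ballP oO Ox.
apply: lt_le_trans (_ : Num.min r 1 <= _); first by rewrite lt_min r0 ltr01.
apply: le_capdist => [|z Oz]; first by rewrite ge_min lexx orbT.
rewrite leNgt; apply/negP; rewrite lt_min => /andP[xz _].
by apply: Oz; apply: rO; rewrite ballE.
Qed.

Lemma capdistC_in (O : set X) x : 0 < capdist (~` O) x -> O x.
Proof.
move=> H; apply: contrapT => Ox.
by have := capdist_le x (Ox : (~` O) x); rewrite subrr normr0; lra.
Qed.

Lemma capdistC_ball (O : set X) x y : `|x - y| < capdist (~` O) x -> O y.
Proof.
by move=> H; apply: contrapT => Oy; have := capdist_le x (Oy : (~` O) y); lra.
Qed.

Lemma capdist_sub Z Z' x : Z `<=` Z' -> capdist Z' x <= capdist Z x.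
Proof.
move=> ZZ; apply: le_capdist; first exact: capdist_le1.
by move=> z /ZZ; exact: capdist_le.
Qed.

End CappedDistance.

(** * Lipschitz approximation on arbitrary balls *)

Section LipschitzApproximationOnBalls.
Context (R : realType) (X Y : normedModType R).

Lemma Ck_affine k (O P : set X) (f : X -> Y) (a : R) (v : X) :
  open O -> open P -> (forall x, P x -> O (a *: x + v)) ->
  Ck k O f -> Ck k P (fun x => f (a *: x + v)).
Proof.
move=> oO oP PO; case: k => [n|] H; last move=> n; exact: Cn_affine PO _.
Qed.

(** Passing to the unit ball multiplies the Lipschitz constant by r and passing back divides it by
    r, so [C] is preserved. *)
Lemma LA_ball k C (c : X) (r : R) (L : R) (f : X -> Y) (e : R) :
  property_LA_with X Y k C -> 0 < r -> 0 <= L -> L.-lipschitz_(ball c r) f -> 0 < e ->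
  exists g : X -> Y, [/\ (C * L).-lipschitz_(ball c r) g, Ck k (ball c r) g &
    forall x, ball c r x -> `|f x - g x| <= e].
Proof.
move=> [C0 LA] r0 L0 /lipschitzP fL e0.
have rn0 : r != 0 by rewrite gt_eqF.
have inB u : ball (0 : X) 1 u -> ball c r (c + r *: u).
  rewrite !ballE /= sub0r normrN opprD addrA subrr sub0r normrN normrZ gtr0_norm//.
  by move=> u1; rewrite gtr_pMr.
have inU x : ball c r x -> ball (0 : X) 1 (r^-1 *: x + (- (r^-1 *: c))).
  rewrite !ballE /= sub0r normrN -scalerBr normrZ normfV gtr0_norm// distrC => xr.
  by rewrite ltr_pdivrMl// mulr1.
have [] := LA (L * r) (fun u => f (c + r *: u)) _ _ e e0.
- by rewrite mulr_ge0// ltW.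
- apply/lipschitzP => u v /inB U /inB V; apply: le_trans (fL _ _ U V) _.
  have -> : c + r *: u - (c + r *: v) = r *: (u - v) by lmod.
  by rewrite normrZ gtr0_norm// mulrA.
move=> g [/lipschitzP gL gk fg].
exists (fun x => g (r^-1 *: x + (- (r^-1 *: c)))); split.
- apply/lipschitzP => x y /inU U /inU V; apply: le_trans (gL _ _ U V) _.
  have -> : r^-1 *: x + - (r^-1 *: c) - (r^-1 *: y + - (r^-1 *: c)) = r^-1 *: (x - y).
    by lmod.
  rewrite normrZ normfV gtr0_norm//.
  by have -> : C * (L * r) * (r^-1 * `|x - y|) = C * L * `|x - y| by field.
- by apply: Ck_affine gk => //; exact: ball_open.
- move=> x xB; have := fg _ (inU _ xB).
  have -> : c + r *: (r^-1 *: x - r^-1 *: c) = x; last by [].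
  by rewrite scalerBr !scalerA divff// !scale1r addrC subrK.
Qed.

End LipschitzApproximationOnBalls.

(* A minimal sublinear functional is linear, and Zorn's lemma provides one below
   any given sublinear functional. *)
Section HahnBanach.
Context (R : realType) (Y : normedModType R).

Definition sublinear (p : Y -> R) :=
  [/\ forall x y, p (x + y) <= p x + p y,
      forall a x, 0 <= a -> p (a *: x) = a * p x &
      forall x, p x <= `|x|].

Lemma sublinear0 p : sublinear p -> p 0 = 0.
Proof. by move=> [_ H _]; rewrite -(scale0r 0) H// mul0r. Qed.

Lemma sublinear_ge p x : sublinear p -> - `|x| <= p x.
Proof.
move=> sp; have [A B C] := sp; have := A x (- x); have := C (- x).
by rewrite subrr normrN (sublinear0 sp); lra.
Qed.

(** The functional is q(x) = inf over t >= 0 of p(x + t v) - t p(v). A minimal p must equal q, and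
    q(-v) <= -p(v) then says that p is odd; an odd sublinear functional is linear. *)
Lemma sublinear_reduce p v : sublinear p -> exists q,
  [/\ sublinear q, forall x, q x <= p x & q (- v) <= - p v].
Proof.
move=> sp; have [pD pZ pn] := sp.
pose S x := [set p (x + t *: v) - t * p v | t in [set t | 0 <= t]].
have lbS x : lbound (S x) (- p (- x)).
  move=> _ [t /= t0 <-]; have := pD (x + t *: v) (- x).
  by rewrite addrAC subrr add0r pZ//; lra.
have infS x : has_inf (S x).
  by split; [exists (p (x + 0 *: v) - 0 * p v); exists 0 => /=|exists (- p (- x)); exact: lbS].
pose q x := inf (S x).
have q_le x t : 0 <= t -> q x <= p (x + t *: v) - t * p v.
  by move=> t0; apply: ge_inf; [exact: (infS x).2|exists t].
have qp x : q x <= p x.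
  by have := q_le x 0 (lexx _); rewrite scale0r addr0 mul0r subr0.
have q_adh x e : 0 < e -> exists2 t, 0 <= t & p (x + t *: v) - t * p v < q x + e.
  by move=> e0; have [_ [t t0 <-] H] := inf_adherent e0 (infS x); exists t.
have qZ_le a x : 0 < a -> q (a *: x) <= a * q x.
  move=> a0; apply/ler_addgt0Pr => e e0.
  have [t t0 H] := q_adh x (e / a) (divr_gt0 e0 a0).
  have := q_le (a *: x) (a * t) (mulr_ge0 (ltW a0) t0).
  rewrite -scalerA -scalerDr pZ ?(ltW a0)//.
  have : a * (p (x + t *: v) - t * p v) <= a * (q x + e / a).
    by rewrite ler_wpM2l ?(ltW a0)// ltW.
  have -> : a * (q x + e / a) = a * q x + e by field; rewrite ?gt_eqF.
  lra.
exists q; split => //; last first.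
  by have := q_le (- v) 1 ler01; rewrite scale1r addNr (sublinear0 sp) mul1r sub0r.
split.
- move=> x y; apply/ler_addgt0Pr => e e0.
  have e2 : 0 < e / 2 by rewrite divr_gt0.
  have [s s0 Hs] := q_adh x _ e2; have [t t0 Ht] := q_adh y _ e2.
  have := q_le (x + y) (s + t) (addr_ge0 s0 t0).
  have := pD (x + s *: v) (y + t *: v); rewrite addrACA -scalerDl; lra.
- move=> a x; rewrite le_eqVlt => /predU1P[<-|a0].
    rewrite scale0r mul0r; apply/eqP; rewrite eq_le; apply/andP; split.
      by apply: le_trans (qp _) _; rewrite (sublinear0 sp).
    apply: lb_le_inf; first exact: (infS 0).1.
    by move=> u /(lbS 0); rewrite oppr0 (sublinear0 sp) oppr0.
  apply/eqP; rewrite eq_le qZ_le//=.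
  have ai : 0 < a^-1 by rewrite invr_gt0.
  have := qZ_le a^-1 (a *: x) ai; rewrite scalerA mulVf ?gt_eqF// scale1r.
  by rewrite -ler_pdivlMl.
- by move=> x; exact: le_trans (qp x) (pn x).
Qed.

Lemma sublinear_norm : sublinear (fun x : Y => `|x|).
Proof.
split=> [x y|a x a0|//]; first exact: ler_normD.
by rewrite normrZ ger0_norm.
Qed.

Lemma minimal_sublinear p : sublinear p -> exists q,
  [/\ sublinear q, forall x, q x <= p x &
      forall r, sublinear r -> (forall x, r x <= q x) -> r = q].
Proof.
move=> sp; pose T := {q : Y -> R | sublinear q /\ forall x, q x <= p x}.
(* The order is reversed, so that the maximal elements of Zorn's lemma are minimal functionals. *)
pose le (q r : T) := `[< forall x, sval r x <= sval q x >].
have [] := @Zorn T le.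
- by move=> q; apply/asboolP.
- move=> q r s /asboolP A /asboolP B; apply/asboolP => x.
  exact: le_trans (B x) (A x).
- move=> [q Hq] [r Hr] /asboolP A /asboolP B; apply: eq_exist.
  by apply/funext => x; apply/eqP; rewrite eq_le A B.
- move=> A totA; have [[a Aa]|An] := pselect (exists a, A a); last first.
    by exists (exist _ p (conj sp (fun x => lexx _))) => s As; case: An; exists s.
  (* A chain is bounded by its pointwise infimum, finite since its members are at least -|x|.
     Subadditivity survives because the smaller of two members of the chain serves at both
     points. *)
  pose S x := [set sval q x | q in A].
  have infS x : has_inf (S x).
    split; first by exists (sval a x); exists a.
    by exists (- `|x|) => _ [q _ <-]; apply: sublinear_ge; case: (svalP q).
  pose m x := inf (S x).
  have m_le q x : A q -> m x <= sval q x.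
    by move=> Aq; apply: ge_inf; [exact: (infS x).2|exists q].
  have m_adh x e : 0 < e -> exists2 q, A q & sval q x < m x + e.
    by move=> e0; have [_ [q Aq <-] H] := inf_adherent e0 (infS x); exists q.
  have sm : sublinear m.
    split.
    - move=> x y; apply/ler_addgt0Pr => e e0.
      have e2 : 0 < e / 2 by rewrite divr_gt0.
      have [q Aq Hq] := m_adh x _ e2; have [r Ar Hr] := m_adh y _ e2.
      have [s [As sq sr]] : exists s, [/\ A s, sval s x <= sval q x & sval s y <= sval r y].
        by have [/asboolP H|/asboolP H] := totA _ _ Aq Ar; [exists r|exists q].
      have := m_le s (x + y) As; have [[D _ _] _] := svalP s; have := D x y; lra.
    - move=> c x c0; apply/eqP; rewrite eq_le; apply/andP; split.
        apply/ler_addgt0Pr => e e0.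
        have [d /andP[d0 _] dc] := eps_small c0 e0.
        have [q Aq Hq] := m_adh x _ d0.
        apply: le_trans (m_le _ _ Aq) _; have [[_ Z _] _] := svalP q.
        rewrite Z//; apply: le_trans (ler_wpM2l c0 (ltW Hq)) _.
        by rewrite mulrDr lerD2l mulrC.
      apply: lb_le_inf; first exact: (infS _).1.
      move=> _ [q Aq <-]; have [[_ Z _] _] := svalP q.
      by rewrite Z// ler_wpM2l// m_le.
    - by move=> x; apply: le_trans (m_le a x Aa) _; have [[_ _ N] _] := svalP a.
  have mp x : m x <= p x.
    by apply: le_trans (m_le a x Aa) _; have [_] := svalP a.
  by exists (exist _ m (conj sm mp)) => s As; apply/asboolP => x /=; exact: m_le.
- move=> [q [sq qp]] Hq; exists q; split => // r sr rq.
  have rp x : r x <= p x by exact: le_trans (rq x) (qp x).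
  have : le (exist _ q (conj sq qp)) (exist _ r (conj sr rp)) by exact/asboolP.
  by move=> /Hq/(congr1 sval).
Qed.

Lemma norming_functional (v : Y) : exists T : 'L(Y, R^o), `|v| <= T v.
Proof.
(* Reducing the norm at -v gives p(v) <= -|v|, which a minimal q below p inherits; the functional
   sought is -q. *)
have [p [sp _ pv]] := sublinear_reduce (- v) sublinear_norm.
rewrite opprK normrN in pv.
have [q [sq qp qmin]] := minimal_sublinear sp.
have [qD qZ qn] := sq.
have qN x : q (- x) = - q x.
  have [r [sr rq rx]] := sublinear_reduce x sq.
  have rE := qmin _ sr rq; have := qD x (- x); rewrite subrr (sublinear0 sq).
  by rewrite -rE in rx *; lra.
have qDE x y : q (x + y) = q x + q y.
  have A := qD x y; have := qD (- x) (- y); rewrite -opprD !qN; lra.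
have qlin : linear (q : Y -> R^o).
  move=> a x y; rewrite qDE; congr (_ + _).
  have [a0|a0] := leP 0 a; first exact: qZ.
  rewrite -{1}[a]opprK scaleNr qN qZ ?oppr_ge0 ?(ltW a0)//.
  by rewrite mulNr opprK.
have [] : exists c : R, forall x, `|q x| <= c * `|x|.
  exists 1 => x; rewrite mul1r ler_norml qn andbT.
  exact: sublinear_ge.
move=> c qc; exists (- to_clin (q : Y -> R^o)).
rewrite clinN (to_clinE qlin qc); have := qp v; lra.
Qed.

End HahnBanach.

(** * Partitions of unity *)

Section ScalarApproximation.
Context (R : realType) (X Y : normedModType R).

(** Approximate [f x *: v] in Y and apply T / T(v) with T norming v. Thus (LA_k) of the pair also
    supplies real C^k functions on X, hence C^k partitions of unity. *)
Lemma LA_scalar k (v : Y) : v != 0 -> property_LA X Y k -> property_LA X R^o k.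
Proof.
move=> v0 [C [C0 LA]].
have [T Tv] := norming_functional v.
have v1 : 0 < `|v| by rewrite normr_gt0.
have Tv0 : 0 < T v by exact: lt_le_trans Tv.
exists ((T v)^-1 * `|T| * C * `|v|); split.
  by rewrite !mulr_ge0// invr_ge0 ltW.
move=> L f L0 /lipschitzP fL e e0.
have [|||g [/lipschitzP gL gk fg]] := LA (L * `|v|) (fun x => f x *: v) _ _
    (e * T v / (`|T| + 1)) _.
- by rewrite mulr_ge0.
- apply/lipschitzP => x y Bx By; rewrite -scalerBl normrZ mulrAC ler_wpM2r//.
  exact: fL.
- by rewrite divr_gt0 ?mulr_gt0// ltr_wpDl.
exists (fun x => (T v)^-1 * T (g x)); split.
- apply/lipschitzP => x y Bx By; rewrite -mulrBr normrM gtr0_norm ?invr_gt0//.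
  rewrite -!mulrA ler_wpM2l ?invr_ge0 ?(ltW Tv0)// -(linearB T)/=.
  apply: le_trans (opnorm_le _ _) _; rewrite ler_wpM2l//.
  by apply: le_trans (gL _ _ Bx By) _; rewrite !mulrA [C * L * _]mulrAC.
- have H n : Cn n (ball 0 1) g -> Cn n (ball 0 1) (fun x => (T v)^-1 * T (g x) : R^o).
    move=> gn; apply: Cn_mul; [exact: ball_open|exact/Cn_cst/ball_open|].
    by apply: Cn_clin_comp => //; exact: ball_open.
  by case: k gk {LA} => [n|] gk; [exact: H|move=> n; exact: H].
- move=> x Bx; have := fg x Bx; have := opnorm_le T (f x *: v - g x).
  rewrite linearB linearZ /= => A B.
  have -> : f x - (T v)^-1 * T (g x) = (T v)^-1 * (f x *: T v - T (g x)).
    by rewrite /GRing.scale/=; field; rewrite gt_eqF.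
  rewrite normrM gtr0_norm ?invr_gt0// ler_pdivrMl//.
  apply: le_trans A _; apply: le_trans (ler_wpM2l (normr_ge0 T) B) _.
  rewrite mulrA ler_pdivrMr ?ltr_wpDl// [T v * e]mulrC [leRHS]mulrC.
  by rewrite ler_wpM2r ?lerDl// mulr_ge0// ltW.
Qed.

End ScalarApproximation.

(** [s x] is the least element of [Q x] for a well-ordering of T: if each of two chosen values is
    admissible at the other point, each is below the other. In the partition of unity this separates
    the pieces with different indices. *)
Lemma least_selection (S T : choiceType) (t0 : T) (Q : S -> set T) :
  exists s : S -> T, (forall x, Q x !=set0 -> Q x (s x)) /\
    forall x y, Q x (s y) -> Q y (s x) -> s x = s y.
Proof.
have [le wo] := wochoice.well_ordering_principle T.
pose A x : {pred T} := [pred i | `[< Q x i >]].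
have minE x : Q x !=set0 -> exists i, wochoice.minimum_of le (A x) i.
  move=> [i Qi]; have [|j [mj _]] := wo (A x); last by exists j.
  by exists i; apply/asboolP.
pose s x := xget t0 (wochoice.minimum_of le (A x)).
have sP x : Q x !=set0 -> wochoice.minimum_of le (A x) (s x).
  by move=> /minE; exact: xgetPex.
exists s; split=> [x /sP[/asboolP//]|x y xy yx].
have [_ lx] := sP x (ex_intro _ _ xy); have [_ ly] := sP y (ex_intro _ _ yx).
have Lxy : le (s x) (s y) by apply: lx; exact/asboolP.
have Lyx : le (s y) (s x) by apply: ly; exact/asboolP.
have := @wochoice.wo_chain_antisymmetric T le predT; apply => //.
  by move=> B _; exact: wo.
by rewrite Lxy Lyx.
Qed.

Lemma half_pow_lt (R : realType) (r : R) : 0 < r ->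
  exists N, forall n, (N <= n)%N -> 2^-1 ^+ n < r.
Proof.
move=> r0; have := @cvg_expr R 2^-1.
rewrite ger0_norm ?invr_ge0// invf_lt1// ltr1n => /(_ isT).
move=> /cvgrPdist_lt/(_ _ r0)[N _ HN]; exists N => n Nn.
by have := HN n Nn; rewrite /= sub0r normrN ger0_norm// exprn_ge0// invr_ge0.
Qed.

Section PartitionOfUnity.
Context (R : realType) (X : normedModType R).

Lemma CkP k (O : set X) (Y : normedModType R) (f : X -> Y) :
  Ck k O f <-> forall n, (if k is Cfinite m then n = m else True) -> Cn n O f.
Proof.
by case: k => [m|] /=; split => [H n|H]; [move=> ->|exact: H|move=> _; exact: H|move=> n; exact: H].
Qed.

(** A smooth step applied to an approximation of the distance to E. The approximation lives on the
    ball of radius n + 2 only; as E is bounded, the cutoff vanishes from radius n + 1 on and can be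
    continued by 0. *)
Lemma smooth_cutoff k (E : set X) (h : R) (n : nat) : property_LA X R^o k ->
  0 < h <= 1 -> (forall x, E x -> `|x| <= n%:R) ->
  exists phi : X -> R^o, [/\ Ck k setT phi,
    exists2 c : R, 0 < c & forall x y, `|phi x - phi y| <= c * `|x - y|,
    forall x, 0 <= phi x <= 1,
    forall x, capdist E x < h / 16 -> phi x = 1 &
    forall x, h / 4 <= capdist E x -> phi x = 0].
Proof.
move=> [C LA] /andP[h0 h1] En.
pose r : R := n%:R + 2.
have r0 : 0 < r by rewrite ltr_wpDl.
have h16 : 0 < h / 16 by rewrite divr_gt0.
have [|g [/lipschitzP gL gk fg]] :=
    @LA_ball _ _ R^o k C 0 r 1 (capdist E) (h / 16) LA r0 ler01 _ h16.
  by apply/lipschitzP => x y _ _; rewrite mul1r; exact: capdist_lip.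
have Br (x : X) : ball 0 r x <-> `|x| < r by rewrite ballE/= sub0r normrN.
(* As g is within h/16 of the distance, a distance below h/16 gives g < h/8, where the step is 1,
   and a distance of at least h/4 gives g >= 3h/16, where it is 0. *)
pose st (x : X) := smooth_step (16 / h * (g x - h / 8)).
pose phi (x : X) : R^o := if `|x| < r then st x else 0.
have far (x : X) : n%:R + 1 <= `|x| -> h / 4 <= capdist E x.
  move=> xn; apply: (@le_trans _ _ 1); first lra.
  apply: le_capdist => // z /En zn.
  by have := lerB_normD x (- z); rewrite normrN; lra.
have phi0 x : h / 4 <= capdist E x -> phi x = 0.
  move=> dx; rewrite /phi; case: ifPn => // /Br/fg.
  rewrite ler_norml => /andP[_ gx]; apply: smooth_step0.
  have E1 : 16 / h * (h / 16) = 1 by field; rewrite gt_eqF.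
  apply: le_trans (_ : 16 / h * (h / 16) <= _); first by rewrite E1.
  by rewrite ler_wpM2l ?divr_ge0 ?(ltW h0)//; lra.
have phi1 x : capdist E x < h / 16 -> phi x = 1.
  move=> dx; have [|z Ez xz] := capdist_lt dx; first lra.
  have zn := En _ Ez; have xr : `|x| < r.
    by have := ler_normD (x - z) z; rewrite subrK /r; lra.
  rewrite /phi xr; apply: smooth_step1; apply: mulr_ge0_le0.
    by rewrite divr_ge0// ltW.
  by have := fg _ ((Br x).2 xr); rewrite ler_norml => /andP[]; lra.
have phi01 x : 0 <= phi x <= 1.
  rewrite /phi; case: ifPn => _; last by rewrite lexx ler01.
  by rewrite smooth_step_ge0 smooth_step_le1.
exists phi; split => //.
- apply/CkP => m km; have gm : Cn m (ball 0 r) g by move/CkP : gk; apply.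
  apply: Cn_local => [|x _]; first exact: openT.
  have [xr|xr] := ltP `|x| r.
    have [|d d0 dr] := @open_ballP _ _ (ball 0 r) x (ball_open _ _); first exact/Br.
    exists d => //; apply: (@Cn_sub _ _ _ _ _ (ball 0 r)) => //; try exact: ball_open.
    apply: (@Cn_eq _ _ _ _ _ (fun x => st x : R^o)); first exact: ball_open.
      by move=> y /Br yr; rewrite /phi yr.
    have oB := @ball_open _ _ (0 : X) r.
    apply: Cn_smooth_step => //; apply: Cn_mul => //; first exact: Cn_cst.
    by apply: Cn_add => //; exact: Cn_cst.
  exists 1 => //; apply: (@Cn_eq _ _ _ _ _ (fun=> 0 : R^o)); first exact: ball_open.
    rewrite ballE => y /= xy; rewrite phi0//; apply: far.
    have := ler_distD y x 0; rewrite !subr0 /r in xr *; lra.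
  exact/Cn_cst/ball_open.
have [K K0 stL] := smooth_step_lip R.
have C0 : 0 <= C by case: LA.
(* The summand 1 is for pairs with one point beyond radius n + 2 and the other where [phi] may be
   non-zero: these are at least 1 apart. *)
pose c := K * (16 / h * C) + 1.
have c1 : 1 <= c by rewrite lerDr !mulr_ge0// invr_ge0 ltW.
exists c; first by exact: lt_le_trans c1.
have H x y : `|x| <= `|y| -> `|phi x - phi y| <= c * `|x - y|.
  move=> xy; have [yr|yr] := ltP `|y| r.
    have xr := le_lt_trans xy yr.
    rewrite /phi xr yr; apply: le_trans (stL _ _) _.
    have -> : 16 / h * (g x - h / 8) - 16 / h * (g y - h / 8) =
      16 / h * (g x - g y) by ring.
    rewrite normrM [`|16 / h|]ger0_norm ?divr_ge0 ?(ltW h0)//.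
    apply: le_trans (_ : K * (16 / h * C) * `|x - y| <= _).
      have a0 : 0 <= 16 / h by rewrite divr_ge0 ?(ltW h0).
      rewrite -[leRHS]mulrA ler_wpM2l// -[leRHS]mulrA ler_wpM2l//.
      by have := gL x y; rewrite mulr1; apply; exact/Br.
    by rewrite ler_wpM2r// lerDl.
  rewrite [phi y]phi0 ?subr0; last by apply: far; rewrite /r in yr; lra.
  have [x1|x1] := ltP `|x| (n%:R + 1); last by rewrite phi0 ?far// normr0 mulr_ge0//; lra.
  have /andP[p0 p1] := phi01 x; rewrite ger0_norm//.
  have xy1 : 1 <= `|x - y|.
    by have := lerB_normD y (- x); rewrite normrN distrC /r in yr *; lra.
  by apply: le_trans p1 _; have := ler_pM ler01 ler01 c1 xy1; rewrite mulr1.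
move=> x y; have [xy|/ltW yx] := leP `|x| `|y|; first exact: H.
by rewrite distrC [`|x - y|]distrC; exact: H.
Qed.

(* The supports are split into pieces, 2^-n apart for each n, on which the index
   [sigma n] is constant: this is M. E. Rudin's proof of paracompactness, with
   [psi n] smoothly approximating a sigma-discrete refinement. *)
Lemma partition_of_unity k (I : set X) (V : X -> set X) :
  property_LA X R^o k -> (forall i, I i -> open (V i)) ->
  exists psi : nat -> X -> R^o, exists c : nat -> R, exists sigma : nat -> X -> X,
  [/\ forall n, Ck k setT (psi n),
      forall n x, 0 <= psi n x,
      forall n, 0 < c n /\ forall x y, `|psi n x - psi n y| <= c n * `|x - y|,
      forall i x, I i -> V i x -> exists N, exists2 d : R, 0 < d &
        forall y, `|x - y| < d -> (forall n, (N <= n)%N -> psi n y = 0) /\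
          \sum_(n < N) psi n y = 1 &
      forall n x, exists2 d : R, 0 < d & (forall y, `|x - y| < d -> psi n y = 0) \/
        exists2 i, I i & forall y, `|x - y| < d -> V i y /\ sigma n y = i].
Proof.
move=> LA oV.
have [sg [sgQ sgE]] := @least_selection X X 0 (fun x i => I i /\ V i x).
pose h (n : nat) : R := 2^-1 ^+ n.
have h0 n : 0 < h n by rewrite exprn_gt0// invr_gt0.
have h1 n : h n <= 1 by rewrite exprn_ile1 ?invr_ge0 ?invf_le1 ?ler1n.
pose E n := [set x | [/\ (I (sg x) /\ V (sg x) x), `|x| <= n%:R &
                        ball x (h n) `<=` V (sg x)]].
(* Points of [E n] closer than 2^-n lie in each other's chosen set, so leastness forces the same
   index. *)
have EE n x y : E n x -> E n y -> `|x - y| < h n -> sg x = sg y.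
  move=> [[Ix _] _ Bx] [[Iy _] _ By] xy; apply: sgE; split => //.
    by apply: By; rewrite ballE /= distrC.
  by apply: Bx; rewrite ballE.
have h01 n : 0 < h n <= 1 by rewrite h0 h1.
have En n x : E n x -> `|x| <= n%:R by case.
have cut n := smooth_cutoff LA (h01 n) (En n).
have [phi phiP] := choice cut.
have phi01 n x : 0 <= phi n x <= 1 by have [] := phiP n.
(* The differences of consecutive P telescope: the first m of them sum to 1 - P m, which is exactly
   1 as soon as an earlier phi equals 1. *)
pose P n x : R^o := \prod_(m < n) (1 - phi m x).
have PS n x : P n.+1 x = P n x * (1 - phi n x) by rewrite /P big_ord_recr.
have P01 n x : 0 <= P n x <= 1.
  elim: n => [|n /andP[A B]]; first by rewrite /P big_ord0 ler01 lexx.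
  rewrite PS; have /andP[a b] := phi01 n x; rewrite mulr_ge0 ?subr_ge0//=.
  by rewrite mulr_ile1// ?subr_ge0// lerBlDr lerDl.
have P0 n m x : phi n x = 1 -> (n < m)%N -> P m x = 0.
  move=> p1; elim: m => // m IH; rewrite ltnS leq_eqVlt => /predU1P[<-|nm].
    by rewrite PS p1 subrr mulr0.
  by rewrite PS IH// mul0r.
have CkP' n : Ck k setT (P n).
  apply/CkP => j jk; elim: n => [|n IH].
    apply: (@Cn_eq _ _ _ _ _ (fun=> 1 : R^o)); [exact: openT|by move=> x _; rewrite /P big_ord0|].
    exact/Cn_cst/openT.
  apply: (@Cn_eq _ _ _ _ _ (fun x => P n x * (1 - phi n x) : R^o)); [exact: openT|by move=> x _; rewrite PS|].
  apply: Cn_mul => //; first exact: openT.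
  apply: Cn_add; [exact: openT|exact/Cn_cst/openT|apply: Cn_opp; first exact: openT].
  by have [/CkP + _ _ _ _] := phiP n; apply.
have PL n : exists2 c : R, 0 < c & forall x y, `|P n x - P n y| <= c * `|x - y|.
  elim: n => [|n [c c0 IH]].
    by exists 1 => // x y; rewrite /P !big_ord0 subrr normr0 mul1r.
  have [_ [c' c'0 pc'] _ _ _] := phiP n.
  exists (c + c'); first by rewrite addr_gt0.
  move=> x y; rewrite !PS.
  have -> : P n x * (1 - phi n x) - P n y * (1 - phi n y) =
     (P n x - P n y) * (1 - phi n x) + P n y * (phi n y - phi n x) by ring.
  apply: le_trans (ler_normD _ _) _; rewrite !normrM mulrDl.
  have /andP[a b] := phi01 n x; have /andP[a' b'] := P01 n y.
  apply: lerD.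
    by apply: le_trans (IH x y); rewrite ler_piMr// ger0_norm ?subr_ge0// lerBlDr lerDl.
  apply: le_trans (_ : `|phi n y - phi n x| <= _); last by rewrite distrC.
  by rewrite ler_piMl// ger0_norm.
have [c cP] := choice (fun n => let: ex_intro2 c c0 H := PL n in ex_intro _ c (conj c0 H)).
pose psi n x : R^o := P n x - P n.+1 x.
have psi0 n y : phi n y = 0 -> psi n y = 0.
  by move=> p0; rewrite /psi PS p0 subr0 mulr1 subrr.
(* The index at y is that of any point of [E n] within 2^-n / 2 of y: two such points are less than
   2^-n apart. The default 0 of [xget] is taken only where [psi n] vanishes. *)
exists psi, (fun n => c n + c n.+1), (fun n y => sg (xget 0 [set e | E n e /\ `|y - e| < h n / 2])).
split.
- move=> n; apply/CkP => j jk; apply: Cn_add; first exact: openT.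
    by have /CkP := CkP' n; apply.
  by apply: Cn_opp; [exact: openT|have /CkP := CkP' n.+1; apply].
- move=> n x; rewrite /psi PS subr_ge0 ler_piMr//; first by have /andP[] := P01 n x.
  by rewrite lerBlDr lerDl; have /andP[] := phi01 n x.
- move=> n; have [c0 H] := cP n; have [c0' H'] := cP n.+1.
  split=> [|x y]; first by rewrite addr_gt0.
  rewrite /psi; have -> : P n x - P n.+1 x - (P n y - P n.+1 y) =
    (P n x - P n y) + (P n.+1 y - P n.+1 x) by ring.
  apply: le_trans (ler_normD _ _) _; rewrite mulrDl lerD// distrC; exact: H'.
- move=> i x Ii Vx.
  have [Isx Vsx] : I (sg x) /\ V (sg x) x by apply: sgQ; exists i.
  have [r r0 rV] := open_ballP (oV _ Isx) Vsx.
  have [n [hn xn]] : exists n, h n < r /\ `|x| <= n%:R.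
    have [m Hm] := half_pow_lt r0.
    have := archi_boundP (normr_ge0 x); set a := Num.bound _ => xa.
    exists (maxn m a); split; first by apply: Hm; exact: leq_maxl.
    by apply: le_trans (ltW xa) _; rewrite ler_nat leq_maxr.
  have Ex : E n x.
    by split => //; apply: subset_trans rV; exact/le_ball/ltW.
  exists n.+1, (h n / 16) => [|y xy]; first by rewrite divr_gt0.
  have p1 : phi n y = 1.
    have [_ _ _ p1 _] := phiP n; apply: p1; apply: le_lt_trans xy.
    by rewrite distrC; exact: capdist_le.
  split=> [m nm|].
    by rewrite /psi (P0 n m y p1 nm) (P0 n m.+1 y p1 (ltnW nm)) subrr.
  have tele m : \sum_(j < m) psi j y = 1 - P m y.
    elim: m => [|m IH]; first by rewrite big_ord0 /P big_ord0 subrr.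
    by rewrite big_ord_recr /= IH /psi addrA subrK.
  by rewrite tele (P0 n)// subr0.
- move=> n x; exists (h n / 16); first by rewrite divr_gt0.
  (* Moving by h/16 leaves a distance of at least 3h/8 above h/4, where psi vanishes, and leaves a
     point of [E n] at distance below 3h/8 within h/2. *)
  have [dx|dx] := ltP (capdist (E n) x) (3 / 8 * h n); last first.
    left=> y xy; apply: psi0; have [_ _ _ _] := phiP n; apply.
    have := capdist_lip (E n) x y; rewrite ler_norml => /andP[_]; have := h0 n; lra.
  right; have [|e Ee xe] := capdist_lt dx; first by have := h1 n; lra.
  exists (sg e); first by case: Ee => -[].
  move=> y xy; have ey : `|e - y| < 7 / 16 * h n.
    by have := ler_distD x e y; rewrite [`|e - x|]distrC; have := h0 n; lra.
  split.
    case: Ee => _ _; apply; rewrite ballE /=.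
    by have := h0 n; lra.
  have [] : [set e | E n e /\ `|y - e| < h n / 2] (xget 0 [set e | E n e /\ `|y - e| < h n / 2]).
    by apply: xgetPex; exists e; split => //; rewrite distrC; have := h0 n; lra.
  set e' := xget _ _ => Ee' ye'; apply/esym; apply: (EE n) => //.
  by have := ler_distD y e e'; have := h0 n; lra.
Qed.

End PartitionOfUnity.

(** * Gluing *)

Section Gluing.
Context (R : realType) (X : normedModType R).

Lemma min_radius (N : nat) (Q : nat -> R -> Prop) :
  (forall n d d', 0 < d' -> d' <= d -> Q n d -> Q n d') ->
  (forall n, exists2 d : R, 0 < d & Q n d) ->
  exists2 d : R, 0 < d & forall n, (n < N)%N -> Q n d.
Proof.
move=> mono H; elim: N => [|N [d d0 IH]]; first by exists 1.
have [d' d'0 Qd'] := H N.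
have m0 : 0 < Num.min d d' by rewrite lt_min d0.
exists (Num.min d d') => // n; rewrite ltnS leq_eqVlt => /predU1P[->|/IH].
  by apply: mono Qd' => //; rewrite ge_min lexx orbT.
by apply: mono => //; rewrite ge_min lexx.
Qed.

(** The order of quantifiers matters: the weights and their Lipschitz constants come before the
    local maps [H i n], which can therefore be adapted to [c n]. Near x all indices are frozen at
    [sigma n x]. *)
Lemma gluing k (I : set X) (V : X -> set X) :
  property_LA X R^o k -> (forall i, I i -> open (V i)) ->
  exists psi : nat -> X -> R^o, exists c : nat -> R, exists sigma : nat -> X -> X,
  [/\ forall n, Ck k setT (psi n),
      forall n x, 0 <= psi n x,
      forall n, 0 < c n /\ forall x y, `|psi n x - psi n y| <= c n * `|x - y| &
      forall (Y : normedModType R) (H : X -> nat -> X -> Y), exists g : X -> Y,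
        forall i x, I i -> V i x -> exists N, exists2 d : R, 0 < d &
        (forall y, `|x - y| < d -> g y = \sum_(n < N) psi n y *: H (sigma n x) n y /\
            \sum_(n < N) psi n y = 1) /\
        forall n, (n < N)%N -> (forall y, `|x - y| < d -> psi n y = 0) \/
          (I (sigma n x) /\ forall y, `|x - y| < d -> V (sigma n x) y)].
Proof.
move=> LA oV; have [psi [c [sigma [sC s0 sL fin loc]]]] := partition_of_unity LA oV.
exists psi, c, sigma; split => // Y H.
have xx (x : X) (e : R) : 0 < e -> `|x - x| < e by rewrite subrr normr0.
have [N HN] : {N : X -> nat | forall x, (exists2 i, I i & V i x) ->
    forall n, (N x <= n)%N -> psi n x = 0}.
  suff /choice[N HN] : forall x, exists N, (exists2 i, I i & V i x) ->
    forall n, (N <= n)%N -> psi n x = 0 by exists N.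
  move=> x; have [[i Ii Vx]|nV] := pselect (exists2 i, I i & V i x); last by exists 0%N.
  by have [N [d d0 Hd]] := fin i x Ii Vx; exists N => _; have [] := Hd x (xx x d d0).
(* The cut [N y] depends on the point; near x the sum agrees with the one up to a fixed M, all
   further terms being zero. *)
exists (fun y => \sum_(n < N y) psi n y *: H (sigma n y) n y).
move=> i x Ii Vx; have [M [d d0 Hd]] := fin i x Ii Vx.
pose Q n d := (forall y, `|x - y| < d -> psi n y = 0) \/
  (I (sigma n x) /\ forall y, `|x - y| < d -> V (sigma n x) y /\ sigma n y = sigma n x).
have [||d' d'0 Qd'] := @min_radius M Q.
- move=> n e e' e'0 e'e [A|[A B]]; [left|right; split => //] => y ye.
    by apply: A; exact: lt_le_trans e'e.
  by apply: B; exact: lt_le_trans e'e.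
- move=> n; have [e e0 [A|[j Ij A]]] := loc n x; exists e => //; first by left.
  right; have [Vj sj] := A x (xx x e e0); rewrite sj; split => // y /A[Vy ->].
have [r r0 rV] := open_ballP (oV i Ii) Vx.
exists M, (Num.min (Num.min d d') r); first by rewrite !lt_min d0 d'0.
split=> [y|n nM].
  rewrite !lt_min => /andP[/andP[yd yd'] yr].
  have [z s1] := Hd y yd; split => //.
  have Vy : V i y by apply: rV; rewrite ballE.
  have HNy := HN y (ex_intro2 _ _ i Ii Vy).
  have E K L : (forall n, (K <= n)%N -> psi n y = 0) -> (forall n, (L <= n)%N -> psi n y = 0) ->
      (K <= L)%N -> \sum_(n < K) psi n y *: H (sigma n y) n y =
      \sum_(n < L) psi n y *: H (sigma n y) n y.
    move=> K0 _ KL; rewrite -(subnKC KL) big_split_ord /= [X in _ + X]big1 ?addr0//.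
    by move=> j _; rewrite K0 ?scale0r// leq_addr.
  have -> : \sum_(n < N y) psi n y *: H (sigma n y) n y =
      \sum_(n < M) psi n y *: H (sigma n y) n y.
    by have [NM|MN] := leqP (N y) M; [exact: E|apply/esym/E => //; exact: ltnW].
  apply: eq_bigr => j _; have [A|[_ A]] := Qd' j (ltn_ord j).
    by rewrite A// !scale0r.
  by have [_ ->] := A y yd'.
have [A|[A B]] := Qd' n nM; [left|right; split => //] => y.
  by rewrite !lt_min => /andP[/andP[_ yd'] _]; exact: A.
by rewrite !lt_min => /andP[/andP[_ yd'] _]; have [] := B y yd'.
Qed.

(** Because the differences p n - q n sum to 0, a common w may be subtracted from all v n: changing
    the weights costs only the distances of the v n from w. *)
Lemma weighted_diff (Y : normedModType R) (N : nat) (p q : nat -> R)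
    (u v : nat -> Y) (t w : Y) (K : R) (b : nat -> R) :
  (forall n, 0 <= p n) -> \sum_(n < N) p n = 1 -> \sum_(n < N) q n = 1 ->
  (forall n, (n < N)%N -> p n != 0 -> `|u n - v n - t| <= K) ->
  (forall n, (n < N)%N -> `|p n - q n| * `|v n - w| <= b n) ->
  `|\sum_(n < N) p n *: u n - \sum_(n < N) q n *: v n - t| <= K + \sum_(n < N) b n.
Proof.
move=> p0 p1 q1 H1 H2.
have -> : \sum_(n < N) p n *: u n - \sum_(n < N) q n *: v n - t =
    \sum_(n < N) p n *: (u n - v n - t) + \sum_(n < N) (p n - q n) *: (v n - w).
  have Et : t = \sum_(n < N) p n *: t by rewrite -scaler_suml p1 scale1r.
  have Ew : \sum_(n < N) (p n - q n) *: w = 0.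
    by rewrite -scaler_suml sumrB p1 q1 subrr scale0r.
  rewrite {1}Et -!sumrB -big_split /= -[LHS]subr0 -{2}Ew -sumrB.
  by apply: eq_bigr => n _; lmod.
apply: le_trans (ler_normD _ _) _; apply: lerD.
  apply: le_trans (ler_norm_sum _ _ _) _.
  rewrite -[leRHS]mul1r -p1 mulr_suml; apply: ler_sum => n _.
  rewrite normrZ ger0_norm//; have [->|pn] := eqVneq (p n) 0; first by rewrite !mul0r.
  by rewrite ler_wpM2l// H1.
apply: le_trans (ler_norm_sum _ _ _) _; apply: ler_sum => n _.
by rewrite normrZ H2.
Qed.

Lemma sum_half_le (N : nat) (e : R) : 0 <= e ->
  \sum_(n < N) (e * 2^-1 ^+ n.+1) <= e.
Proof.
move=> e0; suff -> : \sum_(n < N) (e * 2^-1 ^+ n.+1) = e - e * 2^-1 ^+ N.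
  by rewrite gerBl mulr_ge0// exprn_ge0// invr_ge0.
elim: N => [|N IH]; first by rewrite big_ord0 expr0 mulr1 subrr.
rewrite big_ord_recr /= IH exprS; set a := _ ^+ N; lra.
Qed.

(** The n-th local map near s is T s plus an (LA_k)-approximation of F - T s, hence follows T s up
    to the Lipschitz error C rho s. *)
Lemma smooth_gluing k (Y : normedModType R) (W : set X) (F : X -> Y) (C : R)
    (T : X -> 'L(X, Y)) (rho r e : X -> R) :
  property_LA_with X Y k C -> property_LA X R^o k -> open W ->
  (forall s, W s -> [/\ 0 <= rho s, 0 < r s, 0 < e s, ball s (r s) `<=` W &
     forall x y, ball s (r s) x -> ball s (r s) y ->
       `|F x - F y - T s (x - y)| <= rho s * `|x - y|]) ->
  exists g : X -> Y, Ck k W g /\ forall y, W y -> forall eps,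
    (forall s, W s -> ball s (r s) y -> e s <= eps) ->
    `|g y - F y| <= eps /\
    forall S K, 0 <= K ->
      (forall s, W s -> ball s (r s) y -> `|T s - S| + C * rho s <= K) ->
      forall D, has_deriv g y D -> `|D - S| <= K + eps.
Proof.
move=> LAY LAR oW HW.
have oB s : W s -> open (ball s (r s)) by move=> _; exact: ball_open.
have [psi [c [sigma [sC s0 sL glue]]]] := gluing LAR oB.
have C0 : 0 <= C by case: LAY.
(* Multiplied by the Lipschitz constants [c n] of the weights and summed over n, these errors give
   at most [e s]. *)
pose er s n : R := e s * 2^-1 ^+ n.+1 / (1 + c n).
have er0 s n : W s -> 0 < er s n.
  move=> Ws; have [_ _ es _ _] := HW s Ws; have [cn _] := sL n.
  by rewrite divr_gt0 ?mulr_gt0 ?exprn_gt0 ?invr_gt0// addr_gt0.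
have H_ex s : exists Hs : nat -> X -> Y, W s -> forall n, [/\ Ck k (ball s (r s)) (Hs n),
    forall x, ball s (r s) x -> `|F x - Hs n x| <= er s n &
    forall x y, ball s (r s) x -> ball s (r s) y ->
      `|Hs n x - Hs n y - T s (x - y)| <= C * rho s * `|x - y|].
  have [Ws|] := pselect (W s); last by exists (fun _ _ => 0).
  have [rho0 rs0 es0 _ FL] := HW s Ws.
  suff : forall n, exists h : X -> Y, [/\ Ck k (ball s (r s)) h,
    forall x, ball s (r s) x -> `|F x - h x| <= er s n &
    forall x y, ball s (r s) x -> ball s (r s) y ->
      `|h x - h y - T s (x - y)| <= C * rho s * `|x - y|].
    by move=> /choice[h hP]; exists h.
  move=> n; have [|g [/lipschitzP gL gk fg]] :=
    @LA_ball _ _ _ k C s (r s) (rho s) (fun x => F x - T s x) (er s n) LAY rs0 rho0 _ (er0 s n Ws).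
    apply/lipschitzP => x y Bx By; have := FL x y Bx By; rewrite linearB/=.
    by have -> : F x - F y - (T s x - T s y) = F x - T s x - (F y - T s y) by lmod.
  exists (fun x => g x + T s x); split.
  - apply/CkP => m km; apply: Cn_add; first exact: ball_open.
      by move/CkP : gk; exact.
    by apply: Cn_clin; exact: ball_open.
  - by move=> x /fg; have -> : F x - T s x - g x = F x - (g x + T s x) by lmod.
  - move=> x y Bx By; have := gL x y Bx By; rewrite linearB/=.
    by have -> : g x + T s x - (g y + T s y) - (T s x - T s y) = g x - g y by lmod.
have [H HP] := choice H_ex.
have [g gP] := glue Y H.
have gP' x : W x -> exists N, exists2 d : R, 0 < d &
        (forall y, `|x - y| < d -> g y = \sum_(n < N) psi n y *: H (sigma n x) n y /\
            \sum_(n < N) psi n y = 1) /\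
        forall n, (n < N)%N -> (forall y, `|x - y| < d -> psi n y = 0) \/
          (W (sigma n x) /\ forall y, `|x - y| < d ->
             ball (sigma n x) (r (sigma n x)) y).
  by move=> Wx; apply: (gP x) => //; apply: ballxx; have [] := HW x Wx.
exists g; split.
  apply/CkP => m km; apply: Cn_local => // x Wx.
  have [N [d d0 [gE fam]]] := gP' x Wx; exists d => //.
  have oBx := @ball_open _ _ x d.
  apply: (@Cn_eq _ _ _ _ _ (fun y => \sum_(n < N) psi n y *: H (sigma n x) n y)) => //.
    by rewrite ballE => y /gE[].
  apply: (@Cn_sum _ _ _ _ _ (fun n y => psi n y *: H (sigma n x) n y)) => // n nN.
  have [z|[Wi Bi]] := fam n nN.
    apply: (@Cn_eq _ _ _ _ _ (fun=> 0)) => //; last exact: Cn_cst.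
    by rewrite ballE => y /z ->; rewrite scale0r.
  apply: Cn_scale => //.
    by apply: (@Cn_sub _ _ _ _ _ setT) => //; [exact: openT|have /CkP := sC n; exact].
  apply: (@Cn_sub _ _ _ _ _ (ball (sigma n x) (r (sigma n x)))) => //.
  - exact: ball_open.
  - by rewrite [ball x d]ballE => y; exact: Bi.
  - by have [/CkP + _ _] := HP _ Wi n; exact.
move=> y Wy eps epsP.
have eps0 : 0 < eps.
  have [_ ry ey _ _] := HW y Wy; apply: lt_le_trans ey _; apply: epsP => //.
  exact: ballxx.
have [N [d d0 [gE fam]]] := gP' y Wy.
have yy : `|y - y| < d by rewrite subrr normr0.
have err n : (n < N)%N -> (forall z, `|y - z| < d -> psi n z = 0) \/
    [/\ W (sigma n y), ball (sigma n y) (r (sigma n y)) y &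
       `|H (sigma n y) n y - F y| <= eps * 2^-1 ^+ n.+1 / (1 + c n)].
  move=> nN; have [|[Wi Bi]] := fam n nN; [by left|right; split => //].
    exact: Bi.
  have [_ A _] := HP _ Wi n; rewrite distrC; apply: le_trans (A _ (Bi _ yy)) _.
  have [cn _] := sL n; rewrite ler_wpM2r ?invr_ge0 ?addr_ge0 ?(ltW cn)//.
  by rewrite ler_wpM2r ?exprn_ge0 ?invr_ge0// epsP//; exact: Bi.
split.
  have [-> p1] := gE y yy.
  have -> : F y = \sum_(n < N) psi n y *: F y by rewrite -scaler_suml p1 scale1r.
  rewrite -sumrB; apply: le_trans (ler_norm_sum _ _ _) _.
  rewrite -[leRHS]mul1r -p1 mulr_suml; apply: ler_sum => n _.
  rewrite -scalerBr normrZ ger0_norm//.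
  have [z|[Wi Bi E]] := err n (ltn_ord n); first by rewrite z// !mul0r.
  rewrite ler_wpM2l//; apply: le_trans E _; have [cn _] := sL n.
  have p1' : 2^-1 ^+ n.+1 <= 1 :> R by rewrite exprn_ile1 ?invr_ge0 ?invf_le1 ?ler1n.
  rewrite ler_pdivrMr ?addr_gt0// ler_wpM2l ?(ltW eps0)//.
  by apply: le_trans p1' _; rewrite lerDl ltW.
move=> S K K0 HK D gD; apply: (has_deriv_lip _ d0 gD); first by rewrite addr_ge0// ltW.
move=> z zd'; have zd : `|y - z| < d by rewrite distrC.
have [-> p1] := gE z zd; have [-> q1] := gE y yy.
apply: le_trans (_ : K * `|z - y| + \sum_(n < N) (eps * `|z - y|) * 2^-1 ^+ n.+1 <= _).
  (* Weights at z against weights at y; the common value subtracted is F y, to which all active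
     local maps are close at y. *)
  apply: (@weighted_diff _ _ (psi^~ z) (psi^~ y) (fun n => H (sigma n y) n z)
    (fun n => H (sigma n y) n y) (S (z - y)) (F y) (K * `|z - y|)
    (fun n => (eps * `|z - y|) * 2^-1 ^+ n.+1)) => //= n nN.
    have [A|[Wi Bi]] := fam n nN; first by rewrite A ?eqxx.
    move=> _; have [_ _ B] := HP _ Wi n.
    have -> : H (sigma n y) n z - H (sigma n y) n y - S (z - y) =
      (H (sigma n y) n z - H (sigma n y) n y - T (sigma n y) (z - y)) +
      (T (sigma n y) - S) (z - y) by rewrite clinB; lmod.
    apply: le_trans (ler_normD _ _) _.
    have := B z y (Bi _ zd) (Bi _ yy); have := opnorm_le (T (sigma n y) - S) (z - y).
    have := ler_wpM2r (normr_ge0 (z - y)) (HK _ Wi (Bi _ yy)); lra.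
  have [A|[Wi Bi E]] := err n nN.
    by rewrite !A// subrr normr0 mul0r !mulr_ge0// ?(ltW eps0)// exprn_ge0// invr_ge0.
  have [cn cL] := sL n; have c1 : 0 < 1 + c n by rewrite addr_gt0.
  apply: le_trans (ler_pM _ _ (cL z y) E) _ => //.
  rewrite mulrA ler_pdivrMr// -subr_ge0.
  have -> : eps * `|z - y| * 2^-1 ^+ n.+1 * (1 + c n) -
    c n * `|z - y| * (eps * 2^-1 ^+ n.+1) = eps * `|z - y| * 2^-1 ^+ n.+1 by ring.
  by rewrite !mulr_ge0 ?(ltW eps0)// exprn_ge0// invr_ge0.
by rewrite [leRHS]mulrDl lerD2l sum_half_le// mulr_ge0// ltW.
Qed.

End Gluing.

(** * Extensions with almost strict derivatives *)

Section LocalExtension.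
Context (R : realType) (X Y : normedModType R).

(** [T] acts as a strict derivative of [F] at s up to the fixed error rho; differentiability is not
    implied. *)
Definition loclip (F : X -> Y) (s : X) (T : 'L(X, Y)) (rho : R) :=
  exists2 r : R, 0 < r & forall x y, ball s r x -> ball s r y ->
    `|F x - F y - T (x - y)| <= rho * `|x - y|.

Lemma within_continuous_eps (Z : normedModType R) (A : set X) (G : X -> Z) (a : X) (e : R) :
  {within A, continuous G} -> A a -> 0 < e ->
  exists2 d : R, 0 < d & forall b, A b -> `|a - b| < d -> `|G b - G a| <= e.
Proof.
move=> /subspace_continuousP cG Aa e0.
have /cvgrPdist_le/(_ e e0) := cG a Aa.
rewrite near_withinE => /nbhs_normP[d /= d0 Hd].
by exists d => // b Ab ab; rewrite distrC; exact: Hd.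
Qed.

(** The point [b x] of A need not be nearest to x. The factor 2 lets the last clause apply to every
    a in A with |x - a| < 2 dist(x, A), since dist(x, A) <= |x - b x|. *)
Lemma local_extension k (Omega A : set X) (f : X -> Y) (G : X -> 'L(X, Y)) (eps : R) :
  property_LA X R^o k -> open Omega -> A `<=` Omega -> property_LLE Y A ->
  condition_W A f G -> 0 < eps ->
  exists O : set X, exists F : X -> Y, exists b : X -> X,
  [/\ open O, A `<=` O, O `<=` Omega &
    forall x, O x -> [/\ A (b x), `|x - b x| < eps, loclip F x (G (b x)) eps &
      forall a, A a -> `|x - a| <= 2 * `|x - b x| ->
        `|F x - f a - G (b x) (x - a)| <= eps * `|x - a|]].
Proof.
move=> LA oOm AOm LLE [Gc Gs] eps0.
have ext a : exists VE : set X * (X -> Y), A a ->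
    [/\ open VE.1, VE.1 a, forall b, VE.1 b -> A b -> VE.2 b = f b,
        forall x y, VE.1 x -> VE.1 y ->
          `|VE.2 x - VE.2 y - G a (x - y)| <= eps / 8 * `|x - y| &
        forall b, VE.1 b -> A b -> `|G b - G a| <= eps / 8].
  have [Aa|] := pselect (A a); last by exists (set0, f).
  have [K K1 HK] := LLE a Aa.
  have K0 : 0 < K by exact: lt_le_trans K1.
  have e8 : 0 < eps / 8 by rewrite divr_gt0.
  (* Dividing by K anticipates the loss in (LLE): the extension of f - G a becomes
     eps/8-Lipschitz. *)
  have eK : 0 < eps / 8 / K by rewrite divr_gt0.
  have [d d0 Hd] := Gs a Aa _ eK.
  have [d' d'0 Hd'] := within_continuous_eps Gc Aa e8.
  have [|U [oU Ua Ub ULE]] := HK (Num.min d d'); first by rewrite lt_min d0.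
  have Ud x : U x -> ball a d x by move=> /Ub; apply: le_ball; rewrite ge_min lexx.
  have Ud' x : U x -> `|a - x| < d'.
    by move=> /Ub; rewrite ballE /= lt_min => /andP[].
  have [||E /lipschitzP EL Ef] := ULE (eps / 8 / K) (fun x => f x - G a x).
  - exact: ltW.
  - apply/lipschitzP => x y [Ux Ax] [Uy Ay]; have := Hd y x.
    rewrite linearB /= => H.
    have -> : f x - G a x - (f y - G a y) = f x - f y - (G a x - G a y) by lmod.
    by apply: H; split => //; exact: Ud.
  exists (U `&` Omega, fun x => E x + G a x) => _ /=; split.
  - exact: openI.
  - by split => //; exact: AOm.
  - by move=> b [Ub' _] Ab; rewrite Ef// subrK.
  - move=> x y [Ux _] [Uy _]; have := EL x y Ux Uy.
    rewrite linearB /= [K * _]mulrC divfK ?gt_eqF//.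
    by have -> : E x + G a x - (E y + G a y) - (G a x - G a y) = E x - E y by lmod.
  - by move=> b [Ub' _] Ab; apply: Hd' => //; exact: Ud'.
have [VE VEP] := choice ext.
have [psi [c [sigma [_ s0 sL glue]]]] :=
  @gluing _ _ k A (fun a => (VE a).1) LA (fun a Aa => let: And5 H _ _ _ _ := VEP a Aa in H).
have [g gP] := glue Y (fun a _ => (VE a).2).
have near_A b : A b -> exists2 d : R, 0 < d & [/\ d <= eps, ball b d `<=` Omega &
    forall x y, ball b d x -> ball b d y -> `|g x - g y - G b (x - y)| <= eps / 2 * `|x - y|].
  move=> Ab; have [oV Vb _ _ _] := VEP b Ab.
  have [N [d d0 [gE fam]]] := gP b b Ab Vb.
  have bb : `|b - b| < d by rewrite subrr normr0.
  have C0 : 0 <= \sum_(n < N) c n by apply: sumr_ge0 => n _; have [/ltW] := sL n.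
  (* All active pieces take the value f b at b, so within d1 of b they differ from f b + G b (y - b)
     by at most eps/4 times d1; this offsets the sum of the Lipschitz constants of the weights. *)
  have [d1 /andP[d10 d11] d1C] := eps_small C0 (ltr01 : 0 < 1).
  have [r r0 rO] := open_ballP oOm (AOm _ Ab).
  pose m := Num.min (Num.min d d1) (Num.min r eps).
  have m0 : 0 < m by rewrite !lt_min d0 d10 r0.
  exists m => //; split.
  - by rewrite /m !ge_min lexx !orbT.
  - by apply: subset_trans rO; apply: le_ball; rewrite /m !ge_min lexx orbT.
  - move=> x y; rewrite !ballE /= !lt_min => /andP[/andP[xd _] _] /andP[/andP[yd yd1] _].
    have [-> p1] := gE x xd; have [-> q1] := gE y yd.
    apply: le_trans (_ : eps / 4 * `|x - y| +
       \sum_(n < N) c n * (eps / 4 * d1 * `|x - y|) <= _).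
      apply: (@weighted_diff _ _ _ (psi^~ x) (psi^~ y) (fun n => (VE (sigma n b)).2 x)
       (fun n => (VE (sigma n b)).2 y) (G b (x - y)) (f b + G b (y - b)) _
       (fun n => c n * (eps / 4 * d1 * `|x - y|))) => //= n nN.
        have [z|[Ai Vi] _] := fam n nN; first by rewrite z ?eqxx.
        have [_ _ _ EL Gi] := VEP _ Ai; have A1 := EL x y (Vi _ xd) (Vi _ yd).
        have A2 := Gi b (Vi _ bb) Ab; rewrite distrC in A2.
        set i := sigma n b in EL Gi A1 A2 *.
        have -> : (VE i).2 x - (VE i).2 y - G b (x - y) =
          ((VE i).2 x - (VE i).2 y - G i (x - y)) + (G i - G b) (x - y).
          by rewrite clinB; lmod.
        apply: le_trans (ler_normD _ _) _.
        have := opnorm_le (G i - G b) (x - y).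
        have := ler_wpM2r (normr_ge0 (x - y)) A2; lra.
      have [z|[Ai Vi]] := fam n nN.
        have [cn _] := sL n.
        rewrite !z// subrr normr0 mul0r !mulr_ge0 ?(ltW cn) ?(ltW eps0) ?(ltW d10)//.
      have [_ _ Ef EL Gi] := VEP _ Ai.
      have A1 := EL y b (Vi _ yd) (Vi _ bb).
      have A2 := Gi b (Vi _ bb) Ab; rewrite distrC in A2.
      have A3 := Ef b (Vi _ bb) Ab.
      set i := sigma n b in EL Gi A1 A2 A3 *.
      have B : `|(VE i).2 y - (f b + G b (y - b))| <= eps / 4 * d1.
        have -> : (VE i).2 y - (f b + G b (y - b)) =
          ((VE i).2 y - (VE i).2 b - G i (y - b)) + (G i - G b) (y - b).
          by rewrite clinB A3; lmod.
        apply: le_trans (ler_normD _ _) _.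
        have := opnorm_le (G i - G b) (y - b).
        have := ler_wpM2r (normr_ge0 (y - b)) A2.
        have yb : `|y - b| <= d1 by rewrite distrC ltW.
        have := ler_wpM2l (ltW eps0) yb; lra.
      have [cn cL] := sL n.
      have := ler_pM (normr_ge0 _) (normr_ge0 _) (cL x y) B; lra.
    rewrite -mulr_suml.
    have : (\sum_(n < N) c n) * (eps / 4 * d1 * `|x - y|) <= eps / 4 * `|x - y|.
      have -> : (\sum_(n < N) c n) * (eps / 4 * d1 * `|x - y|) =
        d1 * (\sum_(n < N) c n) * (eps / 4 * `|x - y|) by ring.
      by rewrite ler_piMl// mulr_ge0// divr_ge0// ltW.
    lra.
have gA b : A b -> g b = f b.
  move=> Ab; have [oV Vb _ _ _] := VEP b Ab.
  have [N [d d0 [gE fam]]] := gP b b Ab Vb.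
  have bb : `|b - b| < d by rewrite subrr normr0.
  have [-> p1] := gE b bb; rewrite -[f b]scale1r -p1 scaler_suml.
  apply: eq_bigr => n _; have [z|[Ai Vi]] := fam n (ltn_ord n).
    by rewrite z// !scale0r.
  by have [_ _ Ef _ _] := VEP _ Ai; rewrite Ef//; exact: Vi.
have [d dP] : {d : X -> R | forall b, A b -> [/\ 0 < d b, d b <= eps, ball b (d b) `<=` Omega &
    forall x y, ball b (d b) x -> ball b (d b) y -> `|g x - g y - G b (x - y)| <= eps / 2 * `|x - y|]}.
  suff /choice[d dP] : forall b, exists d : R, A b -> [/\ 0 < d, d <= eps, ball b d `<=` Omega &
    forall x y, ball b d x -> ball b d y -> `|g x - g y - G b (x - y)| <= eps / 2 * `|x - y|] by exists d.
  move=> b; have [Ab|] := pselect (A b); last by exists 0.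
  by have [d d0 [? ? ?]] := near_A b Ab; exists d.
(* The quarter leaves room: if |x - b| < d/4 and |x - a| <= 2 |x - b|, then a is still within d of
   b. *)
pose O := \bigcup_(a in A) ball a (d a / 4).
have [b bP] : {b : X -> X | forall x, O x -> A (b x) /\ `|b x - x| < d (b x) / 4}.
  suff /choice[b bP] : forall x, exists b, O x -> A b /\ `|b - x| < d b / 4 by exists b.
  move=> x; have [[a Aa]|] := pselect (O x); last by exists 0.
  by rewrite ballE => xa; exists a.
exists O, g, b; split.
- by apply: bigcup_open => a _; exact: ball_open.
- by move=> a Aa; exists a => //; apply: ballxx; have [? _ _ _] := dP a Aa; rewrite divr_gt0.
- move=> x [a Aa xa]; have [d0 _ + _] := dP a Aa; apply.
  by apply: le_ball xa; lra.
- move=> x Ox; have [Ab xb] := bP x Ox; have [d0 de dO dL] := dP _ Ab.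
  have xb' : `|x - b x| < d (b x) / 4 by rewrite distrC.
  split => //; first by lra.
    have [r r0 rd] : exists2 r : R, 0 < r & ball x r `<=` ball (b x) (d (b x)).
      by apply: open_ballP; [exact: ball_open|rewrite ballE /=; lra].
    exists r => // y z /rd By /rd Bz; apply: le_trans (dL y z By Bz) _.
    by rewrite ler_wpM2r//; lra.
  move=> a Aa xa; rewrite -gA//.
  have := dL x a; rewrite !ballE /= => H; apply: le_trans (H _ _) _.
  - lra.
  - by have := ler_distD x (b x) a; lra.
  - by rewrite ler_wpM2r//; lra.
Qed.

End LocalExtension.

(** * Logarithmic cutoffs *)

Section LogCutoff.
Context (R : realType).

Lemma ln_lip (u v w : R) : 0 < w -> w <= u -> w <= v -> `|ln u - ln v| <= `|u - v| / w.
Proof.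
move=> w0 wu wv.
have H a b : w <= a -> w <= b -> ln a - ln b <= `|a - b| / w.
  move=> wa wb; have a0 := lt_le_trans w0 wa; have b0 := lt_le_trans w0 wb.
  rewrite -ln_div ?posrE//.
  have -> : a / b = 1 + (a - b) / b by field; rewrite gt_eqF.
  apply: le_trans (le_ln1Dx _) _.
    by rewrite ltr_pdivlMr//; lra.
  apply: le_trans (_ : `|a - b| / b <= _).
    by rewrite ler_wpM2r ?invr_ge0 ?(ltW b0)// ler_norm.
  by rewrite ler_wpM2l// lef_pV2 ?posrE.
by rewrite ler_norml; have := H _ _ wu wv; have := H _ _ wv wu;
  rewrite [`|v - u|]distrC => A B; apply/andP; split; lra.
Qed.

(** A function of the ratio r / D for D > 0, rising from 0 at r = D to 1 at r = exp(1/g) D. The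
    inner maximum also covers r = 0, the radius of a layer outside its domain. *)
Definition log_cutoff (g D r : R) : R := Num.min 1 (g * (ln (Num.max r D) - ln D)).

Context (g : R) (g0 : 0 < g).

Lemma log_cutoff01 D r : 0 < D -> 0 <= log_cutoff g D r <= 1.
Proof.
move=> D0; rewrite /log_cutoff ge_min lexx/= andbT le_min ler01/=.
rewrite mulr_ge0 ?(ltW g0)// subr_ge0 ler_ln ?posrE//.
  by rewrite le_max lexx orbT.
by rewrite lt_max D0 orbT.
Qed.

Lemma log_cutoff0 D r : r <= D -> log_cutoff g D r = 0.
Proof.
by move=> rD; rewrite /log_cutoff max_r// subrr mulr0 min_r.
Qed.

Lemma log_cutoff1 D r : 0 < D -> expR g^-1 * D <= r -> log_cutoff g D r = 1.
Proof.
move=> D0 H; rewrite /log_cutoff min_l//.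
have e0 : 0 < expR g^-1 * D by rewrite mulr_gt0 ?expR_gt0.
have : ln (expR g^-1 * D) <= ln (Num.max r D).
  by rewrite ler_ln ?posrE// ?le_max ?H// lt_max D0 orbT.
rewrite lnM ?posrE ?expR_gt0// expRK => K.
have : g * g^-1 <= g * (ln (Num.max r D) - ln D).
  by rewrite ler_wpM2l ?(ltW g0)//; lra.
by rewrite divff ?gt_eqF.
Qed.

Lemma log_cutoff_lip (w D r D' r' k : R) : 0 < w -> w <= D -> w <= D' ->
  `|D - D'| <= k -> `|r - r'| <= k ->
  `|log_cutoff g D r - log_cutoff g D' r'| <= 2 * g / w * k.
Proof.
move=> w0 wD wD' DD rr.
have minL (a b : R) : `|Num.min 1 a - Num.min 1 b| <= `|a - b|.
  rewrite /Num.min; case: ifPn; case: ifPn; rewrite -?leNgt => A B;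
  rewrite ?subrr ?normr0//; rewrite ler_norml; apply/andP;
  (have := ler_norm (a - b); have := ler_norm (b - a); rewrite [`|b - a|]distrC; split; lra).
have maxL : `|Num.max r D - Num.max r' D'| <= k.
  move: DD rr; rewrite !ler_norml => /andP[? ?] /andP[? ?].
  rewrite /Num.max; case: ifPn; case: ifPn; rewrite -?leNgt => A B; apply/andP; split; lra.
apply: le_trans (minL _ _) _; rewrite -mulrBr normrM gtr0_norm//.
have A := ln_lip w0 wD wD'.
have B : `|ln (Num.max r D) - ln (Num.max r' D')| <= k / w.
  apply: le_trans (ln_lip w0 _ _) _; rewrite ?le_max ?wD ?wD' ?orbT//.
  by rewrite ler_wpM2r// invr_ge0 ltW.
have {}A : `|ln D - ln D'| <= k / w.
  by apply: le_trans A _; rewrite ler_wpM2r// invr_ge0 ltW.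
rewrite [2 * g]mulrC -!mulrA ler_wpM2l ?(ltW g0)//.
have -> : ln (Num.max r D) - ln D - (ln (Num.max r' D') - ln D') =
  (ln (Num.max r D) - ln (Num.max r' D')) - (ln D - ln D') by ring.
apply: le_trans (ler_normB _ _) _; lra.
Qed.

End LogCutoff.

(** * Interpolation of approximate strict derivatives *)

Section Interpolation.
Context (R : realType) (X Y : normedModType R).

Lemma loclip_le (F : X -> Y) s T (rho rho' : R) : rho <= rho' ->
  loclip F s T rho -> loclip F s T rho'.
Proof.
move=> le [r r0 H]; exists r => // x y Bx By.
by apply: le_trans (H x y Bx By) _; rewrite ler_wpM2r.
Qed.

Lemma loclip_eq (F F' : X -> Y) s T (rho r : R) : 0 < r ->
  (forall x, `|s - x| < r -> F x = F' x) -> loclip F s T rho -> loclip F' s T rho.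
Proof.
move=> r0 FF [d d0 H]; exists (Num.min d r); first by rewrite lt_min d0.
move=> x y; rewrite !ballE /= !lt_min => /andP[xd xr] /andP[yd yr].
by rewrite -!FF//; apply: H; rewrite ballE.
Qed.

(** A product rule without derivatives: slopes and errors are averaged with the weight at s, and the
    variation of chi costs l B. The term eta pays for replacing chi x by chi s in front of the
    increments of F - P. *)
Lemma loclip_interpolate (P F : X -> Y) (chi : X -> R) s (T T' : 'L(X, Y))
    (rho rho' l B eta r : R) :
  0 <= rho -> 0 <= rho' -> 0 <= l -> 0 <= B -> 0 < eta -> 0 < r -> 0 <= chi s <= 1 ->
  loclip P s T rho -> loclip F s T' rho' ->
  (forall x y, `|s - x| < r -> `|s - y| < r -> `|chi x - chi y| <= l * `|x - y|) ->
  (forall x, `|s - x| < r -> `|F x - P x| <= B) ->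
  loclip (fun x => P x + chi x *: (F x - P x)) s ((1 - chi s) *: T + chi s *: T')
    ((1 - chi s) * rho + chi s * rho' + l * B + eta).
Proof.
move=> rho0 rho'0 l0 B0 eta0 r0 /andP[c0 c1] [d d0 HP] [d' d'0 HF] chiL FB.
set c := chi s in c0 c1 *.
(* A Lipschitz constant of F - P near s. *)
pose La := `|T' - T| + rho + rho'.
have La0 : 0 <= La by rewrite !addr_ge0.
have [e /andP[e0 e1] eL] := eps_small (mulr_ge0 l0 La0) eta0.
pose m := Num.min (Num.min d d') (Num.min r e).
exists m; first by rewrite !lt_min d0 d'0 r0.
move=> x y; rewrite !ballE /= !lt_min => /andP[/andP[xd xd'] /andP[xr xe]].
move=> /andP[/andP[yd yd'] /andP[yr ye]].
have A1 := HP x y; have A2 := HF x y; rewrite !ballE /= in A1 A2.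
have {}A1 := A1 xd yd; have {}A2 := A2 xd' yd'.
have A3 := chiL x y xr yr; have A4 := FB y yr.
have ss : `|s - s| < r by rewrite subrr normr0.
have A5 := chiL x s xr ss; rewrite -/c [`|x - s|]distrC in A5.
have U : `|(F x - P x) - (F y - P y)| <= La * `|x - y|.
  have -> : (F x - P x) - (F y - P y) = (F x - F y - T' (x - y)) -
    (P x - P y - T (x - y)) + (T' - T) (x - y) by rewrite clinB; lmod.
  apply: le_trans (ler_normD _ _) _; rewrite /La !mulrDl.
  have := ler_normB (F x - F y - T' (x - y)) (P x - P y - T (x - y)).
  have := opnorm_le (T' - T) (x - y); lra.
have -> : P x + chi x *: (F x - P x) - (P y + chi y *: (F y - P y)) -
    ((1 - c) *: T + c *: T') (x - y) =
  (1 - c) *: (P x - P y - T (x - y)) + c *: (F x - F y - T' (x - y)) +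
  (chi x - c) *: (F x - P x - (F y - P y)) + (chi x - chi y) *: (F y - P y).
  by rewrite clinD !clinZ; lmod.
have B1 : `|(chi x - chi y) *: (F y - P y)| <= l * B * `|x - y|.
  by rewrite normrZ [l * B * _]mulrAC ler_pM.
have B2 : `|(1 - c) *: (P x - P y - T (x - y)) + c *: (F x - F y - T' (x - y))|
    <= ((1 - c) * rho + c * rho') * `|x - y|.
  apply: le_trans (ler_normD _ _) _.
  have c1' : 0 <= 1 - c by rewrite subr_ge0.
  rewrite !normrZ (ger0_norm c0) (ger0_norm c1').
  by have := ler_wpM2l c0 A2; have := ler_wpM2l c1' A1; lra.
have B3 : `|(chi x - c) *: (F x - P x - (F y - P y))| <= eta * `|x - y|.
  rewrite normrZ; apply: le_trans (ler_pM _ _ A5 U) _ => //.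
  rewrite mulrA ler_wpM2r//; apply: le_trans eL.
  have -> : l * `|s - x| * La = `|s - x| * (l * La) by ring.
  by rewrite ler_wpM2r ?mulr_ge0// ltW.
move: B1 B2 B3; set a := (1 - c) *: _ + _; set b := (chi x - c) *: _; set h := _ *: (F y - P y).
by have := ler_normD (a + b) h; have := ler_normD a b; lra.
Qed.

End Interpolation.

(** * Layered extensions *)

Section Layers.
Context (R : realType) (X Y : normedModType R) (Omega A : set X) (f FE : X -> Y).
Context (G : X -> 'L(X, Y)) (Q M C tau : R).
Context (Q0 : 0 <= Q) (M0 : 0 <= M) (C0 : 0 <= C) (tau0 : 0 < tau).
Context (oOm : open Omega) (AOm : A `<=` Omega).
Context (FEL : forall x y, Omega x -> Omega y -> `|FE x - FE y| <= Q * `|x - y|).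
Context (FEA : forall x, A x -> FE x = f x) (GM : forall x, A x -> `|G x| <= M).
Context (dist_gt0 : forall x, (Omega `\` A) x -> 0 < capdist A x).
Context (Fm : nat -> X -> Y) (O : nat -> set X) (b : nat -> X -> X) (ep : nat -> R).
Context (ep0 : forall n, 0 < ep n) (ep1 : forall n, ep n <= 2^-1 ^+ n).
Context (epC : forall n, C * ep n <= tau / 2).
Context (oO : forall n, open (O n)) (AO : forall n, A `<=` O n).
Context (OOm : forall n, O n `<=` Omega).
Context (layerP : forall n x, O n x -> [/\ A (b n x), `|x - b n x| < ep n,
  loclip (Fm n) x (G (b n x)) (ep n) &
  forall a, A a -> `|x - a| <= 2 * `|x - b n x| ->
    `|Fm n x - f a - G (b n x) (x - a)| <= ep n * `|x - a|]).

Let D := capdist A.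
(** [C3 * D x] bounds the distance of an active layer from [FE]: some point of A is within 2 D x,
    and Q, M and the bound 1 on [ep n] add up. The radius [rm n] vanishes off [O n]; its factor 2^-n
    leaves finitely many layers active at a point at positive distance from A. *)
Let C3 := 2 * (Q + M + 1).
Let beta := Num.min 4^-1 (tau / C3).
Let rm n x := beta * 2^-1 ^+ n * capdist (~` O n) x.
(** Step n may spend [sg n], in total tau / 2. In [gam], the factor 1 / (C + 1) anticipates the
    multiplication by C in [deriv_dist], and 12 C3 + 1 is the cost of one interpolation per unit of
    [gam n]. *)
Let sg n := tau / 4 * 2^-1 ^+ n.
Let gam n := sg n / (C + 1) / (12 * C3 + 1).

Definition layer_weight n x := log_cutoff (gam n) (D x) (rm n x).
Local Notation chi := layer_weight.

Fixpoint layered n x : Y := match n with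
  | 0 => FE x
  | m.+1 => layered m x + chi m x *: (Fm m x - layered m x)
  end.

(** Together with [layered_lip], the slope and the error that interpolation yields for [layered n]
    at s, starting from slope 0 and error Q for the Q-Lipschitz [FE]. *)
Fixpoint layered_deriv n s : 'L(X, Y) := match n with
  | 0 => 0
  | m.+1 => (1 - chi m s) *: layered_deriv m s + chi m s *: G (b m s)
  end.

Fixpoint layered_lip n s : R := match n with
  | 0 => Q
  | m.+1 => (1 - chi m s) * layered_lip m s + chi m s * ep m + sg m / (C + 1)
  end.

Let pw n : 0 < (2^-1 : R) ^+ n <= 1.
Proof. by rewrite exprn_gt0 ?invr_gt0// exprn_ile1 ?invr_ge0 ?invf_le1 ?ler1n. Qed.

Let C30 : 0 < C3. Proof. have := Q0; have := M0; rewrite /C3; lra. Qed.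
Let beta0 : 0 < beta. Proof. by rewrite lt_min invr_gt0 ltr0n divr_gt0. Qed.
Let beta4 : beta <= 4^-1. Proof. by rewrite ge_min lexx. Qed.
Let betaC : C3 * beta <= tau.
Proof.
have : beta <= tau / C3 by rewrite ge_min lexx orbT.
by rewrite ler_pdivlMr// mulrC.
Qed.

Let sg0 n : 0 < sg n.
Proof. by rewrite mulr_gt0 ?divr_gt0//; have /andP[] := pw n. Qed.

Let gam0 n : 0 < gam n.
Proof. by rewrite /gam divr_gt0//; [rewrite divr_gt0// ltr_wpDl|have := C30; lra]. Qed.

Let D01 x : 0 <= D x <= 1.
Proof. by rewrite capdist_ge0 capdist_le1. Qed.

Let rm_le n x : rm n x <= beta * capdist (~` O n) x.
Proof.
rewrite /rm -mulrA ler_wpM2l ?(ltW beta0)// ler_piMl ?capdist_ge0//.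
by have /andP[] := pw n.
Qed.

Let rm_le4 n x : rm n x <= 4^-1.
Proof.
apply: le_trans (rm_le n x) _; apply: le_trans beta4.
by rewrite ler_piMr ?(ltW beta0)// capdist_le1.
Qed.

Let rm_lt n x : rm n x <= 2^-1 ^+ n.
Proof.
have /andP[p0 p1] := pw n; rewrite /rm mulrAC.
have c0 := capdist_ge0 (~` O n) x; have c1 := capdist_le1 (~` O n) x.
have bc : beta * capdist (~` O n) x <= 1.
  by apply: mulr_ile1 => //; [exact: ltW|have := beta4; lra].
by rewrite ler_piMl// ltW.
Qed.

Let rm_lip n x y : `|rm n x - rm n y| <= `|x - y|.
Proof.
rewrite /rm -mulrBr normrM; have := capdist_lip (~` O n) x y.
have /andP[p0 p1] := pw n; apply: le_trans.
rewrite ler_piMl// ger0_norm ?mulr_ge0 ?(ltW beta0) ?(ltW p0)//.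
by rewrite mulr_ile1 ?(ltW p0) ?(ltW beta0)//; have := beta4; lra.
Qed.

Let D_lip x y : `|D x - D y| <= `|x - y|.
Proof. exact: capdist_lip. Qed.

Let D_ge s x : `|s - x| < D s / 2 -> D s / 2 <= D x.
Proof. by have := D_lip s x; rewrite ler_norml => /andP[_]; lra. Qed.

Let rm_gt0 n x : 0 < rm n x -> O n x.
Proof.
rewrite /rm pmulr_rgt0; first exact: capdistC_in.
by rewrite mulr_gt0//; have /andP[] := pw n.
Qed.

Lemma layer_weight01 n x : 0 < D x -> 0 <= chi n x <= 1.
Proof. exact: log_cutoff01. Qed.

Lemma layer_weight_supp n x : chi n x != 0 -> [/\ O n x, D x < 4^-1 & D x < rm n x].
Proof.
have [rD|Dr] := leP (rm n x) (D x); first by rewrite /chi log_cutoff0// eqxx.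
move=> _; split => //; last exact: lt_le_trans (rm_le4 n x).
by apply: rm_gt0; apply: le_lt_trans Dr; have /andP[] := D01 x.
Qed.

Lemma layer_near n x : O n x -> 0 < D x < 2^-1 -> exists a, [/\ A a, `|x - a| < 2 * D x &
  `|Fm n x - f a - G (b n x) (x - a)| <= ep n * `|x - a|].
Proof.
move=> Ox /andP[Dx0 Dx]; have [Ab _ _ H] := layerP Ox.
have [||a Aa xa] := @capdist_lt _ _ A x (2 * D x); rewrite -?/(D x); try lra.
exists a; split => //; apply: H => //; apply: le_trans (ltW xa) _.
by rewrite ler_wpM2l//; exact: capdist_le.
Qed.

Lemma layer_FE n x : O n x -> 0 < D x < 2^-1 -> `|Fm n x - FE x| <= C3 * D x.
Proof.
move=> Ox Dx; have [a [Aa xa Fa]] := layer_near Ox Dx.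
have [Ab _ _ _] := layerP Ox.
have A1 := FEL (OOm Ox) (AOm Aa); rewrite (FEA Aa) in A1.
have A2 := opnorm_le (G (b n x)) (x - a).
have A3 := ler_wpM2r (normr_ge0 (x - a)) (GM Ab).
have e1 : ep n <= 1 by apply: le_trans (ep1 n) _; have /andP[] := pw n.
have A4 := ler_wpM2r (normr_ge0 (x - a)) e1.
have -> : Fm n x - FE x = (Fm n x - f a - G (b n x) (x - a)) +
   G (b n x) (x - a) - (FE x - f a) by lmod.
apply: le_trans (ler_normB _ _) _.
have := ler_normD (Fm n x - f a - G (b n x) (x - a)) (G (b n x) (x - a)).
have K0 : 0 <= Q + M + 1 by have := Q0; have := M0; lra.
have := ler_wpM2l K0 (ltW xa); rewrite /C3; lra.
Qed.

Let WD x : Omega x -> 0 < D x -> (Omega `\` A) x.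
Proof.
move=> Ox Dx; split => // Ax; have := capdist_le x Ax.
by rewrite subrr normr0 -/(D x); lra.
Qed.

Lemma layered_step (S0 : Y) n x : layered n.+1 x - S0 =
  (1 - chi n x) *: (layered n x - S0) + chi n x *: (Fm n x - S0).
Proof. rewrite /=; lmod. Qed.

(** The bound on v is asked only for non-zero weight, since a layer is controlled on its own domain
    alone. *)
Lemma convex_norm (Z : normedModType R) (c K : R) (u v : Z) : 0 <= c <= 1 ->
  `|u| <= K -> (c != 0 -> `|v| <= K) -> `|(1 - c) *: u + c *: v| <= K.
Proof.
move=> /andP[c0 c1] uK vK.
have [->|cn0] := eqVneq c 0; first by rewrite subr0 scale1r scale0r addr0.
apply: le_trans (ler_normD _ _) _; rewrite !normrZ (ger0_norm c0).
rewrite ger0_norm ?subr_ge0//.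
have c1' : 0 <= 1 - c by rewrite subr_ge0.
by have := ler_wpM2l c1' uK; have := ler_wpM2l c0 (vK cn0); lra.
Qed.

(** Where layer n is active, D x < rm n x, so [C3 * D x] is itself at most tau times the distance to
    the complement of Omega; convexity carries both bounds through the layers. *)
Lemma layered_FE n x : (Omega `\` A) x ->
  `|layered n x - FE x| <= C3 * D x /\ `|layered n x - FE x| <= tau * capdist (~` Omega) x.
Proof.
move=> Wx; have Dx := dist_gt0 Wx.
elim: n => [|n [IH1 IH2]] /=.
  by rewrite subrr normr0; split; rewrite mulr_ge0 ?(ltW C30) ?(ltW tau0) ?capdist_ge0.
have c01 := layer_weight01 n Dx.
have B : chi n x != 0 -> `|Fm n x - FE x| <= C3 * D x.
  by move=> /layer_weight_supp[Ox D4 _]; apply: layer_FE => //; rewrite Dx/=; lra.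
rewrite -[_ + _ *: _]/(layered n.+1 x) layered_step; split; apply: convex_norm => //.
move=> c0; apply: le_trans (B c0) _; have [Ox _ Dr] := layer_weight_supp c0.
apply: le_trans (_ : C3 * (beta * capdist (~` O n) x) <= _).
  by rewrite ler_wpM2l ?(ltW C30)//; apply: le_trans (ltW Dr) _; exact: rm_le.
have sub : capdist (~` O n) x <= capdist (~` Omega) x.
  by apply: capdist_sub => z Oz Onz; apply: Oz; exact: OOm Onz.
rewrite mulrA; apply: (ler_pM _ _ betaC sub); rewrite ?capdist_ge0//.
by rewrite mulr_ge0 ?(ltW C30) ?(ltW beta0).
Qed.

Lemma layered_lip_ge0 n s : (Omega `\` A) s -> 0 <= layered_lip n s.
Proof.
move=> Ws; elim: n => //= n IH; have /andP[c0 c1] := layer_weight01 n (dist_gt0 Ws).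
have C1 : 0 <= (C + 1)^-1 by rewrite invr_ge0 addr_ge0.
have c1' : 0 <= 1 - chi n s by rewrite subr_ge0.
by rewrite addr_ge0 ?addr_ge0 ?(mulr_ge0 c1' IH) ?(mulr_ge0 c0 (ltW (ep0 n)))
  ?(mulr_ge0 (ltW (sg0 n)) C1).
Qed.

Lemma layered_loclip n s : (Omega `\` A) s ->
  loclip (layered n) s (layered_deriv n s) (layered_lip n s).
Proof.
move=> Ws; have Ds := dist_gt0 Ws; elim: n => [|n IH].
  have [r r0 rO] := open_ballP oOm Ws.1.
  exists r => // x y /rO Ox /rO Oy.
  by rewrite -[layered_deriv 0 s (x - y)]/(0 : Y) subr0; exact: FEL.
have c01 := layer_weight01 n Ds.
have eta0 : 0 < sg n / (C + 1) by rewrite divr_gt0// ltr_wpDl.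
have [Dr|rD] := leP (D s) (rm n s); last first.
  have cz x : `|s - x| < (D s - rm n s) / 2 -> chi n x = 0.
    move=> sx; apply: log_cutoff0; have := D_lip s x; have := rm_lip n s x.
    by rewrite !ler_norml => /andP[? ?] /andP[? ?]; lra.
  have e0 : 0 < (D s - rm n s) / 2 by lra.
  apply: (@loclip_eq _ _ _ (layered n) _ s _ _ _ e0).
    by move=> x /cz /= ->; rewrite scale0r addr0.
  have cs : chi n s = 0 by apply: cz; rewrite subrr normr0.
  rewrite /= cs subr0 scale1r scale0r addr0 mul1r mul0r addr0.
  by apply: loclip_le IH; rewrite lerDl ltW.
have On : O n s by apply: rm_gt0; exact: lt_le_trans Dr.
have [r r0 rO] := open_ballP (oO n) On.
have [Ab _ FL _] := layerP On.
have D4 : D s <= 4^-1 by exact: le_trans Dr (rm_le4 n s).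
pose m := Num.min (D s / 2) r.
have m0 : 0 < m by rewrite lt_min r0 divr_gt0.
(* Near s the distance to A stays between D s / 2 and 3 D s / 2, so the cutoff is (4 gam n / D
   s)-Lipschitz and the two maps, each within C3 D x of [FE], differ by at most 3 C3 D s. The last
   [gam n] is the eta of the interpolation. *)
have -> : layered_lip n.+1 s = (1 - chi n s) * layered_lip n s + chi n s * ep n +
    4 * gam n / D s * (3 * C3 * D s) + gam n.
  rewrite /= -[RHS]addrA; congr (_ + _); rewrite /gam.
  have n1 : 12 * C3 + 1 != 0 by rewrite gt_eqF//; have := C30; lra.
  have n2 : C + 1 != 0 by rewrite gt_eqF// ltr_wpDl.
  have n3 : D s != 0 by rewrite gt_eqF.
  move: (sg n) (D s) n1 n2 n3 => u v n1 n2 n3.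
  by field; rewrite n1 n2 n3.
have l0 : 0 <= 4 * gam n / D s.
  exact: (divr_ge0 (mulr_ge0 (ler0n R 4) (ltW (gam0 n))) (ltW Ds)).
have B0 : 0 <= 3 * C3 * D s.
  exact: (mulr_ge0 (mulr_ge0 (ler0n R 3) (ltW C30)) (ltW Ds)).
apply: (loclip_interpolate (layered_lip_ge0 n Ws) (ltW (ep0 n)) l0 B0 (gam0 n) m0 c01 IH FL).
- move=> x y; rewrite !lt_min => /andP[xD _] /andP[yD _].
  have w0 : 0 < D s / 2 by rewrite divr_gt0.
  have := log_cutoff_lip (gam0 n) w0 (D_ge xD) (D_ge yD) (D_lip x y) (rm_lip n x y).
  by have -> : 2 * gam n / (D s / 2) = 4 * gam n / D s by field; rewrite gt_eqF.
- move=> x; rewrite lt_min => /andP[xD xr].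
  have Ox : O n x by apply: rO; rewrite ballE.
  have Dx := D_ge xD; have Dx' := D_lip s x; rewrite ler_norml in Dx'.
  have /andP[Dx1 Dx2] := Dx'.
  have Dx01 : 0 < D x < 2^-1 by apply/andP; split; lra.
  have Wx : (Omega `\` A) x by apply: WD; [exact: OOm Ox|case/andP: Dx01].
  have [B1 _] := layered_FE n Wx; have B2 := layer_FE Ox Dx01.
  have -> : Fm n x - layered n x = (Fm n x - FE x) - (layered n x - FE x) by lmod.
  apply: le_trans (ler_normB _ _) _.
  have : C3 * D x <= C3 * (3 / 2 * D s) by rewrite ler_wpM2l ?(ltW C30)//; lra.
  lra.
Qed.

Definition deriv_dist n s (S : 'L(X, Y)) : R :=
  `|layered_deriv n s - S| + C * layered_lip n s.

Lemma deriv_dist_step n s S K : (Omega `\` A) s -> 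
  (chi n s != 1 -> deriv_dist n s S <= K) ->
  (chi n s != 0 -> `|G (b n s) - S| + C * ep n <= K) ->
  deriv_dist n.+1 s S <= K + sg n.
Proof.
move=> Ws H1 H2; have c01 := layer_weight01 n (dist_gt0 Ws).
have /andP[c0 c1] := c01; set c := chi n s in H1 H2 c01 c0 c1 *.
have sC : C * (sg n / (C + 1)) <= sg n.
  by rewrite mulrCA ler_piMr ?(ltW (sg0 n))// ler_pdivrMr ?mul1r ?ltr_wpDl// lerDl.
rewrite /deriv_dist /= -/c.
have -> : (1 - c) *: layered_deriv n s + c *: G (b n s) - S =
  (1 - c) *: (layered_deriv n s - S) + c *: (G (b n s) - S) by lmod.
have A1 : (1 - c) * deriv_dist n s S <= (1 - c) * K.
  have [->|/H1] := eqVneq c 1; first by rewrite subrr !mul0r.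
  by apply: ler_wpM2l; rewrite subr_ge0.
have A2 : c * (`|G (b n s) - S| + C * ep n) <= c * K.
  have [->|/H2] := eqVneq c 0; first by rewrite !mul0r.
  exact: ler_wpM2l.
have := ler_normD ((1 - c) *: (layered_deriv n s - S)) (c *: (G (b n s) - S)).
rewrite !normrZ (ger0_norm c0) ger0_norm ?subr_ge0// /deriv_dist in A1 *.
lra.
Qed.

Lemma layer_weight_far s x n : `|s - x| < D s / 2 -> 2^-1 ^+ n <= D s / 2 -> chi n x = 0.
Proof.
move=> sx nD; apply: log_cutoff0.
exact: le_trans (rm_lt n x) (le_trans nD (D_ge sx)).
Qed.

Lemma layered_stable x N n : (forall i, (N <= i)%N -> chi i x = 0) -> (N <= n)%N ->
  layered n x = layered N x.
Proof.
move=> H; elim: n => [|n IH]; first by rewrite leqn0 => /eqP->.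
rewrite leq_eqVlt => /predU1P[->//|]; rewrite ltnS => Nn.
by rewrite /= H// scale0r addr0 IH.
Qed.

(** D tends to 0 at a while [rm N] stays near its positive value there, so their ratio eventually
    exceeds exp(1 / gam N). *)
Lemma layer_weight_near N a : A a -> exists2 d : R, 0 < d &
  forall x, `|x - a| < d -> 0 < D x -> chi N x = 1.
Proof.
move=> Aa; pose E := expR (gam N)^-1.
have E0 : 0 < 1 + E by rewrite addr_gt0 ?expR_gt0.
have r0 : 0 < rm N a.
  apply: mulr_gt0; last by apply: capdistC_gt0; [exact: oO|exact: AO Aa].
  by apply: mulr_gt0 => //; have /andP[] := pw N.
exists (rm N a / (1 + E)); first by rewrite divr_gt0.
move=> x; rewrite ltr_pdivlMr// => xa Dx; apply: log_cutoff1 => //; rewrite -/E.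
have Da : D x <= `|x - a| by exact: capdist_le.
have := rm_lip N x a; rewrite ler_norml => /andP[H _].
have : E * D x <= E * `|x - a| by rewrite ler_wpM2l// expR_ge0.
lra.
Qed.

Let pwS n : tau / 2 * 2^-1 ^+ n = tau / 2 * 2^-1 ^+ n.+1 + sg n.
Proof. by rewrite /sg exprS; set u := _ ^+ n; lra. Qed.

Lemma deriv_dist_le n s : (Omega `\` A) s -> deriv_dist n s 0 <= Num.max (C * Q) M + tau.
Proof.
move=> Ws; set K := Num.max _ _.
have K1 : C * Q <= K by rewrite le_max lexx.
have K2 : M <= K by rewrite le_max lexx orbT.
(* One half of tau absorbs [C * ep n]; the other half is spent as the sum of the [sg]. *)
suff : deriv_dist n s 0 <= K + tau - tau / 2 * 2^-1 ^+ n.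
  have /andP[p0 _] := pw n; have : 0 <= tau / 2 * 2^-1 ^+ n.
    by rewrite mulr_ge0 ?(ltW p0)// divr_ge0// ltW.
  lra.
elim: n => [|n IH].
  rewrite /deriv_dist /= subr0 normr0 add0r expr0 mulr1; have := tau0; lra.
have -> : K + tau - tau / 2 * 2^-1 ^+ n.+1 = (K + tau - tau / 2 * 2^-1 ^+ n) + sg n.
  by rewrite [in RHS]pwS; ring.
apply: deriv_dist_step => // /layer_weight_supp[On _ _].
have [Ab _ _ _] := layerP On; rewrite subr0.
have := GM Ab; have := epC n; have /andP[p0 p1] := pw n.
have : tau / 2 * 2^-1 ^+ n <= tau / 2 by rewrite ler_piMr// divr_ge0// ltW.
lra.
Qed.

Context (HW : condition_W A f G).

Lemma layer_close a e : A a -> 0 < e -> exists N, exists2 d : R, 0 < d &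
  forall n s, (N <= n)%N -> O n s -> `|s - a| < d ->
    `|G (b n s) - G a| <= e /\ ep n <= e.
Proof.
move=> Aa e0; have [d d0 Hd] := within_continuous_eps HW.1 Aa e0.
have m0 : 0 < Num.min (d / 2) e by rewrite lt_min divr_gt0.
have [N HN] := half_pow_lt m0; exists N, (d / 2); first by rewrite divr_gt0.
move=> n s Nn On sa; have [Ab sb _ _] := layerP On.
have := HN n Nn; rewrite lt_min => /andP[nd ne].
have e1 := ep1 n; split; last by lra.
apply: Hd => //; have := ler_distD s a (b n s); rewrite distrC in sa; lra.
Qed.

(** Layer N has weight 1 near a and erases all that precedes it, [FE] included; later active layers
    have slopes near G a. The condition on n forces n > N, because D s <= |s - a| < 2^-N. *)
Lemma deriv_dist_near a e : A a -> 0 < e -> exists2 d : R, 0 < d &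
  forall s n, (Omega `\` A) s -> `|s - a| < d -> 2^-1 ^+ n < D s / 2 ->
    deriv_dist n s (G a) <= e.
Proof.
move=> Aa e0; have C1 : 0 < C + 1 by rewrite ltr_wpDl.
have [N1 [d d0 Hd]] := layer_close Aa (divr_gt0 e0 (mulr_gt0 (ltr0n R 2) C1)).
have [N2 HN2] := half_pow_lt (divr_gt0 e0 tau0).
pose N := maxn N1 N2.
have [d' d'0 Hd'] := layer_weight_near N Aa.
have pN0 : 0 < (2^-1 : R) ^+ N by have /andP[] := pw N.
exists (Num.min (Num.min d d') (2^-1 ^+ N)); first by rewrite !lt_min d0 d'0.
move=> s n Ws; rewrite !lt_min => /andP[/andP[sd sd'] sN] nD.
have Ds := dist_gt0 Ws.
have Nn : (N < n)%N.
  rewrite ltnNge; apply/negP => nN.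
  have : (2^-1 : R) ^+ N <= 2^-1 ^+ n.
    by apply: ler_wiXn2l; rewrite ?invr_ge0 ?invf_le1 ?ler1n.
  have : D s <= `|s - a| by exact: capdist_le.
  lra.
have HG m : (N <= m)%N -> chi m s != 0 -> `|G (b m s) - G a| + C * ep m <= e / 2.
  move=> Nm /layer_weight_supp[Om _ _].
  have [A1 A2] := Hd m s (leq_trans (leq_maxl _ _) Nm) Om sd.
  have A3 := ler_wpM2l C0 A2.
  have E : (C + 1) * (e / (2 * (C + 1))) = e / 2 by field; rewrite gt_eqF.
  lra.
have tN : tau / 2 * 2^-1 ^+ N <= e / 2.
  have := HN2 N (leq_maxr _ _); rewrite ltr_pdivlMr// => H; lra.
suff : deriv_dist n s (G a) <= e / 2 + tau / 2 * 2^-1 ^+ N - tau / 2 * 2^-1 ^+ n.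
  have /andP[p0 _] := pw n; have : 0 <= tau / 2 * 2^-1 ^+ n.
    by rewrite mulr_ge0 ?(ltW p0)// divr_ge0// ltW.
  lra.
elim: n Nn {nD} => // n IH; rewrite ltnS leq_eqVlt => /predU1P[<-|Nn].
  have -> : e / 2 + tau / 2 * 2^-1 ^+ N - tau / 2 * 2^-1 ^+ N.+1 = e / 2 + sg N.
    by rewrite [X in _ + X - _]pwS; ring.
  apply: deriv_dist_step => //; last exact: HG.
  by rewrite Hd' ?eqxx.
have -> : e / 2 + tau / 2 * 2^-1 ^+ N - tau / 2 * 2^-1 ^+ n.+1 =
   (e / 2 + tau / 2 * 2^-1 ^+ N - tau / 2 * 2^-1 ^+ n) + sg n.
  by rewrite [X in _ = _ - X + _]pwS; ring.
apply: deriv_dist_step => // [_|c0]; first exact: IH.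
apply: le_trans (HG n (ltnW Nn) c0) _.
have : (2^-1 : R) ^+ n <= 2^-1 ^+ N.
  by apply: ler_wiXn2l; rewrite ?invr_ge0 ?invf_le1 ?ler1n// ltnW.
have t2 : 0 <= tau / 2 by rewrite divr_ge0// ltW.
by move=> /(ler_wpM2l t2); lra.
Qed.

Lemma layered_near a e : A a -> 0 < e -> exists2 d : R, 0 < d &
  forall x n, (Omega `\` A) x -> `|x - a| < d -> 2^-1 ^+ n < D x / 2 ->
    `|layered n x - f a - G a (x - a)| <= e * `|x - a|.
Proof.
move=> Aa e0; have e8 : 0 < e / 8 by rewrite divr_gt0.
have [N [d d0 Hd]] := layer_close Aa e8.
have [d' d'0 Hd'] := layer_weight_near N Aa.
have [r r0 Hr] := HW.2 a Aa _ e8.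
have pN0 : 0 < (2^-1 : R) ^+ N by have /andP[] := pw N.
exists (Num.min (Num.min d d') (Num.min (2^-1 ^+ N) (r / 3))).
  by rewrite !lt_min d0 d'0 pN0 divr_gt0.
move=> x n Wx; rewrite !lt_min => /andP[/andP[xd xd'] /andP[xN xr]] nD.
have Dx := dist_gt0 Wx; have Dxa : D x <= `|x - a| by exact: capdist_le.
have Nn : (N < n)%N.
  rewrite ltnNge; apply/negP => nN.
  have : (2^-1 : R) ^+ N <= 2^-1 ^+ n.
    by apply: ler_wiXn2l; rewrite ?invr_ge0 ?invf_le1 ?ler1n.
  lra.
set S0 := f a + G a (x - a).
have HF m : (N <= m)%N -> chi m x != 0 -> `|Fm m x - S0| <= e * `|x - a|.
  move=> Nm /layer_weight_supp[Om D4 _].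
  have [A1 A2] := Hd m x Nm Om xd.
  (* The layer is controlled at the nearly nearest point a', and strict differentiability of f along
     A leads from a' to a. With |x - a'| <= 2 |x - a| and |a' - a| <= 3 |x - a| the errors add up to
     7/8 of the bound. *)
  have [|a' [Aa' xa' Fa']] := layer_near Om; first by rewrite Dx/=; lra.
  have a'a : `|a' - a| <= 3 * `|x - a|.
    by have := ler_distD x a' a; rewrite [`|a' - x|]distrC; lra.
  have Ba : (ball a r `&` A) a by split => //; exact: ballxx.
  have Ba' : (ball a r `&` A) a' by split => //; rewrite ballE /= distrC; lra.
  have A3 := Hr a a' Ba Ba'.
  have A4 := opnorm_le (G (b m x) - G a) (x - a').
  have A5 := ler_wpM2r (normr_ge0 (x - a')) A1.
  have A6 := ler_wpM2r (normr_ge0 (x - a')) A2.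
  have xa'2 : `|x - a'| <= 2 * `|x - a| by lra.
  have A7 := ler_wpM2l (ltW e8) xa'2; have A8 := ler_wpM2l (ltW e8) a'a.
  have -> : Fm m x - S0 = (Fm m x - f a' - G (b m x) (x - a')) +
      (G (b m x) - G a) (x - a') + (f a' - f a - G a (a' - a)).
    rewrite /S0 clinB.
    have -> : G a (x - a) = G a (x - a') + G a (a' - a) by rewrite -linearD/= subrKA.
    by lmod.
  have := ler_normD (Fm m x - f a' - G (b m x) (x - a') + (G (b m x) - G a) (x - a'))
    (f a' - f a - G a (a' - a)).
  have := ler_normD (Fm m x - f a' - G (b m x) (x - a')) ((G (b m x) - G a) (x - a')).
  have := mulr_ge0 (ltW e0) (normr_ge0 (x - a)); lra.
have -> : layered n x - f a - G a (x - a) = layered n x - S0 by rewrite /S0; lmod.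
elim: n Nn {nD} => // n IH; rewrite ltnS leq_eqVlt => Nn.
rewrite layered_step.
have [c1|c1] := eqVneq (chi n x) 1.
  rewrite c1 subrr scale0r add0r scale1r; apply: HF; last by rewrite c1 oner_eq0.
  by case/predU1P: Nn => [->//|/ltnW].
move: Nn => /predU1P[nN|Nn]; first by rewrite -nN Hd' ?eqxx in c1.
apply: convex_norm; [exact: layer_weight01|exact: IH|].
by apply: HF; exact: ltnW.
Qed.

End Layers.

(** * Assembly of the layers into one extension *)

Section StrictExtension.
Context (R : realType) (X Y : normedModType R).

Lemma strict_extension k (Omega A : set X) (f FE : X -> Y) (G : X -> 'L(X, Y))
    (Q M C tau : R) :
  property_LA X R^o k -> open Omega -> open (Omega `\` A) -> A `<=` Omega ->
  0 <= Q -> 0 <= M -> 0 <= C -> 0 < tau ->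
  (forall x, (Omega `\` A) x -> 0 < capdist A x) ->
  (forall x y, Omega x -> Omega y -> `|FE x - FE y| <= Q * `|x - y|) ->
  (forall x, A x -> FE x = f x) -> (forall x, A x -> `|G x| <= M) ->
  property_LLE Y A -> condition_W A f G ->
  exists F : X -> Y, exists T : X -> 'L(X, Y), exists rho : X -> R,
  [/\ forall s, (Omega `\` A) s -> [/\ 0 <= rho s, loclip F s (T s) (rho s) &
        `|T s| + C * rho s <= Num.max (C * Q) M + tau],
      forall a e, A a -> 0 < e -> exists2 d : R, 0 < d & forall s,
        (Omega `\` A) s -> `|s - a| < d -> `|T s - G a| + C * rho s <= e,
      forall a e, A a -> 0 < e -> exists2 d : R, 0 < d & forall x,
        (Omega `\` A) x -> `|x - a| < d ->
          `|F x - f a - G a (x - a)| <= e * `|x - a| &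
      forall x, (Omega `\` A) x -> `|F x - FE x| <= tau * capdist (~` Omega) x].
Proof.
move=> LA oOm oW AOm Q0 M0 C0 tau0 Dgt0 FEL FEA GM LLE HW.
have [e0 /andP[e00 e01] e0C] := eps_small C0 (divr_gt0 tau0 (ltr0n R 2)).
pose ep n : R := e0 * 2^-1 ^+ n.
have pw n : 0 < (2^-1 : R) ^+ n <= 1.
  by rewrite exprn_gt0 ?invr_gt0// exprn_ile1 ?invr_ge0 ?invf_le1 ?ler1n.
have ep0 n : 0 < ep n by rewrite mulr_gt0//; have /andP[] := pw n.
have ep1 n : ep n <= 2^-1 ^+ n by have /andP[p0 _] := pw n; rewrite ler_piMl// ltW.
have epC n : C * ep n <= tau / 2.
  apply: le_trans e0C; rewrite [e0 * C]mulrC ler_wpM2l//.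
  by have /andP[_ p1] := pw n; rewrite ler_piMr// ltW.
have lay n : exists OFb : set X * (X -> Y) * (X -> X),
  [/\ open OFb.1.1, A `<=` OFb.1.1, OFb.1.1 `<=` Omega &
    forall x, OFb.1.1 x -> [/\ A (OFb.2 x), `|x - OFb.2 x| < ep n,
      loclip OFb.1.2 x (G (OFb.2 x)) (ep n) &
      forall a, A a -> `|x - a| <= 2 * `|x - OFb.2 x| ->
        `|OFb.1.2 x - f a - G (OFb.2 x) (x - a)| <= ep n * `|x - a|]].
  have [U [F [b H]]] := local_extension LA oOm AOm LLE HW (ep0 n).
  by exists (U, F, b).
have [OFb OFbP] := choice lay.
pose O n := (OFb n).1.1; pose Fm n := (OFb n).1.2; pose b n := (OFb n).2.
have openO n : open (O n) by have [] := OFbP n.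
have AO n : A `<=` O n by have [] := OFbP n.
have OOm n : O n `<=` Omega by have [] := OFbP n.
have OP n : forall x, O n x -> [/\ A (b n x), `|x - b n x| < ep n,
      loclip (Fm n) x (G (b n x)) (ep n) &
      forall a, A a -> `|x - a| <= 2 * `|x - b n x| ->
        `|Fm n x - f a - G (b n x) (x - a)| <= ep n * `|x - a|].
  by have [_ _ _] := OFbP n.
pose Phi := layered A FE Q M C tau Fm O.
pose Tm := layered_deriv A G Q M C tau O b.
pose rm := layered_lip A Q M C tau O ep.
have [N NP] : {N : X -> nat | forall s, (Omega `\` A) s ->
    forall n, (N s <= n)%N -> 2^-1 ^+ n < capdist A s / 2}.
  suff /choice[N NP] : forall s, exists N, (Omega `\` A) s ->
    forall n, (N <= n)%N -> 2^-1 ^+ n < capdist A s / 2 by exists N.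
  move=> s; have [Ws|] := pselect ((Omega `\` A) s); last by exists 0%N.
  have [N HN] := half_pow_lt (divr_gt0 (Dgt0 s Ws) (ltr0n R 2)).
  by exists N.
(* No layer from [N s] on is active within D s / 2 of s, so the pointwise stabilised map coincides
   near s with the single map [Phi (N s)]. *)
have same s x : (Omega `\` A) s -> (Omega `\` A) x -> `|s - x| < capdist A s / 2 ->
    Phi (N s) x = Phi (N x) x.
  move=> Ws Wx sx.
  have st n : (N s <= n)%N -> Phi n x = Phi (N s) x.
    apply: layered_stable => i /(NP s Ws)/ltW.
    exact: layer_weight_far.
  have st' n : (N x <= n)%N -> Phi n x = Phi (N x) x.
    apply: layered_stable => i /(NP x Wx)/ltW.
    apply: layer_weight_far => //; rewrite subrr normr0.
    by rewrite divr_gt0// Dgt0.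
  by rewrite -(st _ (leq_maxl (N s) (N x))) (st' _ (leq_maxr (N s) (N x))).
exists (fun x => Phi (N x) x), (fun s => Tm (N s) s), (fun s => rm (N s) s); split.
- move=> s Ws; split.
  + exact: (layered_lip_ge0 Q0 M0 C0 tau0 Dgt0 O ep0 _ Ws).
  + have [r r0 rW] := open_ballP oW Ws.
    have m0 : 0 < Num.min r (capdist A s / 2).
      by rewrite lt_min r0 divr_gt0// Dgt0.
    apply: (@loclip_eq _ _ _ (Phi (N s)) _ s _ _ _ m0).
      move=> x; rewrite lt_min => /andP[xr xD]; apply: same => //.
      by apply: rW; rewrite ballE.
    exact: (layered_loclip Q0 M0 C0 tau0 oOm AOm FEL FEA GM Dgt0 ep0 ep1 openO OOm OP _ Ws).
  + have := deriv_dist_le Q0 M0 C0 tau0 GM Dgt0 epC OP (N s) Ws.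
    by rewrite /deriv_dist subr0.
- move=> a e Aa e0'.
  have [d d0 Hd] := deriv_dist_near Q0 M0 C0 tau0 Dgt0 ep1 openO AO OP HW Aa e0'.
  by exists d => // s Ws sa; apply: Hd => //; exact: NP.
- move=> a e Aa e0'.
  have [d d0 Hd] := layered_near FE Q0 M0 C0 tau0 Dgt0 ep1 openO AO OP HW Aa e0'.
  by exists d => // s Ws sa; apply: Hd => //; exact: NP.
- move=> x Wx.
  by have [_] := layered_FE Q0 M0 C0 tau0 AOm FEL FEA GM Dgt0 ep1 OOm OP (N x) Wx.
Qed.

End StrictExtension.

(** * Smooth approximation *)

Section Smoothing.
Context (R : realType) (X Y : normedModType R).

Lemma capdist_half (Z : set X) s y : `|s - y| < capdist Z s / 2 ->
  capdist Z s <= 2 * capdist Z y /\ capdist Z s ^+ 2 <= 4 * capdist Z y ^+ 2.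
Proof.
move=> sy; have := capdist_lip Z s y; rewrite ler_norml => /andP[_ H].
have A : capdist Z s <= 2 * capdist Z y by lra.
split => //; have -> : 4 * capdist Z y ^+ 2 = (2 * capdist Z y) ^+ 2 by ring.
by rewrite ler_pXn2r// nnegrE ?mulr_ge0 ?capdist_ge0.
Qed.

(** Balls of radius at most half the distance to the complement of W make that distance at a centre
    at most twice the one at any point y of the ball, so errors th/4 times its square at the centres
    become th times its square at y. *)
Lemma fine_approximation k (W : set X) (F : X -> Y) (C th : R) (T : X -> 'L(X, Y))
    (rho : X -> R) :
  property_LA_with X Y k C -> property_LA X R^o k -> open W -> 0 < th ->
  (forall s, W s -> 0 <= rho s /\ loclip F s (T s) (rho s)) ->
  exists g : X -> Y, Ck k W g /\ forall y, W y ->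
    `|g y - F y| <= th * capdist (~` W) y ^+ 2 /\
    forall S K D, 0 <= K ->
      (forall s, W s -> `|s - y| < capdist (~` W) y -> `|T s - S| + C * rho s <= K) ->
      has_deriv g y D -> `|D - S| <= K + th * capdist (~` W) y ^+ 2.
Proof.
move=> LA LAR oW th0 HT; set D2 := capdist (~` W).
have D20 s : W s -> 0 < D2 s by exact: capdistC_gt0.
have [r rP] : {r : X -> R | forall s, W s -> [/\ 0 < r s, r s <= D2 s / 2 &
    forall x y, ball s (r s) x -> ball s (r s) y ->
      `|F x - F y - T s (x - y)| <= rho s * `|x - y|]}.
  suff /choice[r rP] : forall s, exists r : R, W s -> [/\ 0 < r, r <= D2 s / 2 &
    forall x y, ball s r x -> ball s r y ->
      `|F x - F y - T s (x - y)| <= rho s * `|x - y|] by exists r.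
  move=> s; have [Ws|] := pselect (W s); last by exists 0.
  have [_ [d d0 H]] := HT s Ws.
  have m0 : 0 < Num.min d (D2 s / 2) by rewrite lt_min d0 divr_gt0// D20.
  exists (Num.min d (D2 s / 2)) => _; split => //.
    by rewrite ge_min lexx orbT.
  by move=> x y Bx By; apply: H; [apply: le_ball Bx|apply: le_ball By];
    rewrite ge_min lexx.
have [|g [gk gP]] := @smooth_gluing _ _ k Y W F C T rho r
    (fun s => th / 4 * D2 s ^+ 2) LA LAR oW.
  move=> s Ws; have [r0 rD rL] := rP s Ws; have [rho0 _] := HT s Ws.
  split => //; first by rewrite mulr_gt0 ?divr_gt0// exprn_gt0// D20.
  move=> y; rewrite ballE /= => sy; apply: (@capdistC_ball _ _ W s).
  by rewrite -/(D2 s); have := D20 s Ws; lra.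
exists g; split => // y Wy.
have bd s : W s -> ball s (r s) y -> `|s - y| < D2 s / 2.
  by move=> Ws; rewrite ballE /= => sy; have [_ rD _] := rP s Ws; exact: lt_le_trans rD.
have [|gF gD] := gP y Wy (th * D2 y ^+ 2).
  move=> s Ws /(bd s Ws)/capdist_half[_ H].
  by have := ler_wpM2l (ltW th0) H; rewrite -/(D2 s) -/(D2 y); lra.
split => // S K D K0 HK Dg; apply: gD => // s Ws /(bd s Ws) sy; apply: HK => //.
by have [H _] := capdist_half sy; rewrite -/(D2 s) -/(D2 y) in H *; lra.
Qed.

Lemma C1_loclip (W : set X) (g : X -> Y) s (rho : R) : open W -> Cn 1 W g -> W s ->
  0 < rho -> loclip g s (fderiv g s) rho.
Proof.
move=> oW gC Ws rho0.
have /(Cn0P _ oW)/(_ s Ws)/continuous_forP/(_ _ rho0)[d d0 Hd] := gC.2.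
have [r r0 rW] := open_ballP oW Ws.
pose m := Num.min d r; have m0 : 0 < m by rewrite lt_min d0.
exists m => // x y Bx By; apply: (mean_value (T := fderiv g)); first exact: ltW.
move=> t /andP[t0 t1] z.
have zm : `|s - z| < m.
  move: Bx By; rewrite !ballE /= => Bx By.
  have -> : s - z = (1 - t) *: (s - y) + t *: (s - x) by rewrite /z; lmod.
  apply: le_lt_trans (ler_normD _ _) _; rewrite !normrZ (ger0_norm t0) ger0_norm ?subr_ge0//.
  have [tz|tz] := eqVneq t 0; first by rewrite tz subr0 mul1r mul0r addr0.
  have tp : 0 < t by rewrite lt_def tz.
  have : (1 - t) * `|s - y| <= (1 - t) * m by rewrite ler_wpM2l ?subr_ge0// ltW.
  have : t * `|s - x| < t * m by rewrite ltr_pM2l.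
  lra.
move: zm; rewrite /m lt_min => /andP[zd zr].
split; last by apply: Hd; rewrite distrC.
by apply: CnS_has_deriv gC _; apply: rW; rewrite ballE.
Qed.

Lemma smoothing k (W : set X) (g : X -> Y) (th : R) : property_LA X Y k -> open W ->
  0 < th -> Cn 1 W g -> exists h : X -> Y, [/\ Ck k W h, Cn 1 W h &
   forall y, W y -> `|h y - g y| <= th * capdist (~` W) y ^+ 2 /\
     `|fderiv h y - fderiv g y| <= th * capdist (~` W) y ^+ 2].
Proof.
move=> LA oW th0 gC; set D2 := capdist (~` W).
have triv : Ck k W g -> exists h : X -> Y, [/\ Ck k W h, Cn 1 W h &
   forall y, W y -> `|h y - g y| <= th * D2 y ^+ 2 /\
     `|fderiv h y - fderiv g y| <= th * D2 y ^+ 2].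
  move=> gk; exists g; split => // y Wy; rewrite !subrr !normr0.
  by rewrite mulr_ge0 ?(ltW th0)// exprn_ge0// capdist_ge0.
(* A C^0 approximant would lose the derivative, but for k = 0 the map g can be kept. *)
have [k0|k1] : k = Cfinite 0 \/ forall h : X -> Y, Ck k W h -> Cn 1 W h.
  clear LA triv; case: k => [[|n]|]; [by left|right => h hk|right => h hk].
    exact: (Cn_le oW (ltn0Sn n) hk).
  exact: (hk 1%N).
  by apply: triv; rewrite k0; exact: CnW gC.
(* For trivial Y the pair (X, Y) yields no real functions on X, but then g is identically 0. *)
have [[v v0]|Y0] := pselect (exists v : Y, v != 0); last first.
  apply: triv; apply/CkP => n _.
  apply: (@Cn_eq _ _ _ _ _ (fun=> 0)) => //; last exact: Cn_cst.
  by move=> x _; apply: contrapT => gx; apply: Y0; exists (g x); apply/eqP => /esym.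
have LAR := LA_scalar v0 LA; have [C LAC] := LA; have C0 : 0 <= C by case: LAC.
have C1 : 0 < C + 1 by rewrite ltr_wpDl.
have D20 s : W s -> 0 < D2 s by exact: capdistC_gt0.
have ths s : W s -> 0 < th / 16 * D2 s ^+ 2.
  by move=> Ws; rewrite mulr_gt0 ?divr_gt0// exprn_gt0// D20.
have [r rP] : {r : X -> R | forall s, W s -> [/\ 0 < r s, r s <= D2 s / 2 &
    forall y, `|y - s| < r s -> `|fderiv g y - fderiv g s| <= th / 16 * D2 s ^+ 2]}.
  suff /choice[r rP] : forall s, exists r : R, W s -> [/\ 0 < r, r <= D2 s / 2 &
    forall y, `|y - s| < r -> `|fderiv g y - fderiv g s| <= th / 16 * D2 s ^+ 2] by exists r.
  move=> s; have [Ws|] := pselect (W s); last by exists 0.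
  have /(Cn0P _ oW)/(_ s Ws)/continuous_forP/(_ _ (ths s Ws))[d d0 Hd] := gC.2.
  have m0 : 0 < Num.min d (D2 s / 2) by rewrite lt_min d0 divr_gt0// D20.
  exists (Num.min d (D2 s / 2)) => _; split => //.
    by rewrite ge_min lexx orbT.
  by move=> y; rewrite lt_min => /andP[/Hd].
(* A C^1 map admits any positive local error; dividing by C + 1 neutralises the constant of
   (LA_k). *)
pose rho s := th / 16 * D2 s ^+ 2 / (C + 1).
have rho0 s : W s -> 0 < rho s by move=> Ws; rewrite divr_gt0// ths.
have [r' r'P] : {r' : X -> R | forall s, W s -> [/\ 0 < r' s, r' s <= r s &
    forall x y, ball s (r' s) x -> ball s (r' s) y ->
      `|g x - g y - fderiv g s (x - y)| <= rho s * `|x - y|]}.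
  suff /choice[r' rP'] : forall s, exists r' : R, W s -> [/\ 0 < r', r' <= r s &
    forall x y, ball s r' x -> ball s r' y ->
      `|g x - g y - fderiv g s (x - y)| <= rho s * `|x - y|] by exists r'.
  move=> s; have [Ws|] := pselect (W s); last by exists 0.
  have [d d0 Hd] := C1_loclip oW gC Ws (rho0 s Ws); have [r0 _ _] := rP s Ws.
  exists (Num.min d (r s)) => _; split; first by rewrite lt_min d0.
    by rewrite ge_min lexx orbT.
  by move=> x y Bx By; apply: Hd; [apply: le_ball Bx|apply: le_ball By];
    rewrite ge_min lexx.
have [|h [hk hP]] := @smooth_gluing _ _ k Y W g C (fderiv g) rho r'
    (fun s => th / 16 * D2 s ^+ 2) LAC LAR oW.
  move=> s Ws; have [r0 rr rL] := r'P s Ws; have [_ rD _] := rP s Ws.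
  split => //; [exact/ltW/rho0|exact: ths|].
  move=> y; rewrite ballE /= => sy; apply: (@capdistC_ball _ _ W s).
  by rewrite -/(D2 s); have := D20 s Ws; lra.
exists h; split; [exact: hk|exact: (k1 _ hk)|].
move=> y Wy.
have bd s : W s -> ball s (r' s) y -> [/\ `|s - y| < r s, `|s - y| < D2 s / 2 &
    th / 16 * D2 s ^+ 2 <= th / 2 * D2 y ^+ 2].
  move=> Ws; rewrite ballE /= => sy; have [_ rr _] := r'P s Ws; have [_ rD _] := rP s Ws.
  have sy2 : `|s - y| < D2 s / 2 by apply: lt_le_trans rD; exact: lt_le_trans rr.
  split => //; first exact: lt_le_trans rr.
  have [_ H] := capdist_half sy2; rewrite -/(D2 s) -/(D2 y) in H.
  have p0 : 0 <= th * D2 y ^+ 2 by rewrite mulr_ge0 ?(ltW th0)// exprn_ge0// capdist_ge0.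
  by have := ler_wpM2l (ltW th0) H; lra.
have [|hF hD] := hP y Wy (th / 2 * D2 y ^+ 2).
  by move=> s Ws /(bd s Ws)[].
have D2y : 0 <= D2 y ^+ 2 by rewrite exprn_ge0// capdist_ge0.
have thD : 0 <= th * D2 y ^+ 2 by rewrite mulr_ge0// ltW.
split; first by lra.
have -> : th * D2 y ^+ 2 = th / 2 * D2 y ^+ 2 + th / 2 * D2 y ^+ 2 by field.
apply: (hD _ _ _ _ (fderiv h y)); last exact: CnS_has_deriv (k1 _ hk) Wy.
  by rewrite mulr_ge0// divr_ge0// ltW.
move=> s Ws Bs; have [sr s2 _] := bd s Ws Bs; have [_ _ H] := rP s Ws.
have A1 : `|fderiv g s - fderiv g y| <= th / 16 * D2 s ^+ 2.
  by rewrite distrC; apply: H; rewrite distrC.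
have A2 : C * rho s <= th / 16 * D2 s ^+ 2.
  rewrite /rho mulrCA ler_piMr ?(ltW (ths s Ws))//.
  by rewrite ler_pdivrMr// mul1r lerDl.
have [_ A3] := capdist_half s2; rewrite -/(D2 s) -/(D2 y) in A3.
have := ler_wpM2l (ltW th0) A3; lra.
Qed.

End Smoothing.

(** * The extension theorem *)

Section Extension.
Context (R : realType) (X Y : normedModType R).

(** One tau is spent by the layers and one by each of the two approximations. *)
Lemma smooth_strict_extension k (Omega A : set X) (f FE : X -> Y) (G : X -> 'L(X, Y))
    (Q M C tau : R) :
  property_LA_with X Y (Cfinite 1) C -> property_LA X R^o (Cfinite 1) ->
  property_LA X Y k -> open Omega -> open (Omega `\` A) -> A `<=` Omega ->
  0 <= Q -> 0 <= M -> 0 < tau ->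
  (forall x, (Omega `\` A) x -> 0 < capdist A x) ->
  (forall x y, Omega x -> Omega y -> `|FE x - FE y| <= Q * `|x - y|) ->
  (forall x, A x -> FE x = f x) -> (forall x, A x -> `|G x| <= M) ->
  property_LLE Y A -> condition_W A f G ->
  exists h : X -> Y,
  [/\ Ck k (Omega `\` A) h /\ Cn 1 (Omega `\` A) h,
      forall x, (Omega `\` A) x -> `|fderiv h x| <= Num.max (C * Q) M + 3 * tau,
      forall a e, A a -> 0 < e -> exists2 d : R, 0 < d & forall x,
        (Omega `\` A) x -> `|x - a| < d -> `|fderiv h x - G a| <= e,
      forall a e, A a -> 0 < e -> exists2 d : R, 0 < d & forall x,
        (Omega `\` A) x -> `|x - a| < d ->
          `|h x - f a - G a (x - a)| <= e * `|x - a| &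
      forall x, (Omega `\` A) x -> `|h x - FE x| <= 3 * tau * capdist (~` Omega) x].
Proof.
move=> LA1 LAR LAk oOm oW AOm Q0 M0 tau0 Dgt0 FEL FEA GM LLE HW.
have C0 : 0 <= C by case: LA1.
have [F [T [rho [P1 P2 P3 P4]]]] :=
  strict_extension LAR oOm oW AOm Q0 M0 C0 tau0 Dgt0 FEL FEA GM LLE HW.
set W := Omega `\` A in oW Dgt0 P1 P2 P3 P4 *; set D2 := capdist (~` W).
have [|g [gC gP]] := @fine_approximation _ _ _ _ W F C tau T rho LA1 LAR oW tau0.
  by move=> s Ws; have [? ? _] := P1 s Ws.
have [h [hk hC hP]] := smoothing LAk oW tau0 gC.
have D2_le1 y : D2 y ^+ 2 <= D2 y.
  by rewrite expr2 ler_piMr ?capdist_ge0 ?capdist_le1.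
have D2_ge0 y : 0 <= D2 y ^+ 2 by rewrite exprn_ge0// capdist_ge0.
have AW a : A a -> (~` W) a by move=> Aa [].
have D2_near y a : A a -> D2 y <= `|y - a| by move=> /AW; exact: capdist_le.
have gD y : W y -> has_deriv g y (fderiv g y).
  by move=> Wy; exact: (@CnS_has_deriv _ _ 0 _ W g y gC Wy).
have hgF y : W y -> `|h y - F y| <= 2 * tau * D2 y ^+ 2.
  move=> Wy; have [A1 _] := gP y Wy; have [A2 _] := hP y Wy.
  rewrite -/(D2 y) in A1 A2.
  by have := ler_distD (g y) (h y) (F y); lra.
have dgh y S K : W y -> 0 <= K ->
    (forall s, W s -> `|s - y| < D2 y -> `|T s - S| + C * rho s <= K) ->
    `|fderiv h y - S| <= K + 2 * tau * D2 y ^+ 2.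
  move=> Wy K0 HK; have [_ A1] := gP y Wy; have [_ A2] := hP y Wy.
  have {}A1 := A1 S K _ K0 HK (gD y Wy); rewrite -/(D2 y) in A1 A2.
  apply: le_trans (ler_distD (fderiv g y) _ _) _.
  by apply: le_trans (lerD A2 A1) _; lra.
have max0 : 0 <= Num.max (C * Q) M by rewrite le_max M0 orbT.
exists h; split.
- by split.
- move=> x Wx; have K0 : 0 <= Num.max (C * Q) M + tau by lra.
  have := dgh x 0 _ Wx K0; rewrite subr0 => H; apply: le_trans (H _) _.
    by move=> s Ws _; rewrite subr0; have [] := P1 s Ws.
  have D1 : D2 x ^+ 2 <= 1 by apply: le_trans (D2_le1 x) (capdist_le1 _ _).
  by have := ler_wpM2l (ltW tau0) D1; lra.
- move=> a e Aa e0; have e2 : 0 < e / 2 by rewrite divr_gt0.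
  have [d d0 Hd] := P2 a _ Aa e2.
  have t2 : 0 <= 2 * tau by rewrite mulr_ge0// ltW.
  have [d1 /andP[d10 d11] d1t] := eps_small t2 e2.
  exists (Num.min (d / 2) d1); first by rewrite lt_min divr_gt0.
  move=> x Wx; rewrite lt_min => /andP[xd xd1].
  have Dxa := D2_near x a Aa; have Dx2 := D2_le1 x.
  apply: le_trans (dgh x (G a) (e / 2) Wx (ltW e2) _) _.
    move=> s Ws sx; apply: Hd => //.
    by have := ler_distD x s a; lra.
  have : D2 x ^+ 2 <= d1 by lra.
  by move=> /(ler_wpM2l t2); lra.
- move=> a e Aa e0; have e2 : 0 < e / 2 by rewrite divr_gt0.
  have [d d0 Hd] := P3 a _ Aa e2.
  have t2 : 0 <= 2 * tau by rewrite mulr_ge0// ltW.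
  have [d1 /andP[d10 d11] d1t] := eps_small t2 e2.
  exists (Num.min d d1); first by rewrite lt_min d0.
  move=> x Wx; rewrite lt_min => /andP[xd xd1].
  have A1 := Hd x Wx xd; have A2 := hgF x Wx.
  have Dxa := D2_near x a Aa.
  (* This is what the quadratic errors are for: at A they are o(|x - a|) and leave the derivative G
     a in place. *)
  have A3 : D2 x ^+ 2 <= d1 * `|x - a|.
    by rewrite expr2; apply: ler_pM => //; rewrite ?capdist_ge0//; lra.
  have A4 := ler_wpM2l t2 A3.
  have A5 : 2 * tau * (d1 * `|x - a|) <= e / 2 * `|x - a|.
    by rewrite mulrA ler_wpM2r// mulrC.
  have -> : h x - f a - G a (x - a) = (h x - F x) + (F x - f a - G a (x - a)) by lmod.
  by apply: le_trans (ler_normD _ _) _; lra.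
- move=> x Wx; have A1 := P4 x Wx; have A2 := hgF x Wx; have A3 := D2_le1 x.
  have A4 : D2 x <= capdist (~` Omega) x by apply: capdist_sub => z Oz [].
  have := ler_distD (F x) (h x) (FE x).
  have : 2 * tau * D2 x ^+ 2 <= 2 * tau * capdist (~` Omega) x.
    by rewrite ler_wpM2l ?mulr_ge0 ?(ltW tau0)//; lra.
  lra.
Qed.

Lemma C1_extension k (Omega A : set X) (f FE : X -> Y) (G : X -> 'L(X, Y))
    (Q M C S : R) :
  property_LA_with X Y (Cfinite 1) C -> property_LA X R^o (Cfinite 1) ->
  property_LA X Y k -> open Omega -> open (Omega `\` A) -> A `<=` Omega ->
  0 <= Q -> 0 <= M -> 1 <= C -> 0 < S ->
  (forall x, (Omega `\` A) x -> 0 < capdist A x) ->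
  (forall x y, Omega x -> Omega y -> `|FE x - FE y| <= Q * `|x - y|) ->
  (forall x, A x -> FE x = f x) -> (forall x, A x -> `|G x| <= M) ->
  property_LLE Y A -> condition_W A f G ->
  exists g : X -> Y,
  [/\ forall x, A x -> g x = f x,
      forall x y, Omega x -> Omega y ->
        `|g x - g y| <= (Num.max (C * Q) M + S) * `|x - y|,
      Cn 1 Omega g,
      forall x, A x -> fderiv g x = G x &
      Ck k (Omega `\` A) g].
Proof.
move=> LA1 LAR LAk oOm oW AOm Q0 M0 C1 S0 Dgt0 FEL FEA GM LLE HW.
pose tau := S / 3; have tau0 : 0 < tau by rewrite divr_gt0.
have [h [[hk hC] hD hDa ha hFE]] := smooth_strict_extension LA1 LAR LAk oOm oW AOm
  Q0 M0 tau0 Dgt0 FEL FEA GM LLE HW.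
set W := Omega `\` A in oW Dgt0 hk hC hD hDa ha hFE *.
have tauS : 3 * tau = S by rewrite /tau; field.
rewrite tauS in hFE hD.
pose g x := if `[< A x >] then f x else h x.
pose Dg x := if `[< A x >] then G x else fderiv h x.
have gA x : A x -> g x = f x by move=> Ax; rewrite /g asboolT.
have gW x : W x -> g x = h x by move=> [_ Ax]; rewrite /g asboolF.
have DgA x : A x -> Dg x = G x by move=> Ax; rewrite /Dg asboolT.
have DgW x : W x -> Dg x = fderiv h x by move=> [_ Ax]; rewrite /Dg asboolF.
have AW x : Omega x -> A x \/ W x by move=> Ox; have [?|?] := pselect (A x); [left|right].
have gDg x : Omega x -> has_deriv g x (Dg x).
  move=> Ox; have [Ax|Wx] := AW x Ox; last first.
    rewrite DgW//; apply: (has_deriv_eq (f := h) oW Wx) => [y Wy|]; first by rewrite gW.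
    exact: CnS_has_deriv hC Wx.
  rewrite DgA// => e e0.
  have [d d0 Hd] := ha x e Ax e0; have [d' d'0 Hd'] := HW.2 x Ax e e0.
  have [r r0 rO] := open_ballP oOm Ox.
  exists (Num.min (Num.min d d') r); first by rewrite !lt_min d0 d'0.
  move=> y; rewrite !lt_min => /andP[/andP[yd yd'] yr]; rewrite (gA x)//.
  have [|Ay|Wy] := AW y; first by apply: rO; rewrite ballE /= distrC.
    rewrite gA//; apply: Hd'; split => //; first exact: ballxx.
    by rewrite ballE /= distrC.
  by rewrite gW//; exact: Hd.
have Dgc x : Omega x -> {for x, continuous Dg}.
  move=> Ox; apply/continuous_forP => e e0.
  have [Ax|Wx] := AW x Ox; last first.
    have /(Cn0P _ oW)/(_ x Wx)/continuous_forP/(_ _ e0)[d d0 Hd] := hC.2.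
    have [r r0 rW] := open_ballP oW Wx.
    exists (Num.min d r); first by rewrite lt_min d0.
    move=> y; rewrite lt_min => /andP[yd yr]; rewrite (DgW x)// DgW; first exact: Hd.
    by apply: rW; rewrite ballE /= distrC.
  have [d d0 Hd] := hDa x e Ax e0.
  have [d' d'0 Hd'] := within_continuous_eps HW.1 Ax e0.
  have [r r0 rO] := open_ballP oOm Ox.
  exists (Num.min (Num.min d d') r); first by rewrite !lt_min d0 d'0.
  move=> y; rewrite !lt_min => /andP[/andP[yd yd'] yr]; rewrite (DgA x)//.
  have [|Ay|Wy] := AW y; first by apply: rO; rewrite ballE /= distrC.
    by rewrite DgA//; apply: Hd' => //; rewrite distrC.
  by rewrite DgW//; exact: Hd.
have Dgb x : Omega x -> `|Dg x| <= Num.max (C * Q) M + S.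
  move=> Ox; have [Ax|Wx] := AW x Ox; last by rewrite DgW// hD.
  rewrite DgA//; apply: le_trans (GM x Ax) _.
  have : M <= Num.max (C * Q) M by rewrite le_max lexx orbT.
  lra.
have QC : Q <= Num.max (C * Q) M by rewrite le_max ler_peMl.
have gFE x : Omega x -> `|g x - FE x| <= S * capdist (~` Omega) x.
  move=> Ox; have [Ax|Wx] := AW x Ox; last by rewrite gW// hFE.
  by rewrite gA// FEA// subrr normr0 mulr_ge0 ?capdist_ge0// ltW.
exists g; split.
- exact: gA.
- move=> x y Ox Oy; have K0 : 0 <= Num.max (C * Q) M + S by lra.
  have [seg|] := pselect (forall t : R, 0 <= t <= 1 -> Omega (y + t *: (x - y))).
    have := @mean_value _ _ _ g Dg 0 y x _ K0.
    rewrite -[(0 : 'L(X, Y)) (x - y)]/(0 : Y) subr0; apply => t t01 z.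
    by have Oz := seg t t01; split; [exact: gDg|rewrite subr0; exact: Dgb].
  (* The segment leaves Omega at z, so the distances of x and y to the complement add up to at most
     |x - y|: passing from g to [FE] at both ends costs S |x - y|, and [FE] is Q-Lipschitz with Q <=
     C Q. *)
  move=> /existsNP[t /not_implyP[/andP[t0 t1] nO]].
  set z := y + t *: (x - y) in nO.
  have xz : `|x - z| = (1 - t) * `|x - y|.
    have -> : x - z = (1 - t) *: (x - y) by rewrite /z; lmod.
    by rewrite normrZ ger0_norm// subr_ge0.
  have yz : `|y - z| = t * `|x - y|.
    have -> : y - z = - (t *: (x - y)) by rewrite /z; lmod.
    by rewrite normrN normrZ ger0_norm.
  have A1 := capdist_le x (nO : (~` Omega) z); have A2 := capdist_le y (nO : (~` Omega) z).
  have B1 := ler_wpM2l (ltW S0) A1; have B2 := ler_wpM2l (ltW S0) A2.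
  have C1' := gFE x Ox; have C2 := gFE y Oy; have C3 := FEL x y Ox Oy.
  rewrite xz in B1; rewrite yz in B2.
  have -> : g x - g y = (g x - FE x) + (FE x - FE y) - (g y - FE y) by lmod.
  have := ler_normB ((g x - FE x) + (FE x - FE y)) (g y - FE y).
  have := ler_normD (g x - FE x) (FE x - FE y).
  have := ler_wpM2r (normr_ge0 (x - y)) QC; lra.
- by apply: (CnSP oOm gDg); apply/(Cn0P _ oOm).
- by move=> x Ax; have /has_derivP[_ ->] := gDg x (AOm _ Ax); exact: DgA.
- by apply/CkP => n nk; move/CkP : hk => /(_ n nk); apply: Cn_eq => // x Wx; rewrite gW.
Qed.

End Extension.

Theorem theorem55 (R : realType) (X : normedModType R)
  (Y : completeNormedModType R) (C_A C_M C_E : R) (k : smoothness)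
  (Omega A : set X) (L M eta : R) (f : X -> Y) (G : X -> 'L(X, Y)) :
  1 <= C_A -> property_LA_with X Y (Cfinite 1) C_A ->
  1 <= C_M -> property_LA_with X R^o (Cfinite 1) C_M ->
  property_LA X Y k ->
  open Omega ->
  (exists2 F : set X, closed F & A = Omega `&` F) ->
  (forall x, Omega x -> connected_component Omega x `&` A !=set0) ->
  1 <= C_E -> lipschitz_extension Y C_E A Omega ->
  property_LLE Y A ->
  0 <= L -> 0 <= M ->
  L.-lipschitz_A f ->
  condition_W A f G ->
  (forall x, A x -> `|G x| <= M) ->
  1 < eta ->
  exists g : X -> Y,
    [/\ forall x, A x -> g x = f x,
        (Num.max (C_A * C_E * L) M + eta * C_M * (C_E * L + M)).-lipschitz_Omega g,
        Ck (Cfinite 1) Omega g,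
        forall x, A x -> fderiv g x = G x
      & Ck k (Omega `\` A) g].
Proof.
move=> CA1 LA1 CM1 LAR LAk oOm [F cF AE] _ CE1 Ext LLE L0 M0 fL HW GM eta1.
have AOm : A `<=` Omega by rewrite AE => x [].
have WE : Omega `\` A = Omega `&` ~` F.
  rewrite AE; apply/seteqP; split => x [Ox nF]; split => //.
    by move=> Fx; apply: nF.
  by case.
have oW : open (Omega `\` A) by rewrite WE; apply: openI => //; exact: closed_openC.
have Dgt0 x : (Omega `\` A) x -> 0 < capdist A x.
  rewrite WE => -[_ nF]; apply: lt_le_trans (capdistC_gt0 (closed_openC cF) nF) _.
  by apply: capdist_sub => y; rewrite AE setCK => -[].
have [FE /lipschitzP FEL FEA] := Ext L f L0 fL.
have Q0 : 0 <= C_E * L by rewrite mulr_ge0//; lra.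
(* A positive C_E L + M serves as the excess S, being at most eta C_M (C_E L + M). If it is 0, then
   G = 0 on A and [FE] is constant on Omega, so [FE] itself is the extension. *)
have [S0|S0] := ltP 0 (C_E * L + M).
  have [g [g1 g2 g3 g4 g5]] := C1_extension LA1 (ex_intro _ C_M LAR) LAk oOm oW AOm
    Q0 M0 CA1 S0 Dgt0 FEL FEA GM LLE HW.
  exists g; split; [exact: g1| |exact: g3|exact: g4|exact: g5].
  apply/lipschitzP => x y Ox Oy.
  apply: le_trans (g2 x y Ox Oy) _; rewrite mulrA ler_wpM2r// lerD2l.
  by rewrite ler_peMl ?(ltW S0)// mulr_ege1// ltW.
have QE : C_E * L = 0 by lra.
have ME : M = 0 by lra.
have FEc x y : Omega x -> Omega y -> FE x = FE y.
  move=> Ox Oy; apply/eqP; rewrite -subr_eq0 -normr_le0.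
  by have := FEL x y Ox Oy; rewrite QE mul0r.
have FEn n : Cn n Omega FE.
  apply: Cn_local => // x Ox; have [r r0 rO] := open_ballP oOm Ox.
  exists r => //; apply: (@Cn_eq _ _ _ _ _ (fun=> FE x)); first exact: ball_open.
    by move=> y /rO Oy; exact: FEc.
  exact/Cn_cst/ball_open.
exists FE; split.
- exact: FEA.
- apply/lipschitzP => x y Ox Oy; rewrite (FEc x y)// subrr normr0 mulr_ge0//.
  by rewrite QE ME addr0 mulr0 addr0 le_max lexx orbT.
- exact: FEn.
- move=> x Ax; have Ox := AOm _ Ax.
  have -> : G x = 0.
    by apply/eqP; rewrite -normr_le0; have := GM x Ax; rewrite ME.
  have /has_derivP[] // : has_deriv FE x (0 : 'L(X, Y)).
  apply: (has_deriv_eq (f := fun=> FE x) oOm Ox); last exact: has_deriv_cst.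
  by move=> y Oy; exact: FEc.
- apply/CkP => n _; apply: (Cn_sub oW oOm) => //.
Qed.
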